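(* The adjunction $(-)_{\le1}:\mathbf{Cpx}\rightleftarrows\mathbf{Gr}:\mathrm{C}\ell$, with $\mathbf{Cpx}$ carrying the Thomason model structure and $\mathbf{Gr}$ the Matsushita model structure, is a Quillen equivalence.
   Context: A simplicial complex $K$ consists of a set $V(K)$ and a collection of nonempty finite subsets (simplices) containing all singletons and closed under nonempty subsets; maps are vertex functions sending simplices to simplices; $\mathbf{Cpx}$ is the category. $\mathbf{Gr}$ (reflexive graphs) is the full subcategory of complexes all of whose simplices have at most two elements. $\mathrm{C}\ell:\mathbf{Gr}\to\mathbf{Cpx}$ is the clique complex functor, with left adjoint the 1-skeleton functor $(-)_{\le1}$. $\mathbf{\Delta}^n$ is the complex on $\{0,\dots,n\}$ with all nonempty subsets simplices, $\mathrm{Sing}(K)_n=\mathbf{Cpx}(\mathbf{\Delta}^n,K)$, and $\mathrm{Ex}$ is the right adjoint of barycentric subdivision. Thomason model structure on $\mathbf{Cpx}$: $f$ is a weak equivalence iff $\mathrm{Sing}(f)$ is a weak homotopy equivalence, a fibration iff $\mathrm{Ex}^2\mathrm{Sing}(f)$ is a Kan fibration, cofibrations are maps with the left lifting property against trivial fibrations. Matsushita model structure on $\mathbf{Gr}$: $f$ is a weak equivalence (fibration) iff $\mathrm{C}\ell(f)$ is a Thomason weak equivalence (fibration), cofibrations defined by left lifting against trivial fibrations. *)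

(* Defs.v *)
From mathcomp Require Import all_boot.
From Stdlib Require Import FunctionalExtensionality ProofIrrelevance Relations.

Set Implicit Arguments.
Unset Strict Implicit.
Unset Printing Implicit Defensive.

Definition pfinite {V : Type} (S : V -> Prop) : Prop :=
  exists (n : nat) (g : 'I_n -> V), forall x, S x -> exists i, g i = x.
Definition pnonempty {V : Type} (S : V -> Prop) : Prop := exists x, S x.
Definition psub {V : Type} (T S : V -> Prop) : Prop := forall x, T x -> S x.
Definition pimage {V W : Type} (f : V -> W) (S : V -> Prop) : W -> Prop :=
  fun y => exists x, S x /\ f x = y.
Definition ppair {V : Type} (a b : V) : V -> Prop := fun x => x = a \/ x = b.

Record Cpx := {
  vert : Type;
  simplex : (vert -> Prop) -> Prop;
  simplex_fin : forall S, simplex S -> pfinite S /\ pnonempty S;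
  simplex_single : forall v, simplex (fun x => x = v);
  simplex_sub : forall S T, simplex S -> psub T S -> pnonempty T -> simplex T
}.
Arguments simplex : clear implicits.

Record CMap (K L : Cpx) := {
  cfun :> vert K -> vert L;
  cfun_simplex : forall S, simplex K S -> simplex L (pimage cfun S)
}.

Lemma cmap_eq K L (f g : CMap K L) : (forall v, f v = g v) -> f = g.
Proof.
case: f => f hf; case: g => g hg /= e.
have E : f = g by apply: functional_extensionality.
subst g; f_equal; apply: proof_irrelevance.
Qed.

Definition cmcomp K L M (g : CMap L M) (f : CMap K L) : CMap K M.
Proof.
refine {| cfun := fun v => g (f v) |}.
move=> S hS; have h := cfun_simplex g (cfun_simplex f hS).
have [_ [x Sx]] := simplex_fin hS.
apply: (simplex_sub h).
- by move=> y [x' [Sx' <-]]; exists (f x'); split=> //; exists x'.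
- by exists (g (f x)); exists x.
Defined.

Definition Delta (n : nat) : Cpx.
Proof.
refine {| vert := 'I_n.+1; simplex := fun S => pnonempty S |}.
- move=> S hS; split=> //; exists n.+1, id => x _; by exists x.
- by move=> v; exists v.
- by [].
Defined.

Definition isGraph (K : Cpx) : Prop :=
  forall S, simplex K S -> exists a b, psub S (ppair a b).

Definition Gr := { K : Cpx | isGraph K }.
Definition GrCpx (G : Gr) : Cpx := proj1_sig G.
Coercion GrCpx : Gr >-> Cpx.

Definition Cl (G : Gr) : Cpx.
Proof.
refine {| vert := vert G;
          simplex := fun S => pfinite S /\ pnonempty S /\
                       forall a b, S a -> S b -> simplex G (ppair a b) |}.
- by move=> S [? [? _]].
- move=> v; split; first by exists 1, (fun _ => v) => x ->; exists ord0.
  split; first by exists v.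
  move=> a b -> ->; apply: (simplex_sub (simplex_single v)).
  + by move=> x [].
  + by exists v; left.
- move=> S T [[n [g hg]] [_ hS]] hTS hT; split; last split=> //.
  + by exists n, g => x /hTS /hg.
  + by move=> a b /hTS ha /hTS hb; apply: hS.
Defined.

Definition ClMap (G H : Gr) (f : CMap G H) : CMap (Cl G) (Cl H).
Proof.
refine (@Build_CMap (Cl G) (Cl H) (fun v => f v) _).
move=> S [[n [g hg]] [[x Sx] hS]]; split; last split.
- exists n, (fun i => f (g i)) => y [x' [/hg [i <-] <-]]; by exists i.
- by exists (f x), x.
- move=> a b [x1 [S1 <-]] [x2 [S2 <-]].
  apply: (simplex_sub (cfun_simplex f (hS _ _ S1 S2))).
  + by move=> y [] ->; [exists x1; split=> //; left | exists x2; split=> //; right].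
  + by exists (f x1); left.
Defined.

Definition skelCpx (K : Cpx) : Cpx.
Proof.
refine {| vert := vert K;
          simplex := fun S => simplex K S /\ exists a b, psub S (ppair a b) |}.
- by move=> S [/simplex_fin].
- move=> v; split; first exact: simplex_single.
  by exists v, v => x ->; left.
- move=> S T [hS [a [b hab]]] hTS hT; split; first exact: simplex_sub hS hTS hT.
  by exists a, b => x /hTS /hab.
Defined.

Definition skel (K : Cpx) : Gr.
Proof. exists (skelCpx K); by move=> S [_ h]. Defined.

Definition skelMap (K L : Cpx) (f : CMap K L) : CMap (skel K) (skel L).
Proof.
refine (@Build_CMap (skel K) (skel L) (fun v => f v) _).
move=> S [hS [a [b hab]]]; split; first exact: (cfun_simplex f hS).
by exists (f a), (f b) => y [x [/hab [] -> <-]]; [left | right].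
Defined.

Definition adjunct (K : Cpx) (G : Gr) (f : CMap (skel K) G) : CMap K (Cl G).
Proof.
refine (@Build_CMap K (Cl G) (fun v => f v) _).
move=> S hS; have [[n [g hg]] [x Sx]] := simplex_fin hS.
split; last split.
- exists n, (fun i => f (g i)) => y [x' [/hg [i <-] <-]]; by exists i.
- by exists (f x), x.
- move=> a b [x1 [S1 <-]] [x2 [S2 <-]].
  have h12 : simplex (skel K) (ppair x1 x2).
    split; last by exists x1, x2.
    apply: (simplex_sub hS); first by move=> y [] ->.
    by exists x1; left.
  apply: (simplex_sub (cfun_simplex f h12)).
  + by move=> y [] ->; [exists x1; split=> //; left | exists x2; split=> //; right].
  + by exists (f x1); left.
Defined.

Definition EmptyCpx : Cpx.
Proof.
refine {| vert := Empty_set; simplex := fun _ => False |}; try by [].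
all: by case.
Defined.

Definition initMap (K : Cpx) : CMap EmptyCpx K.
Proof. refine (@Build_CMap EmptyCpx K (fun v : Empty_set => match v with end) _); by []. Defined.

Definition TermGr : Gr.
Proof.
exists (Delta 0) => S _; exists ord0, ord0 => x _; left; exact: ord1.
Defined.

Definition termMap (G : Gr) : CMap G TermGr.
Proof.
refine (@Build_CMap G TermGr (fun _ => (ord0 : 'I_1)) _).
move=> S /simplex_fin [_ [x Sx]]; by exists ord0, x.
Defined.

Record Dmap (m n : nat) := {
  dfun :> 'I_m.+1 -> 'I_n.+1;
  dmono : forall i j : 'I_m.+1, i <= j -> dfun i <= dfun j
}.

Definition did (n : nat) : Dmap n n := {| dfun := id; dmono := fun i j h => h |}.
Definition dcomp l m n (g : Dmap m n) (f : Dmap l m) : Dmap l n :=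
  {| dfun := fun i => g (f i); dmono := fun i j h => dmono g (dmono f h) |}.

Lemma dmap_eq m n (f g : Dmap m n) : (forall i, f i = g i) -> f = g.
Proof.
case: f => f hf; case: g => g hg /= e.
have E : f = g by apply: functional_extensionality.
subst g; f_equal; apply: proof_irrelevance.
Qed.

Lemma sig_eq (A : Type) (P : A -> Prop) (x y : {a | P a}) :
  proj1_sig x = proj1_sig y -> x = y.
Proof. case: x => x hx; case: y => y hy /= E; subst y; f_equal; exact: proof_irrelevance. Qed.

Record SSet := {
  sx :> nat -> Type;
  sact : forall m n, Dmap m n -> sx n -> sx m;
  sact_id : forall n (x : sx n), sact (did n) x = x;
  sact_comp : forall l m n (f : Dmap l m) (g : Dmap m n) (x : sx n),
      sact (dcomp g f) x = sact f (sact g x)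
}.
Arguments sact s {m n} _ _.

Unset Implicit Arguments.
Record SMap (X Y : SSet) := {
  smap :> forall n, X n -> Y n;
  snat : forall m n (f : Dmap m n) (x : X n),
      smap m (sact X f x) = sact Y f (smap n x)
}.
Set Implicit Arguments.
Arguments smap {X Y} _ _ _.
Arguments snat {X Y} _ {m n} _ _.

Lemma smap_eq X Y (f g : SMap X Y) : (forall n x, f n x = g n x) -> f = g.
Proof.
case: f => f hf; case: g => g hg /= e.
have E : f = g.
  apply: functional_extensionality_dep => n.
  by apply: functional_extensionality => x.
subst g; f_equal; apply: proof_irrelevance.
Qed.

Definition scomp X Y Z (g : SMap Y Z) (f : SMap X Y) : SMap X Z.
Proof.
refine {| smap := fun n x => g n (f n x) |}.
by move=> m n h x; rewrite snat snat.
Defined.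

Definition Std (n : nat) : SSet.
Proof.
refine {| sx := fun m => Dmap m n; sact := fun m m' f x => dcomp x f |}.
- by move=> m x; apply: dmap_eq.
- by move=> l m m' f g x; apply: dmap_eq.
Defined.

Definition hornP (n : nat) (k : 'I_n.+1) (m : nat) (t : Dmap m n) : Prop :=
  exists j : 'I_n.+1, j != k /\ forall i, t i != j.

Lemma hornP_act n k m m' (f : Dmap m' m) (t : Dmap m n) :
  hornP k t -> hornP k (dcomp t f).
Proof. case=> j [hj ht]; exists j; split=> // i; exact: ht. Qed.

Definition Horn (n : nat) (k : 'I_n.+1) : SSet.
Proof.
refine {| sx := fun m => { t : Dmap m n | hornP k t };
          sact := fun m m' (f : Dmap m m') (x : { t : Dmap m' n | hornP k t }) =>
                    exist _ (dcomp (proj1_sig x) f)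
                                    (hornP_act f (proj2_sig x)) |}.
- by move=> m x; apply: sig_eq; apply: dmap_eq.
- by move=> l m m' f g x; apply: sig_eq; apply: dmap_eq.
Defined.

Definition horn_incl (n : nat) (k : 'I_n.+1) : SMap (Horn k) (Std n).
Proof.
refine (@Build_SMap (Horn k) (Std n) (fun m (x : Horn k m) => proj1_sig x) _).
by [].
Defined.

Definition kanfib (X Y : SSet) (p : SMap X Y) : Prop :=
  forall (n : nat) (k : 'I_n.+1), 0 < n ->
  forall (a : SMap (Horn k) X) (b : SMap (Std n) Y),
    (forall m x, p m (a m x) = b m (horn_incl k m x)) ->
    exists c : SMap (Std n) X,
      (forall m x, c m (horn_incl k m x) = a m x) /\
      (forall m x, p m (c m x) = b m x).

Definition kan (Z : SSet) : Prop :=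
  forall (n : nat) (k : 'I_n.+1), 0 < n ->
  forall a : SMap (Horn k) Z,
    exists c : SMap (Std n) Z, forall m x, c m (horn_incl k m x) = a m x.

Definition Prod (X Y : SSet) : SSet.
Proof.
refine {| sx := fun n => (X n * Y n)%type;
          sact := fun m n f x => (sact X f x.1, sact Y f x.2) |}.
- by move=> n [x y] /=; rewrite !sact_id.
- by move=> l m n f g [x y] /=; rewrite !sact_comp.
Defined.

(** Constant maps [[m] -> [1]] (the two vertices of [Δ[1]] in degree m). *)
Definition cst (m : nat) (i : 'I_2) : Dmap m 1 :=
  {| dfun := fun _ => i; dmono := fun _ _ _ => leqnn i |}.

Definition ehomot (X Z : SSet) (g h : SMap X Z) : Prop :=
  exists H : SMap (Prod X (Std 1)) Z,
    (forall n (x : X n), H n (x, cst n ord0) = g n x) /\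
    (forall n (x : X n), H n (x, cst n ord_max) = h n x).

Definition homot (X Z : SSet) : SMap X Z -> SMap X Z -> Prop :=
  clos_refl_sym_trans (SMap X Z) (@ehomot X Z).

(** Weak homotopy equivalences of simplicial sets: [f : X -> Y] such that
    for every Kan complex [Z], precomposition with [f] induces a bijection
    [[Y, Z] -> [X, Z]] on simplicial homotopy classes. *)
Definition sweq (X Y : SSet) (f : SMap X Y) : Prop :=
  forall Z : SSet, kan Z ->
    (forall g : SMap X Z, exists h : SMap Y Z, homot (scomp h f) g) /\
    (forall h1 h2 : SMap Y Z, homot (scomp h1 f) (scomp h2 f) -> homot h1 h2).

(** Barycentric subdivision [sd Δ[n]]: the nerve of the poset of nonempty
    subsets of [[n]] ordered by inclusion. *)
Definition sdP (n m : nat) (c : 'I_m.+1 -> {set 'I_n.+1}) : Prop :=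
  (forall i, c i != set0) /\ (forall i j : 'I_m.+1, i <= j -> c i \subset c j).

Lemma sdP_act n m m' (f : Dmap m' m) (c : 'I_m.+1 -> {set 'I_n.+1}) :
  sdP c -> sdP (fun i => c (f i)).
Proof. case=> h1 h2; split=> // i j hij; apply: h2; exact: dmono. Qed.

Definition Sd (n : nat) : SSet.
Proof.
refine {| sx := fun m => { c : 'I_m.+1 -> {set 'I_n.+1} | sdP c };
          sact := fun m m' (f : Dmap m m')
                        (x : { c : 'I_m'.+1 -> {set 'I_n.+1} | sdP c }) =>
                    exist _ (fun i => proj1_sig x (f i))
                                    (sdP_act f (proj2_sig x)) |}.
- by move=> m x; apply: sig_eq.
- by move=> l m m' f g x; apply: sig_eq.
Defined.

Lemma sdP_img n' n m (t : Dmap n' n) (c : 'I_m.+1 -> {set 'I_n'.+1}) :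
  sdP c -> sdP (fun i => [set t y | y in c i]).
Proof.
case=> h1 h2; split=> [i|i j hij]; first by rewrite imset_eq0.
apply: imsetS; exact: h2.
Qed.

Definition sdmap (n' n : nat) (t : Dmap n' n) : SMap (Sd n') (Sd n).
Proof.
refine (@Build_SMap (Sd n') (Sd n)
  (fun m (x : Sd n' m) => exist _ (fun i => [set t y | y in proj1_sig x i])
                                 (sdP_img t (proj2_sig x))) _).
by move=> m m' f x; apply: sig_eq.
Defined.

(** Kan's [Ex]: [Ex(X)_n = sSet(sd Δ[n], X)], the right adjoint of
    barycentric subdivision. *)
Definition Ex (X : SSet) : SSet.
Proof.
refine {| sx := fun n => SMap (Sd n) X;
          sact := fun m n f a => scomp a (sdmap f) |}.
- move=> n a; apply: smap_eq => m x /=; congr (a m _).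
  apply: sig_eq; apply: functional_extensionality => i /=; exact: imset_id.
- move=> l m n f g a; apply: smap_eq => m' x /=; congr (a m' _).
  apply: sig_eq; apply: functional_extensionality => i /=.
  exact: (imset_comp g f).
Defined.

Definition ExMap (X Y : SSet) (f : SMap X Y) : SMap (Ex X) (Ex Y).
Proof.
refine (@Build_SMap (Ex X) (Ex Y) (fun n (a : Ex X n) => scomp f a) _).
by move=> m n t a; apply: smap_eq.
Defined.

Definition DeltaMap (m n : nat) (t : Dmap m n) : CMap (Delta m) (Delta n).
Proof.
refine (@Build_CMap (Delta m) (Delta n) (fun i => t i) _).
move=> S [x Sx]; by exists (t x), x.
Defined.

Definition Sing (K : Cpx) : SSet.
Proof.
refine {| sx := fun n => CMap (Delta n) K;
          sact := fun m n t s => cmcomp s (DeltaMap t) |}.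
- by move=> n s; apply: cmap_eq.
- by move=> l m n f g s; apply: cmap_eq.
Defined.

Definition SingMap (K L : Cpx) (f : CMap K L) : SMap (Sing K) (Sing L).
Proof.
refine (@Build_SMap (Sing K) (Sing L) (fun n (s : Sing K n) => cmcomp f s) _).
by move=> m n t s; apply: cmap_eq.
Defined.

Definition T_weq (K L : Cpx) (f : CMap K L) : Prop := sweq (SingMap f).
Definition T_fib (K L : Cpx) (f : CMap K L) : Prop :=
  kanfib (ExMap (ExMap (SingMap f))).
Definition T_cof (A B : Cpx) (i : CMap A B) : Prop :=
  forall (X Y : Cpx) (p : CMap X Y), T_fib p -> T_weq p ->
  forall (a : CMap A X) (b : CMap B Y), (forall v, p (a v) = b (i v)) ->
  exists c : CMap B X, (forall v, c (i v) = a v) /\ (forall v, p (c v) = b v).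

Definition M_weq (G H : Gr) (f : CMap G H) : Prop := T_weq (ClMap f).
Definition M_fib (G H : Gr) (f : CMap G H) : Prop := T_fib (ClMap f).
Definition M_cof (A B : Gr) (i : CMap A B) : Prop :=
  forall (X Y : Gr) (p : CMap X Y), M_fib p -> M_weq p ->
  forall (a : CMap A X) (b : CMap B Y), (forall v, p (a v) = b (i v)) ->
  exists c : CMap B X, (forall v, c (i v) = a v) /\ (forall v, p (c v) = b v).

Definition T_cofibrant (K : Cpx) : Prop := T_cof (initMap K).
Definition M_fibrant (G : Gr) : Prop := M_fib (termMap G).

(* Main.v *)
Require Import Defs.
From mathcomp Require Import all_boot zify.
From Stdlib Require Import FunctionalExtensionality PropExtensionality.
From Stdlib Require Import ProofIrrelevance ClassicalEpsilon Relations.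

(** Both halves rest on one explicit factorization.  For [phi : K -> L] let [P] be obtained from [K]
    by freely attaching all lifting problems [Sd^2 Lambda^n_k -> Sd^2 Delta^n] over [L]; then
    [P -> L] is a Thomason fibration by construction.  Each attached cell splits, by the Dwyer
    property of the second subdivision, into a collar whose links in the old part are cones and a
    remainder glued along a pair that contracts inside itself.  This description survives the passage
    to clique complexes, so both [K -> P] and [Cl K_{<=1} -> Cl P_{<=1}] have the extension property
    against Kan complexes, together with its relative version, and are weak equivalences.

    A trivial cofibration [i] is then a retract of [K -> P], so [Cl i_{<=1}] is a weak equivalence.
    For cofibrant [K], apply the factorization to a weak equivalence [Q -> K] from a flag complex:
    [K] is a retract of [P], the unit [Q -> Cl Q_{<=1}] is an isomorphism, hence the units of [P]
    and of [K] are weak equivalences, and the adjunct of [f] is [Cl f] composed with the unit. *)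

Set Implicit Arguments.
Unset Strict Implicit.
Unset Printing Implicit Defensive.

(** * Extension of partial maps *)

(** Weak equivalences are tested by mapping into Kan complexes, so acyclicity can be phrased as
    extension of partial maps and carried through gluings and filtrations, without realizations or
    homology.

    The obstacle is that passing to the clique complex of the 1-skeleton does not commute with
    attaching cells: a clique could combine vertices of several cells. What saves the argument is
    that both properties used of a cell can be read off edges. A vertex off the collar is joined,
    among vertices of at most its rank, only to vertices of its own cell outside the horn. A cone
    point may be added to a clique as soon as it is joined to each vertex. The second subdivision
    provides both: its vertices are flags of faces, and a flag with some faces in the horn has a
    definite horn part, which serves as cone point. The same filtration therefore treats both
    complexes. *)

Definition spred (X : SSet) := forall n, X n -> Prop.

Definition sclosed (X : SSet) (P : spred X) : Prop :=
  forall m n (f : Dmap m n) (x : X n), P n x -> P m (sact X f x).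

Definition sfull (X : SSet) : spred X := fun _ _ => True.

(** Subobjects are predicates on one ambient simplicial set, so that filtrations need no inclusions.
    Naturality takes both membership proofs, hence closure of [P] under faces is not built in. *)
Record partmap (X : SSet) (P : spred X) (Z : SSet) := {
  pfun :> forall n (x : X n), P n x -> Z n;
  partnat : forall m n (f : Dmap m n) (x : X n) (h : P n x) (h' : P m (sact X f x)),
      pfun h' = sact Z f (pfun h)
}.

Arguments partnat {X P Z} p {m n} f x h h'.

Lemma partfunE X (P : spred X) Z (g : partmap P Z) n (x y : X n) (hx : P n x) (hy : P n y) :
  x = y -> g n x hx = g n y hy.
Proof. by move=> E; subst y; congr (pfun g _); apply: proof_irrelevance. Qed.

Definition ext (Z X : SSet) (P P' : spred X) : Prop :=
  forall g : partmap P Z, exists h : partmap P' Z,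
    forall n x (hx : P n x) (hx' : P' n x), h n x hx' = g n x hx.

Lemma choice_fun (A : Type) (B : A -> Type) (R : forall a, B a -> Prop) :
  (forall a, exists b, R a b) -> exists f : forall a, B a, forall a, R a (f a).
Proof.
move=> h; exists (fun a => proj1_sig (constructive_indefinite_description _ (h a))).
by move=> a; exact: proj2_sig (constructive_indefinite_description _ (h a)).
Qed.

Definition pcomp X Y Z (P : spred X) (Q : spred Y) (u : SMap X Y)
  (hu : forall n x, P n x -> Q n (u n x)) (g : partmap Q Z) : partmap P Z.
Proof.
refine (@Build_partmap X P Z (fun n x hx => g n (u n x) (hu n x hx)) _).
move=> m n f x h h'; have e := snat u f x.
have h2 : Q m (sact Y f (u n x)) by rewrite -e; apply: hu.
by rewrite (partfunE g (hu m _ h') h2 e) (partnat g _ _ (hu n x h)).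
Defined.

Definition partmap_of X Y (u : SMap X Y) : partmap (@sfull X) Y :=
  {| pfun := fun n x _ => u n x; partnat := fun m n f x _ _ => snat u f x |}.

Definition of_partmap X Y (g : partmap (@sfull X) Y) : SMap X Y.
Proof.
refine (@Build_SMap X Y (fun n x => g n x I) _).
by move=> m n f x; rewrite (partnat g f x I I).
Defined.

(** [P'] is the pushout of [P] along the cells: a simplex outside [P] comes from exactly one cell
    simplex, so extensions chosen cell by cell fit together. *)
Lemma ext_cells (Z X : SSet) (P P' : spred X) (J : Type) (C : J -> SSet)
    (C0 : forall j, spred (C j)) (chi : forall j, SMap (C j) X) :
  sclosed P -> (forall n x, P n x -> P' n x) ->
  (forall j n c, C0 j n c <-> P n (chi j n c)) ->
  (forall n x, P' n x -> P n x \/ exists j c, chi j n c = x) ->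
  (forall n j j' (c : C j n) (c' : C j' n), chi j n c = chi j' n c' -> ~ P n (chi j n c) ->
     existT (fun j => C j n) j c = existT (fun j => C j n) j' c') ->
  (forall j, ext Z (C0 j) (@sfull (C j))) ->
  ext Z P P'.
Proof.
move=> clP PP' C0P cov inj extC g.
have ext1 j : exists h : SMap (C j) Z, forall n (c : C j n) (hc : P n (chi j n c)),
    h n c = g n _ hc.
  have [h hh] := extC j (pcomp (fun n x (hx : C0 j n x) => proj1 (C0P j n x) hx) g).
  exists (of_partmap h) => n c hc /=.
  have hc0 : C0 j n c by apply/C0P.
  by rewrite (hh n c hc0) /=; apply: partfunE.
have [h hh] := choice_fun ext1.
have [k hk] : exists k : forall n (x : X n), P' n x -> Z n, forall n x (hx : P' n x),
    (forall h : P n x, k n x hx = g n x h) /\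
    (forall j c, chi j n c = x -> k n x hx = h j n c).
  suff H n : exists k : forall x : X n, P' n x -> Z n, forall x (hx : P' n x),
     (forall h : P n x, k x hx = g n x h) /\
     (forall j c, chi j n c = x -> k x hx = h j n c) by exact: choice_fun H.
  suff H (x : X n) : exists k : P' n x -> Z n, forall (hx : P' n x),
     (forall h : P n x, k hx = g n x h) /\
     (forall j c, chi j n c = x -> k hx = h j n c) by exact: (choice_fun H).
  suff H (hx : P' n x) : exists z : Z n,
     (forall h : P n x, z = g n x h) /\
     (forall j c, chi j n c = x -> z = h j n c) by exact: (choice_fun H).
  case: (classic (P n x)) => [px|npx].
    exists (g n x px); split=> [px'|j c e]; first exact: partfunE.
    subst x; by rewrite (hh j n c px).
  have [//|[j [c e]]] := cov n x hx.
  exists (h j n c); split=> [//|j' c' e'].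
  have npc : ~ P n (chi j n c) by rewrite e.
  have E : existT (fun j => C j n) j c = existT (fun j => C j n) j' c'.
    by apply: inj npc; rewrite e e'.
  by have := f_equal (fun s : {j : J & C j n} => h (projT1 s) n (projT2 s)) E.
have kn m n (f : Dmap m n) (x : X n) (hx : P' n x) (hx' : P' m (sact X f x)) :
    k m _ hx' = sact Z f (k n x hx).
  have [K1 K2] := hk n x hx; have [K3 K4] := hk m _ hx'.
  case: (cov n x hx) => [px|[j [c e]]].
    have px' := clP m n f x px.
    by rewrite (K1 px) (K3 px') (partnat g f x px).
  by rewrite (K2 j c e) (K4 j (sact (C j) f c)) ?snat ?e.
exists {| pfun := k; partnat := kn |} => n x hx hx' /=.
by have [K _] := hk n x hx'; apply: K.
Qed.

Lemma ext_seq (Z X : SSet) (P : nat -> spred X) (P' : spred X) :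
  (forall i n x, P i n x -> P i.+1 n x) ->
  (forall n x, P' n x -> exists i, P i n x) ->
  (forall i, sclosed (P i)) ->
  (forall i, ext Z (P i) (P i.+1)) -> ext Z (P 0) P'.
Proof.
move=> mono cov cl H g.
have [s hs] := choice_fun (fun i => choice_fun (H i)).
(* Each stage extends the previous one, so by [GE] the value at a simplex does not depend on the
   stage at which it is read. *)
pose G := fix G i : partmap (P i) Z := if i is i'.+1 then s i' (G i') else g.
have monoD i j n x : P i n x -> P (j + i) n x.
  by elim: j => // j IH /IH; apply: mono.
have GD j i n x (hx : P i n x) (hx' : P (j + i) n x) : G (j + i) n x hx' = G i n x hx.
  elim: j hx' => [|j IH] hx'; first exact: partfunE.
  rewrite /= (hs (j + i) (G (j + i)) n x (monoD i j n x hx)); exact: IH.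
have GE i j n x (hx : P i n x) (hx' : P j n x) : G i n x hx = G j n x hx'.
  have h1 := monoD i j n x hx; have h2 := monoD j i n x hx'.
  rewrite -(GD j i n x hx h1) -(GD i j n x hx' h2).
  by move: h1 h2; rewrite addnC => h1 h2; apply: partfunE.
pose idx n x (hx : P' n x) := constructive_indefinite_description _ (cov n x hx).
unshelve eexists.
  refine (@Build_partmap X P' Z
    (fun n x hx => G (proj1_sig (idx n x hx)) n x (proj2_sig (idx n x hx))) _).
  move=> m n f x h h'.
  have hc := cl (proj1_sig (idx n x h)) m n f x (proj2_sig (idx n x h)).
  by rewrite (GE _ _ _ _ _ hc) (partnat _ f x (proj2_sig (idx n x h))).
move=> n x hx hx' /=; exact: (GE _ 0).
Qed.

Lemma ext_refl Z X (P P' : spred X) : (forall n x, P' n x -> P n x) -> ext Z P P'.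
Proof.
move=> H g.
exists (@Build_partmap X P' Z (fun n x hx => g n x (H n x hx))
          (fun m n f x h h' => partnat g f x (H n x h) (H m _ h'))).
by move=> n x hx hx' /=; apply: partfunE.
Qed.

Lemma ext_trans Z X (P P' P'' : spred X) : (forall n x, P n x -> P' n x) ->
  ext Z P P' -> ext Z P' P'' -> ext Z P P''.
Proof.
move=> PP' H1 H2 g; have [h1 e1] := H1 g; have [h2 e2] := H2 h1.
by exists h2 => n x hx hx''; rewrite (e2 n x (PP' n x hx)).
Qed.

Lemma ext_mono Z X (P P' Q : spred X) : (forall n x, P' n x -> Q n x) ->
  ext Z P Q -> ext Z P P'.
Proof.
move=> PQ H1 g; have [h e] := H1 g.
exists (@Build_partmap X P' Z (fun n x hx => h n x (PQ n x hx))
          (fun m n f x k k' => partnat h f x (PQ n x k) (PQ m _ k'))) => n x hx hx' /=; exact: e.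
Qed.

(** * The homotopy extension property *)

Definition dsurj m n (f : Dmap m n) : Prop := forall j, exists i, f i = j.

Lemma dsurjPn m n (f : Dmap m n) : ~ dsurj f -> exists j, forall i, f i != j.
Proof.
move=> h; apply: NNPP => h'; apply: h => j; apply: NNPP => h2; apply: h'.
exists j => i; apply/eqP => e; apply: h2; by exists i.
Qed.

(** Prescribing that the section passes through [b] is what lets [nondeg_unique] compare two
    degeneracies point by point. *)
Lemma dsurj_section m n (f : Dmap m n) (b : 'I_m.+1) : dsurj f ->
  exists s : Dmap n m, dcomp f s = did n /\ s (f b) = b.
Proof.
move=> hf.
have [s hs] : exists s : 'I_n.+1 -> 'I_m.+1, forall j, f (s j) = j /\ (j = f b -> s j = b).
  suff H j : exists i, f i = j /\ (j = f b -> i = b) by exact: choice_fun H.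
  case: (j =P f b) => [->|ne]; first by exists b.
  by have [i hi] := hf j; exists i; split.
have sm (i j : 'I_n.+1) : i <= j -> s i <= s j.
  case: (leqP (s i) (s j)) => // lt le.
  have := dmono f (ltnW lt); rewrite (proj1 (hs i)) (proj1 (hs j)) => ji.
  have e : i = j by apply: val_inj => /=; lia.
  by move: lt; rewrite e ltnn.
exists {| dfun := s; dmono := sm |}; split.
  by apply: dmap_eq => i /=; exact: proj1 (hs i).
exact: (proj2 (hs _)).
Qed.

Lemma dinj_ge n (s : Dmap n n) : injective s -> forall i : 'I_n.+1, i <= s i.
Proof.
move=> inj [i hi] /=; elim: i hi => // i IH hi.
have hi' : i < n.+1 by lia.
have h1 := IH hi'.
have h2 : s (Ordinal hi') <= s (Ordinal hi) by apply: dmono => /=.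
have h3 : s (Ordinal hi') != s (Ordinal hi) :> nat.
  apply/eqP => /val_inj /inj /(f_equal val) /=; lia.
lia.
Qed.

Lemma dsurj_id n (f : Dmap n n) : dsurj f -> f = did n.
Proof.
move=> hf; have [s [fs _]] := dsurj_section ord0 hf.
have fsE i : f (s i) = i by have := f_equal (fun h : Dmap n n => h i) fs.
have sinj : injective s by move=> x y e; rewrite -(fsE x) -(fsE y) e.
have [t ts st] := injF_bij sinj.
have finj : injective f.
  by move=> x y; rewrite -(st x) -(st y) !fsE => ->.
apply: dmap_eq => i /=; apply: val_inj => /=.
have h1 := dinj_ge finj i.
have := dmono f (dinj_ge sinj i); rewrite fsE; lia.
Qed.

Lemma dmiss_factor m n (f : Dmap m n) (j : 'I_n.+1) : (forall i, f i != j) ->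
  exists l (g : Dmap l n) (h : Dmap m l), l < n /\ f = dcomp g h.
Proof.
case: n f j => [|n] f j hj.
  by have := hj ord0; rewrite (ord1 (f ord0)) (ord1 j) eqxx.
have hm (a b : 'I_n.+1) : a <= b -> lift j a <= lift j b by rewrite /= leq_bump2.
pose g : Dmap n n.+1 := {| dfun := lift j; dmono := hm |}.
have [h hh] : exists h : 'I_m.+1 -> 'I_n.+1, forall i, lift j (h i) = f i.
  suff H i : exists k, lift j k = f i by exact: choice_fun H.
  have := hj i; rewrite eq_sym => /unlift_some [k e _].
  by exists k; rewrite e.
have hm2 (a b : 'I_m.+1) : a <= b -> h a <= h b.
  move=> /(dmono f); rewrite -!hh /= leq_bump2 //.
exists n, g, {| dfun := h; dmono := hm2 |}; split=> //.
by apply: dmap_eq => i /=; rewrite hh.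
Qed.



Lemma pt_eq (X Y : SSet) n (p q : Prod X Y n) : p.1 = q.1 -> p.2 = q.2 -> p = q.
Proof. by case: p => a b; case: q => c d /= -> ->. Qed.

(** The codegeneracy taking the value [i] twice. *)
Definition prism_fun n (i : 'I_n.+1) (j : 'I_n.+2) : 'I_n.+1 :=
  inord (if j <= i then j : nat else j.-1).

Lemma prism_funE n (i : 'I_n.+1) (j : 'I_n.+2) :
  prism_fun i j = (if j <= i then j : nat else j.-1) :> nat.
Proof.
rewrite /prism_fun inordK //; case: (leqP j i) => h; have := ltn_ord i; have := ltn_ord j; lia.
Qed.

Definition prism_proj n (i : 'I_n.+1) : Dmap n.+1 n.
Proof.
refine (@Build_Dmap n.+1 n (prism_fun i) _).
by move=> a b ab; rewrite !prism_funE; case: (leqP a i) => h; case: (leqP b i) => h'; lia.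
Defined.

Definition prism_time n (i : 'I_n.+1) : Dmap n.+1 1.
Proof.
refine (@Build_Dmap n.+1 1 (fun j => if j <= i then ord0 else ord_max) _).
by move=> a b ab; case: (leqP a i) => h //; case: (leqP b i) => h' //; lia.
Defined.

Definition prism_simplex n (i : 'I_n.+1) : SMap (Std n.+1) (Prod (Std n) (Std 1)).
Proof.
refine (@Build_SMap (Std n.+1) (Prod (Std n) (Std 1))
  (fun m t => (dcomp (prism_proj i) t, dcomp (prism_time i) t)) _).
by [].
Defined.

(* The prism is filled by the simplices [(0,0), .., (i,0), (i,1), .., (n,1)] for [i = n, .., 0];
   [prism_part k] is the part present once those with [i >= k] have been added. *)
Definition prism_part n (k : nat) : spred (Prod (Std n) (Std 1)) :=
  fun m x => ~ dsurj x.1 \/ forall s : 'I_m.+1, x.2 s != ord0 -> k <= x.1 s.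

Lemma not_dsurj_comp l m n (g : Dmap m n) (f : Dmap l m) : ~ dsurj g -> ~ dsurj (dcomp g f).
Proof. by move=> h h'; apply: h => j; have [i hi] := h' j; exists (f i). Qed.

Lemma ord2P (x : 'I_2) : x = ord0 \/ x = ord_max.
Proof. by case: x => [[|[|//]]] h; [left|right]; apply: val_inj. Qed.

Lemma ext_full_of X Z (P : spred X) : (forall g : partmap P Z,
   exists h : SMap X Z, forall n x (hx : P n x), h n x = g n x hx) -> ext Z P (@sfull X).
Proof. by move=> H g; have [h e] := H g; exists (partmap_of h) => n x hx hx' /=; apply: e. Qed.

Lemma ext_full_to X Z (P : spred X) : ext Z P (@sfull X) -> forall g : partmap P Z,
   exists h : SMap X Z, forall n x (hx : P n x), h n x = g n x hx.
Proof. by move=> H g; have [h e] := H g; exists (of_partmap h) => n x hx /=; apply: e. Qed.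

Lemma kan_horn_ext Z n (k : 'I_n.+1) : kan Z -> 0 < n ->
  ext Z (fun m (t : Std n m) => hornP k t) (@sfull (Std n)).
Proof.
move=> kZ n0; apply: ext_full_of => g.
have [c hc] := kZ n k n0 (@Build_SMap (Horn k) Z (fun m x => g m (proj1_sig x) (proj2_sig x))
   (fun m m' f x => partnat g f (proj1_sig x) (proj2_sig x) _)).
by exists c => m x hx; have := hc m (exist _ x hx).
Qed.

(** The [i]-th prism simplex meets the earlier part exactly in its horn at [i]. Its faces other than
    [i] and [i.+1] project to proper faces of [Std n], and face [i.+1] omits [(i,1)], so its
    vertices at time 1 project above [i]. Face [i] is the new one. *)
Lemma prism_step Z n (i : 'I_n.+1) : kan Z ->
  ext Z (@prism_part n i.+1) (@prism_part n i).
Proof.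
move=> kZ.
apply: (@ext_cells Z (Prod (Std n) (Std 1)) _ _ unit (fun _ => Std n.+1)
   (fun _ m t => @hornP n.+1 (widen_ord (leqnSn _) i) m t) (fun _ => prism_simplex i)).
- move=> m m' f [a b] [h|h]; [left | right].
    exact: not_dsurj_comp.
  by move=> s; apply: h.
- by move=> m [a b] [h|h]; [left|right=> s /h /=; lia].
- move=> _ m t; split.
    case=> j [hj ht].
    case: (ltngtP j i.+1) => hji.
    + left=> hs; have ji : j < i by move/eqP: hj => hj; have : (j : nat) <> i by [move=> e; apply: hj; apply: val_inj]; lia.
      have hjn : j < n.+1 by have := ltn_ord i; lia.
      have [s es] := hs (Ordinal hjn); move/(f_equal val): es => /=.
      rewrite prism_funE; case: (leqP (t s) i) => h e; last by lia.
      by move/eqP: (ht s); apply; apply: val_inj.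
    + left=> hs; have hjn : j.-1 < n.+1 by have := ltn_ord j; lia.
      have [s es] := hs (Ordinal hjn); move/(f_equal val): es => /=.
      rewrite prism_funE; case: (leqP (t s) i) => h e; first by lia.
      move/eqP: (ht s); apply; apply: val_inj => /=; lia.
    + right=> s /=; rewrite prism_funE; case: (leqP (t s) i) => // h _.
      have : (t s : nat) <> i.+1.
        by move=> e; move/eqP: (ht s); apply; apply: val_inj; rewrite /= e hji.
      lia.
  move=> h; apply: NNPP => nh.
  have hit (j : 'I_n.+2) : (j : nat) <> i -> exists s, t s = j.
    move=> hj; apply: NNPP => ne; apply: nh; exists j; split.
      by apply/eqP => e; apply: hj; rewrite e.
    by move=> s; apply/eqP => e; apply: ne; exists s.
  have hi1 : i.+1 < n.+2 by have := ltn_ord i; lia.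
  case: h => [h|h].
    apply: h => j /=.
    case: (ltnP j i) => hji.
      have hj2 : j < n.+2 by have := ltn_ord j; lia.
      have [|s es] := hit (Ordinal hj2) => /=; first by lia.
      exists s; apply: val_inj => /=; rewrite prism_funE es /=; case: (leqP _ i); lia.
    have hj2 : j.+1 < n.+2 by have := ltn_ord j; lia.
    have [|s es] := hit (Ordinal hj2) => /=; first by lia.
    exists s; apply: val_inj => /=; rewrite prism_funE es /=; case: (leqP _ i); lia.
  have [|s es] := hit (Ordinal hi1) => /=; first by lia.
  by have := h s; rewrite /= es prism_funE /= !ltnn => /(_ isT).
- move=> m [a b] [h|h]; first by left; left.
  case: (classic (dsurj a)) => sa; last by left; left.
  case: (classic (forall s : 'I_m.+1, b s != ord0 -> i < a s)) => h2; first by left; right.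
  right; exists tt.
  have [s0 [b0 a0]] : exists s0, b s0 = ord_max /\ (a s0 : nat) = i.
    apply: NNPP => ne; apply: h2 => s bs; rewrite ltn_neqAle h // andbT.
    apply/eqP => e; apply: ne; exists s; split=> //.
    by case: (ord2P (b s)) => e'; first by rewrite e' in bs.
  have le0 s : b s = ord0 -> a s <= i.
    move=> bs; case: (leqP s s0) => hs; first by rewrite -a0; apply: dmono.
    by have := dmono b (ltnW hs); rewrite b0 bs.
  (* In the vertex list of the prism simplex, [(a,0)] stands at position [a] and [(a,1)] at position
     [a.+1]. *)
  pose tf s : 'I_n.+2 := inord (if b s == ord0 then a s : nat else (a s).+1).
  have tfE s : tf s = (if b s == ord0 then a s : nat else (a s).+1) :> nat.
    by rewrite /tf inordK //; have := ltn_ord (a s); case: (_ == _); lia.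
  have tm (s s' : 'I_m.+1) : s <= s' -> tf s <= tf s'.
    move=> le; rewrite !tfE; have := dmono a le; have := dmono b le.
    case: (ord2P (b s)) => ->; case: (ord2P (b s')) => -> /=; lia.
  exists {| dfun := tf; dmono := tm |}.
  apply: pt_eq; apply: dmap_eq => s; apply: val_inj => /=.
    rewrite prism_funE tfE; case: (ord2P (b s)) => e; rewrite e /=.
      by rewrite le0.
    have : i <= a s by apply: h; rewrite e.
    case: leqP; lia.
  rewrite tfE; case: (ord2P (b s)) => e; rewrite e /=.
    by rewrite le0.
  have : i <= a s by apply: h; rewrite e.
  by case: leqP => //; lia.
- move=> m [] [] c c' E _; congr existT; apply: dmap_eq => s; apply: val_inj.
  have E1 := f_equal (fun p : Prod (Std n) (Std 1) m => val (p.1 s)) E.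
  have E2 := f_equal (fun p : Prod (Std n) (Std 1) m => val (p.2 s)) E.
  move: E1 E2 => /=; rewrite !prism_funE; case: (leqP (c s) i) => h1; case: (leqP (c' s) i) => h2 //=; lia.
- move=> _; exact: kan_horn_ext.
Qed.

Definition prism_base n : spred (Prod (Std n) (Std 1)) :=
  fun m x => (forall s : 'I_m.+1, x.2 s = ord0) \/ ~ dsurj x.1.
Arguments prism_base : clear implicits.

Lemma prism_ext Z n : kan Z -> ext Z (prism_base n) (@sfull (Prod (Std n) (Std 1))).
Proof.
move=> kZ.
have H k : k <= n.+1 -> ext Z (@prism_part n n.+1) (@prism_part n (n.+1 - k)).
  elim: k => [|k IH] hk; first by rewrite subn0; apply: ext_refl.
  apply: (@ext_trans _ _ _ (@prism_part n (n.+1 - k))).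
  - by move=> m x [h|h]; [left|right=> s /h; lia].
  - by apply: IH; lia.
  - have hi : n - k < n.+1 by lia.
    have := @prism_step Z n (Ordinal hi) kZ; rewrite /= -subSn //.
apply: (@ext_trans _ _ _ (@prism_part n n.+1)).
- move=> m x [h|h]; [right|by left].
  by move=> s; rewrite h.
- apply: ext_refl => m x [h|h]; [by right|left=> s].
  have := h s; case: (ord2P (x.2 s)) => // -> /(_ isT); have := ltn_ord (x.1 s); lia.
- apply: (ext_mono _ (H n.+1 (leqnn _))) => m x _; right=> s _; lia.
Qed.

(** Generated by dimensions strictly below [i], so that for [x] in [X i] the negation says that [x]
    is nondegenerate. *)
Definition skeleton (X : SSet) (i : nat) : spred X :=
  fun m x => exists l (y : X l) (f : Dmap m l), l < i /\ x = sact X f y.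

Lemma skeleton_nondeg (X : SSet) (Q : spred X) i m (x : X i) (f : Dmap m i) : sclosed Q ->
  ~ Q i x -> ~ skeleton i x -> dsurj f ->
  ~ (Q m (sact X f x) \/ skeleton i (sact X f x)).
Proof.
move=> clQ nQ nS sf; have [s [fs _]] := dsurj_section ord0 sf.
have E : x = sact X s (sact X f x) by rewrite -sact_comp fs sact_id.
case=> [h|[l [y [g [li h]]]]].
  by apply: nQ; rewrite E; apply: clQ.
by apply: nS; exists l, y, (dcomp g s); rewrite sact_comp -h.
Qed.

Lemma skeleton_not_surj (X : SSet) i m (x : X i) (f : Dmap m i) :
  ~ dsurj f -> skeleton i (sact X f x).
Proof.
move=> /dsurjPn [j hj]; have [l [g [h [li ->]]]] := dmiss_factor hj.
by exists l, (sact X g x), h; rewrite sact_comp.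
Qed.

(** Uniqueness in the Eilenberg-Zilber lemma. A section [s] of [f] presents [x] as the restriction
    of [y] along [g s]; nondegeneracy makes [g s] surjective, hence the identity. Letting [s] pass
    through [b] gives [f b = g b]. *)
Lemma nondeg_unique (X : SSet) i m (x y : X i) (f g : Dmap m i) :
  ~ skeleton i x -> dsurj f -> dsurj g -> sact X f x = sact X g y -> x = y /\ f = g.
Proof.
move=> nS sf sg E.
have key (b : 'I_m.+1) : x = y /\ f b = g b.
  have [s [fs sb]] := dsurj_section b sf.
  have E1 : x = sact X (dcomp g s) y.
    by rewrite sact_comp -E -sact_comp fs sact_id.
  have sgs : dsurj (dcomp g s).
    by apply: NNPP => h; apply: nS; rewrite E1; apply: skeleton_not_surj.
  have gs := dsurj_id sgs.
  split; first by rewrite E1 gs sact_id.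
  by have := f_equal (fun h : Dmap i i => h (f b)) gs; rewrite /= sb => ->.
split; first by case: (key ord0).
by apply: dmap_eq => b; case: (key b).
Qed.

Definition cyl_bot X (P : spred X) : spred (Prod X (Std 1)) :=
  fun m x => P m x.1 \/ forall i : 'I_m.+1, x.2 i = ord0.

Definition cell_map (X : SSet) n (x : X n) : SMap (Std n) X.
Proof.
refine (@Build_SMap (Std n) X (fun m f => sact X f x) _).
by move=> m m' f g /=; rewrite sact_comp.
Defined.

Definition prod_map X X' Y (u : SMap X X') : SMap (Prod X Y) (Prod X' Y).
Proof.
refine (@Build_SMap (Prod X Y) (Prod X' Y) (fun m x => (u m x.1, x.2)) _).
by move=> m n f x /=; rewrite snat.
Defined.

(* The prisms over the nondegenerate simplices outside [P] are attached by dimension. *)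
Lemma homotopy_extension Z X (P : spred X) : kan Z -> sclosed P ->
  ext Z (cyl_bot P) (@sfull (Prod X (Std 1))).
Proof.
move=> kZ clP.
pose R i : spred (Prod X (Std 1)) := fun m x => cyl_bot P x \/ skeleton i x.1.
have skcl i : sclosed (@skeleton X i).
  move=> m n f x [l [y [g [li ->]]]]; exists l, y, (dcomp g f).
  by rewrite sact_comp.
have skmono i n (x : X n) : skeleton i x -> skeleton i.+1 x.
  by case=> l [y [g [li h]]]; exists l, y, g; split=> //; lia.
have cl0 : sclosed (cyl_bot P).
  move=> m n f [x s] [h|h]; [by left; apply: clP | right=> i; exact: h].
apply: (@ext_trans _ _ _ (R 0)); first by move=> n x; left.
  apply: ext_refl => n x [//|[l [y [f []]]]]; by rewrite ltn0.
apply: (ext_seq (P := R)).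
- by move=> i n x [h|/skmono h]; [left | right].
- move=> n x _; exists n.+1; right; exists n, x.1, (did n); by rewrite sact_id.
- by move=> i m n f x [h|h]; [left; apply: cl0 | right; apply: skcl].
move=> i.
pose J := {x : X i | ~ (P i x \/ skeleton i x)}.
apply: (@ext_cells Z _ _ _ J (fun _ => Prod (Std i) (Std 1)) (fun _ => @prism_base i)
          (fun j => prod_map _ (cell_map (proj1_sig j)))).
- by move=> m n f x [h|h]; [left; apply: cl0 | right; apply: skcl].
- by move=> n x [h|/skmono h]; [left | right].
- move=> [x nx] n [f s] /=; split.
    case=> [h|h]; first by left; right.
    by right; apply: skeleton_not_surj.
  case=> [[h|h]|h]; [right|by left|right] => sf;
    apply: (@skeleton_nondeg X P i n x f clP _ _ sf) => [h'|h'|];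
    by [apply: nx; left | apply: nx; right | left | right].
- move=> n [x s] [h|[l [y [f [li /= h]]]]]; first by left; left.
  case: (ltngtP l i) => li'; last 1 first.
  + subst l; case: (classic (P i y \/ skeleton i y)) => hy.
      left; rewrite /R /= h; case: hy => hy; last by right; apply: skcl.
      by left; left; apply: clP.
    by right; exists (exist _ y hy), (f, s); rewrite /= h.
  + by left; right; exists l, y, f.
  + by lia.
- move=> n [x nx] [y ny] [f s] [g t] /= E nR.
  have Es : s = t by have := f_equal snd E.
  have Ef : sact X f x = sact X g y by have := f_equal fst E.
  have sf : dsurj f by apply: NNPP => h; apply: nR; right; apply: skeleton_not_surj.
  have sg : dsurj g.
    by apply: NNPP => h; apply: nR; right; rewrite /= Ef; apply: skeleton_not_surj.
  have nsx : ~ skeleton i x by move=> h; apply: nx; right.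
  have [Exy Efg] := nondeg_unique nsx sf sg Ef.
  subst y g t; congr existT; congr exist; exact: proof_irrelevance.
- move=> _; exact: prism_ext.
Qed.

(** * Contractible pairs *)

Definition pstep (C : SSet) (C0 : spred C) (f g : SMap C C) : Prop :=
  exists H : SMap (Prod C (Std 1)) C,
    [/\ forall n x, H n (x, cst n ord0) = f n x,
        forall n x, H n (x, cst n ord_max) = g n x &
        forall n x s, C0 n x -> C0 n (H n (x, s))].

Definition dzero m : Dmap m 0 := {| dfun := fun _ => ord0; dmono := fun _ _ _ => isT |}.

Lemma dzero_comp l m (f : Dmap l m) : dcomp (dzero m) f = dzero l.
Proof. exact: dmap_eq. Qed.

Definition sconst (C : SSet) (c : C 0) : SMap C C.
Proof.
refine (@Build_SMap C C (fun n _ => sact C (dzero n) c) _).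
by move=> m n f x; rewrite -sact_comp dzero_comp.
Defined.

Definition sid (C : SSet) : SMap C C := @Build_SMap C C (fun n x => x) (fun m n f x => erefl).

(* The contraction preserves [C0], so that [C0 x D1 u C x dD1] is contractible as well. *)
Definition pcontr (C : SSet) (C0 : spred C) : Prop :=
  exists c : C 0, C0 0 c /\ clos_refl_trans_1n _ (pstep C0) (sconst c) (sid C).

Lemma cst_comp m n (f : Dmap m n) i : dcomp (cst n i) f = cst m i.
Proof. exact: dmap_eq. Qed.

(** Along the chain of homotopies from the constant to the identity, the composite of [g] with the
    current self-map extends from [C0] to [C]. This is clear for the constant. At each step [g]
    composed with the homotopy is defined over [C0], because the homotopy preserves [C0], and
    homotopy extension carries the extension from one end to the other. *)
Lemma pcontr_ext Z C (C0 : spred C) : kan Z -> sclosed C0 -> pcontr C0 ->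
  ext Z C0 (@sfull C).
Proof.
move=> kZ cl [c [hc H]] g.
suff W f1 f2 : clos_refl_trans_1n _ (pstep C0) f1 f2 ->
    (forall n x, C0 n x -> C0 n (f1 n x)) ->
    (exists h : SMap C Z, forall n x (hx : C0 n x) hx', h n x = g n (f1 n x) hx') ->
    (exists h : SMap C Z, forall n x (hx : C0 n x) hx', h n x = g n (f2 n x) hx').
  have [] := W _ _ H.
  - move=> n x _; exact: cl.
  - exists (@Build_SMap C Z (fun n _ => sact Z (dzero n) (g 0 c hc))
      (fun m n f x => etrans (f_equal (fun d => sact Z d _) (esym (dzero_comp f)))
                             (sact_comp _ _ _))).
    by move=> n x hx hx' /=; rewrite -(partnat g (dzero n) c hc hx').
  - by move=> h hh; exists (partmap_of h) => n x hx hx' /=; exact: hh.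
elim=> // f f' f'' [h [h0 h1 hC]] _ IH pf [u hu]; apply: IH.
  by move=> n x hx; rewrite -h1; apply: hC.
have clb : sclosed (cyl_bot C0).
  move=> m n q [x s] [k|k]; [by left; apply: cl | right=> i; exact: k].
have s0 n (s : Dmap n 1) : (forall i, s i = ord0) -> s = cst n ord0.
  by move=> k; apply: dmap_eq.
have [G hG] : exists G : partmap (cyl_bot C0) Z, forall n (p : Prod C (Std 1) n) (hp : @cyl_bot C C0 n p),
    (forall hx : C0 n (h n p), C0 n p.1 -> G n p hp = g n (h n p) hx) /\
    ((forall i : 'I_n.+1, p.2 i = ord0) -> G n p hp = u n p.1).
  have ex n (p : Prod C (Std 1) n) : exists F : @cyl_bot C C0 _ p -> Z n, forall hp,
      (forall hx : C0 n (h n p), C0 n p.1 -> F hp = g n (h n p) hx) /\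
      ((forall i : 'I_n.+1, p.2 i = ord0) -> F hp = u n p.1).
    suff K (hp : @cyl_bot C C0 _ p) : exists z : Z n,
      (forall hx : C0 n (h n p), C0 n p.1 -> z = g n (h n p) hx) /\
      ((forall i : 'I_n.+1, p.2 i = ord0) -> z = u n p.1) by exact: choice_fun K.
    case: p hp => x s hp /=.
    case: (classic (C0 n x)) => hx.
      have hx' := hC n x s hx.
      exists (g n _ hx'); split=> [hx2 _|k]; first exact: partfunE.
      move: hx'; rewrite (s0 n s k) => hx'.
      rewrite (hu n x hx (pf n x hx)); apply: partfunE; exact: h0.
    exists (u n x); split=> //.
  have [F hF] := choice_fun (fun n => choice_fun (ex n)).
  have nF m n (q : Dmap m n) (p : Prod C (Std 1) n) (k : @cyl_bot C C0 n p) (k' : @cyl_bot C C0 m (sact _ q p)) :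
      F m _ k' = sact Z q (F n p k).
    have [F1 F2] := hF n p k; have [F3 F4] := hF m _ k'.
    have := k; case=> hp.
      have hx := hC n p.1 p.2 hp; rewrite -surjective_pairing in hx.
      have hx' : C0 m (h m (sact (Prod C (Std 1)) q p)) by rewrite snat; apply: cl.
      rewrite (F1 hx hp) (F3 hx'); last exact: cl.
      have hx2 := cl _ _ q _ hx.
      rewrite -(partnat g q _ hx hx2); apply: partfunE; exact: snat.
    rewrite (F2 hp) F4; first exact: snat.
    by move=> i; exact: hp.
  by exists (@Build_partmap _ _ Z F nF) => n p hp; exact: hF.
have [W hW] := ext_full_to (homotopy_extension kZ cl) G.
exists (@Build_SMap C Z (fun n x => W n (x, cst n ord_max))
   (fun m n q x => etrans (f_equal (fun d => W m (sact C q x, d)) (esym (cst_comp q ord_max)))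
                          (snat W q (x, cst n ord_max)))).
move=> n x hx hx' /=.
have hb : @cyl_bot C C0 _ (x, cst n ord_max) by left.
rewrite (hW n _ hb); have [K _] := hG n _ hb.
have hx2 : C0 n (h n (x, cst n ord_max)) by rewrite h1.
rewrite (K hx2 hx); apply: partfunE; exact: h1.
Qed.

(** * Acyclic extensions *)

Definition cyl_bd X (P : spred X) : spred (Prod X (Std 1)) :=
  fun m x => P m x.1 \/ forall i j : 'I_m.+1, x.2 i = x.2 j.

Lemma cyl_bd_closed X (P : spred X) : sclosed P -> sclosed (cyl_bd P).
Proof.
move=> cl m n f [x s] [h|h]; [left; exact: cl | right=> i j; exact: h].
Qed.

(* The first extension property makes restriction to the smaller part surjective on homotopy
   classes, the second one makes it injective. *)
Definition acyclic X (P P' : spred X) : Prop :=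
  forall Z, kan Z -> ext Z P P' /\ ext Z (cyl_bd P) (cyl_bd P').

Lemma acyclic_trans X (P P' P'' : spred X) : (forall n x, P n x -> P' n x) ->
  acyclic P P' -> acyclic P' P'' -> acyclic P P''.
Proof.
move=> PP' H1 H2 Z kZ; have [a b] := H1 Z kZ; have [c d] := H2 Z kZ; split.
  exact: ext_trans a c.
apply: ext_trans b d => n x [h|h]; [left; exact: PP' | by right].
Qed.

Lemma acyclic_seq X (P : nat -> spred X) (P' : spred X) :
  (forall i n x, P i n x -> P i.+1 n x) ->
  (forall n x, P' n x -> exists i, P i n x) ->
  (forall i, sclosed (P i)) ->
  (forall i, acyclic (P i) (P i.+1)) -> acyclic (P 0) P'.
Proof.
move=> mono cov cl H Z kZ; split.
  by apply: ext_seq mono cov cl _ => i; case: (H i Z kZ).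
apply: (ext_seq (P := fun i => cyl_bd (P i))).
- by move=> i n x [/mono h|h]; [left | right].
- by move=> n x [/cov [i h]|h]; [exists i; left | exists 0; right].
- by move=> i; apply: cyl_bd_closed.
- by move=> i; case: (H i Z kZ).
Qed.

Lemma clos_map A B (R : relation A) (S : relation B) (u : A -> B) x y :
  (forall x y, R x y -> S (u x) (u y)) ->
  clos_refl_trans_1n _ R x y -> clos_refl_trans_1n _ S (u x) (u y).
Proof.
move=> H; elim=> [a|a b c /H hab _ IH]; first exact: rt1n_refl.
exact: Relation_Operators.rt1n_trans hab IH.
Qed.

(** The contraction of [C] times the identity of the interval preserves both halves of [cyl_bd C0].
    It starts at [(x,s) |-> (c,s)], which is joined to the constant [(c,0)] by taking minima on the
    interval; that homotopy stays over [c], which lies in [C0]. *)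
Lemma pcontr_cyl C (C0 : spred C) : sclosed C0 -> pcontr C0 -> pcontr (cyl_bd C0).
Proof.
move=> cl [c [hc H]].
exists (c, cst 0 ord0); split; first by left.
pose u (f : SMap C C) := prod_map (Std 1) f.
have uid : sid (Prod C (Std 1)) = u (sid C).
  by apply: smap_eq => n [x s].
rewrite uid.
have min1 (i j k l : 'I_2) : i <= j -> k <= l -> (if (i == ord0) || (k == ord0) then ord0 else ord_max : 'I_2) <= (if (j == ord0) || (l == ord0) then ord0 else ord_max : 'I_2).
  by case: (ord2P i) => ->; case: (ord2P j) => ->; case: (ord2P k) => ->; case: (ord2P l) => ->.
pose meet n (s t : Dmap n 1) : Dmap n 1 := @Build_Dmap n 1
  (fun i => if (s i == ord0) || (t i == ord0) then ord0 else ord_max)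
  (fun i j ij => min1 _ _ _ _ (dmono s ij) (dmono t ij)).
apply: Relation_Operators.rt1n_trans (_ : pstep _ _ (u (sconst c))) _; last first.
  apply: (clos_map (u := u) _ H) => f g [h [h0 h1 hC]].
  exists (@Build_SMap (Prod (Prod C (Std 1)) (Std 1)) (Prod C (Std 1))
    (fun m x => (h m (x.1.1, x.2), x.1.2))
    (fun m n q x => f_equal2 pair (snat h q (x.1.1, x.2)) erefl)).
  split=> [n [x s]|n [x s]|n [x s] t [k|k]] /=.
  - by rewrite h0.
  - by rewrite h1.
  - by left; apply: hC.
  - by right.
have nH m n (q : Dmap m n) (x : Prod (Prod C (Std 1)) (Std 1) n) :
  (sact C (dzero m) c, meet m (dcomp x.1.2 q) (dcomp x.2 q)) =
  sact (Prod C (Std 1)) q (sact C (dzero n) c, meet n x.1.2 x.2).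
  by rewrite /= -sact_comp dzero_comp; congr pair; apply: dmap_eq.
exists (@Build_SMap (Prod (Prod C (Std 1)) (Std 1)) (Prod C (Std 1))
    (fun m x => (sact C (dzero m) c, meet m x.1.2 x.2)) nH).
split=> [n [x s]|n [x s]|n [x s] t _] /=.
- by congr pair; apply: dmap_eq => i /=; rewrite orbT.
- by congr pair; apply: dmap_eq => i /=; case: (ord2P (s i)) => ->.
- by left; apply: cl.
Qed.

Lemma acyclic_cells (X : SSet) (P P' : spred X) (J : Type) (C : J -> SSet)
    (C0 : forall j, spred (C j)) (chi : forall j, SMap (C j) X) :
  sclosed P -> (forall n x, P n x -> P' n x) ->
  (forall j n c, C0 j n c <-> P n (chi j n c)) ->
  (forall n x, P' n x -> P n x \/ exists j c, chi j n c = x) ->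
  (forall n j j' (c : C j n) (c' : C j' n), chi j n c = chi j' n c' -> ~ P n (chi j n c) ->
     existT (fun j => C j n) j c = existT (fun j => C j n) j' c') ->
  (forall j, pcontr (C0 j)) ->
  acyclic P P'.
Proof.
move=> cl PP' C0P cov inj ctr Z kZ.
have cl0 j : sclosed (C0 j).
  by move=> m n f x /C0P h; apply/C0P; rewrite snat; apply: cl.
split.
  apply: (ext_cells cl PP' C0P cov inj) => j; exact: pcontr_ext (ctr j).
apply: (@ext_cells Z _ _ _ J (fun j => Prod (C j) (Std 1)) (fun j => cyl_bd (@C0 j))
          (fun j => prod_map _ (chi j))).
- exact: cyl_bd_closed.
- by move=> n x [h|h]; [left; apply: PP' | right].
- by move=> j n [x s]; split=> -[h|h]; [left; apply/C0P|right|left; apply/C0P|right].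
- move=> n [x s] [/cov [h|[j [c /= h]]]|h]; [by left; left| |by left; right].
  by right; exists j, (c, s); rewrite /= h.
- move=> n j j' [x s] [x' s'] /= E nP.
  have Ex := f_equal fst E; have Es : s = s' := f_equal snd E.
  have nPx : ~ P n (chi j n x) by move=> h; apply: nP; left.
  subst s'; have E2 := inj _ _ _ _ _ Ex nPx.
  by have := f_equal (fun q : {j : J & C j n} =>
     existT (fun j => Prod (C j) (Std 1) n) (projT1 q) (projT2 q, s)) E2.
- move=> j; apply: pcontr_ext => //; first exact: cyl_bd_closed.
  exact: pcontr_cyl.
Qed.

Lemma partmap_of_rel (X Z : SSet) (P : spred X) (R : forall n, X n -> Z n -> Prop) :
  (forall n x, P n x -> exists z, R n x z) ->
  (forall n x z z', R n x z -> R n x z' -> z = z') ->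
  (forall m n (f : Dmap m n) x z, R n x z -> R m (sact X f x) (sact Z f z)) ->
  exists g : partmap P Z, forall n x hx, R n x (g n x hx).
Proof.
move=> ex un st.
have [g hg] := choice_fun (fun n => choice_fun (fun x => choice_fun (fun h => ex n x h))).
exists (@Build_partmap X P Z g (fun m n f x h h' => un m _ _ _ (hg m _ h') (st m n f x _ (hg n x h)))).
exact: hg.
Qed.

(** Extension from the image gives surjectivity on homotopy classes. For injectivity, the zigzag of
    elementary homotopies on [X] is lifted link by link: each intermediate map is first extended to
    [Y], then the relative property extends the homotopy with both ends prescribed. *)
Lemma acyclic_sweq X Y (f : SMap X Y) (P : spred Y) :
  (forall n x x', f n x = f n x' -> x = x') ->
  (forall n y, P n y <-> exists x, f n x = y) ->
  acyclic P (@sfull Y) -> sweq f.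
Proof.
move=> inj im ac Z kZ; have [E1 E2] := ac Z kZ.
have extend (g : SMap X Z) : exists h : SMap Y Z, scomp h f = g.
  have [|||g' hg'] := @partmap_of_rel Y Z P (fun n y z => exists x, f n x = y /\ z = g n x).
  - by move=> n y /im [x <-]; exists (g n x), x.
  - by move=> n y z z' [x [<- ->]] [x' [/inj -> ->]].
  - by move=> m n q y z [x [<- ->]]; exists (sact X q x); rewrite !snat.
  have [h hh] := ext_full_to E1 g'.
  exists h; apply: smap_eq => n x /=.
  have hP : P n (f n x) by apply/im; exists x.
  by rewrite (hh n _ hP); have [x' [/inj -> ->]] := hg' n _ hP.
split=> [g|h1 h2].
  by have [h <-] := extend g; exists h; apply: rst_refl.
suff W a b : homot a b -> forall ha hb : SMap Y Z, scomp ha f = a -> scomp hb f = b -> homot ha hb.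
  by move=> H; exact: W H _ _ erefl erefl.
have step x y : ehomot x y -> forall ha hb : SMap Y Z, scomp ha f = x -> scomp hb f = y -> homot ha hb.
  case=> H [H0 H1] ha hb ea eb; apply: rst_step.
  have s01 n (s : Dmap n 1) i : (forall j, s j = i) -> s = cst n i.
    by move=> k; apply: dmap_eq.
  have [|||G hG] := @partmap_of_rel (Prod Y (Std 1)) Z (cyl_bd P) (fun n p z =>
      [\/ exists x, f n x = p.1 /\ z = H n (x, p.2),
          p.2 = cst n ord0 /\ z = ha n p.1 |
          p.2 = cst n ord_max /\ z = hb n p.1]).
  - move=> n [p s] [/im [q hq]|h]; first by exists (H n (q, s)); constructor 1; exists q.
    case: (ord2P (s ord0)) => e.
      by exists (ha n p); constructor 2; split=> //; apply: s01 => j; rewrite -e; apply: h.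
    by exists (hb n p); constructor 3; split=> //; apply: s01 => j; rewrite -e; apply: h.
  - have c01 n : cst n ord0 = cst n ord_max -> False.
      by move=> e; have := f_equal (fun d : Dmap n 1 => val (d ord0)) e.
    have K0 n q : H n (q, cst n ord0) = ha n (f n q) by rewrite H0 -ea.
    have K1 n q : H n (q, cst n ord_max) = hb n (f n q) by rewrite H1 -eb.
    move=> n [p s] z z' /= [[q [hq ->]]|[-> ->]|[-> ->]] [[q' [hq' ->]]|[e ->]|[e ->]] //.
    + by rewrite -hq in hq'; rewrite (inj _ _ _ hq').
    + by rewrite e K0 hq.
    + by rewrite e K1 hq.
    + by rewrite K0 hq'.
    + by case: (c01 n).
    + by rewrite K1 hq'.
    + by case: (c01 n).
  - move=> m n q [p s] z /= [[u [hu ->]]|[-> ->]|[-> ->]].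
    + constructor 1; exists (sact X q u); rewrite snat hu; split=> //.
      by rewrite -(snat H q (u, s)).
    + by constructor 2; rewrite cst_comp snat.
    + by constructor 3; rewrite cst_comp snat.
  have clf : ext Z (cyl_bd P) (@sfull (Prod Y (Std 1))).
    by apply: (ext_mono _ E2) => n p _; left.
  have [W hW] := ext_full_to clf G.
  have c0 n p i : cyl_bd P (n := n) (p, cst n i) by right.
  exists W; split=> n p.
    rewrite (hW n _ (c0 n p ord0)).
    have [[q [/= hq ->]]|[_ ->]//|[/= e _]] := hG n _ (c0 n p ord0).
      by rewrite H0 -ea /= hq.
    by have := f_equal (fun d : Dmap n 1 => val (d ord0)) e.
  rewrite (hW n _ (c0 n p ord_max)).
  have [[q [/= hq ->]]|[/= e _]|[_ ->]//] := hG n _ (c0 n p ord_max).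
    by rewrite H1 -eb /= hq.
  by have := f_equal (fun d : Dmap n 1 => val (d ord0)) e.
elim=> {a b} [a b /step S|a|a b _ IH|a b c _ IH1 _ IH2] ha hb ea eb.
- exact: S ea eb.
(* [ha] and [hb] agree only on [X], so even the reflexive case has to extend a homotopy, the
   constant one. *)
- apply: (step a a) => //.
  by exists (@Build_SMap (Prod X (Std 1)) Z (fun n p => a n p.1) (fun m n q p => snat a q p.1)).
- by apply: rst_sym; apply: IH.
- have [h hh] := extend b; apply: rst_trans (IH1 _ _ ea hh) (IH2 _ _ hh eb).
Qed.

(** * Acyclic extensions of simplicial complexes *)

Lemma pred_ext V (S T : V -> Prop) : (forall x, S x <-> T x) -> S = T.
Proof. by move=> h; apply: functional_extensionality => x; apply: propositional_extensionality. Qed.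

Definition vfam (U : Cpx) := (vert U -> Prop) -> Prop.

Definition fclosed (U : Cpx) (F : vfam U) : Prop :=
  forall S T, F S -> psub T S -> pnonempty T -> F T.

Definition rng (U : Cpx) n (s : CMap (Delta n) U) : vert U -> Prop :=
  fun v => exists i : 'I_n.+1, s i = v.

(** Only the vertex set matters: a simplex of [Sing U] is any tuple, repetitions allowed, whose
    entries span a simplex. *)
Definition fam (U : Cpx) (F : vfam U) : spred (Sing U) := fun n s => F (rng s).

Lemma rng_nonempty U n (s : CMap (Delta n) U) : pnonempty (rng s).
Proof. by exists (s ord0), ord0. Qed.

Lemma rng_simplex U n (s : CMap (Delta n) U) : simplex U (rng s).
Proof.
have h : simplex (Delta n) (fun _ => True) by exists ord0.
apply: (simplex_sub (cfun_simplex s h)); last exact: rng_nonempty.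
by move=> v [i <-]; exists i.
Qed.

Definition mk_sing (U : Cpx) n (s : 'I_n.+1 -> vert U)
  (h : simplex U (fun v => exists i, s i = v)) : CMap (Delta n) U.
Proof.
refine (@Build_CMap (Delta n) U s _) => S [i Si]; apply: (simplex_sub h).
  by move=> v [j [_ <-]]; exists j.
by exists (s i), i.
Defined.

Lemma fam_closed U (F : vfam U) : fclosed F -> sclosed (fam F).
Proof.
move=> cl m n f s h; apply: cl h _ _; last exact: rng_nonempty.
by move=> v [i <-]; exists (f i).
Qed.

Definition punion V (S T : V -> Prop) : V -> Prop := fun x => S x \/ T x.

(** Contiguity of self-maps of the pair [(C, F)]. It is stated for plain vertex functions because it
    forces both of them to be simplicial. *)
Definition contig (C : Cpx) (F : vfam C) (f g : vert C -> vert C) : Prop :=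
  (forall S, simplex C S -> simplex C (punion (pimage f S) (pimage g S))) /\
  (forall S, simplex C S -> F S -> F (punion (pimage f S) (pimage g S))).

Lemma contig_sub (C : Cpx) (F : vfam C) (f g : vert C -> vert C) (h : vert C -> vert C) :
  contig F f g -> (forall v, h v = f v) \/ (forall v, h v = g v) ->
  exists H : CMap C C, forall v, H v = h v.
Proof.
move=> [c _] hh; unshelve eexists.
  refine (@Build_CMap C C h _) => S hS; apply: (simplex_sub (c S hS)).
    by move=> v [x [Sx <-]]; case: hh => ->; [left|right]; exists x.
  have [_ [x Sx]] := simplex_fin hS; by exists (h x), x.
by [].
Qed.

(** Vertex [i] is moved by [F] or by [G] according to its time coordinate. Tuples in [Sing] carry no
    order, so this is already a homotopy and no prism decomposition is needed. *)
Lemma contig_pstep (C : Cpx) (Phi : vfam C) (F G : CMap C C) : fclosed Phi ->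
  contig Phi F G -> pstep (fam Phi) (SingMap F) (SingMap G).
Proof.
move=> cl [cS cP].
pose fn n (p : Prod (Sing C) (Std 1) n) (i : 'I_n.+1) :=
  if p.2 i == ord0 then F ((p.1 : CMap _ _) i) else G ((p.1 : CMap _ _) i).
have sub n (p : Prod (Sing C) (Std 1) n) :
    psub (fun v => exists i, fn n p i = v) (punion (pimage F (rng p.1)) (pimage G (rng p.1))).
  move=> v [i <-]; rewrite /fn; case: ifP => _; [left|right];
    by exists ((p.1 : CMap _ _) i); split=> //; exists i.
have ne n (p : Prod (Sing C) (Std 1) n) : pnonempty (fun v => exists i, fn n p i = v).
  by exists (fn n p ord0), ord0.
have sm n (p : Prod (Sing C) (Std 1) n) : simplex C (fun v => exists i, fn n p i = v).
  exact: simplex_sub (cS _ (rng_simplex p.1)) (sub n p) (ne n p).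
unshelve eexists.
  refine (@Build_SMap (Prod (Sing C) (Std 1)) (Sing C) (fun n p => mk_sing (sm n p)) _).
  by move=> m n f p; apply: cmap_eq.
split=> [n s|n s|n s t hs].
- by apply: cmap_eq => i.
- by apply: cmap_eq => i.
- exact: cl (cP _ (rng_simplex s) hs) (sub n (s, t)) (ne n (s, t)).
Qed.

Lemma contig_pcontr (C : Cpx) (Phi : vfam C) (c : vert C) : fclosed Phi ->
  Phi (fun x => x = c) -> clos_refl_trans_1n _ (contig Phi) (fun _ => c) id ->
  pcontr (fam Phi).
Proof.
move=> cl Pc H.
have W f g : clos_refl_trans_1n _ (contig Phi) f g ->
    forall F G : CMap C C, (forall v, F v = f v) -> (forall v, G v = g v) ->
    clos_refl_trans_1n _ (pstep (fam Phi)) (SingMap F) (SingMap G).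
  elim=> [a F G eF eG|a b d hab _ IH F G eF eG].
    have -> : F = G by apply: cmap_eq => v; rewrite eF eG.
    exact: rt1n_refl.
  have [B eB] := contig_sub (h := b) hab (or_intror (fun=> erefl)).
  have EF : (F : _ -> _) = a by apply: functional_extensionality.
  have EB : (B : _ -> _) = b by apply: functional_extensionality.
  apply: Relation_Operators.rt1n_trans (IH B G eB eG).
  by apply: contig_pstep => //; rewrite EF EB.
have c0 : simplex C (fun v => exists i : 'I_1, c = v).
  apply: (simplex_sub (simplex_single c)); [by move=> v [_ <-] | by exists c, ord0].
exists (mk_sing (n := 0) (s := fun _ => c) c0); split.
  by apply: cl Pc _ _; [move=> v [i <-] | exact: rng_nonempty].
have cc : forall S, simplex C S -> simplex C (pimage (fun _ : vert C => c) S).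
  move=> S /simplex_fin [_ [x Sx]]; apply: (simplex_sub (simplex_single c)).
    by move=> v [y [_ <-]].
  by exists c, x.
have ic : forall S, simplex C S -> simplex C (pimage id S).
  move=> S hS; have [_ [x Sx]] := simplex_fin hS; apply: (simplex_sub hS).
    by move=> v [y [Sy <-]].
  by exists x, x.
have := W _ _ H (Build_CMap cc) (Build_CMap ic) (fun=> erefl) (fun=> erefl).
have -> : SingMap (Build_CMap ic) = sid (Sing C).
  by apply: smap_eq => n s; apply: cmap_eq.
set A := SingMap _; set B := sconst _; have -> // : A = B.
by apply: smap_eq => n s; apply: cmap_eq.
Qed.

Lemma rng_comp C U (f : CMap C U) n (s : CMap (Delta n) C) : rng (cmcomp f s) = pimage f (rng s).
Proof.
apply: pred_ext => v; split; first by case=> i <-; exists (s i); split=> //; exists i.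
by case=> w [[i <-] <-]; exists i.
Qed.

Lemma acyclic_complex_cells (U : Cpx) (P P' : vfam U) (J : Type) (C : J -> Cpx)
    (chi : forall j, CMap (C j) U) :
  fclosed P -> (forall S, simplex U S -> P S -> P' S) ->
  (forall S, simplex U S -> P' S -> P S \/ exists j T, simplex (C j) T /\ pimage (chi j) T = S) ->
  (forall j v w, chi j v = chi j w -> v = w) ->
  (forall j j' T T', simplex (C j) T -> simplex (C j') T' ->
     pimage (chi j) T = pimage (chi j') T' -> ~ P (pimage (chi j) T) -> j = j') ->
  (forall j, pcontr (fam (fun S => P (pimage (chi j) S)))) ->
  acyclic (fam P) (fam P').
Proof.
move=> clP PP' cov inj dis ctr.
apply: (@acyclic_cells (Sing U) _ _ J (fun j => Sing (C j))
          (fun j => fam (fun S => P (pimage (chi j) S))) (fun j => SingMap (chi j))) => //.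
- exact: fam_closed.
- by move=> n s; apply: PP'; exact: rng_simplex.
- by move=> j n c; rewrite /fam /= rng_comp.
- move=> n s /(cov _ (rng_simplex s)) [h|[j [T [hT eT]]]]; [by left | right].
  have [t ht] : exists t : 'I_n.+1 -> vert (C j), forall i, T (t i) /\ chi j (t i) = s i.
    suff H i : exists v, T v /\ chi j v = s i by exact: choice_fun H.
    have : rng s (s i) by exists i.
    by rewrite -eT.
  have sT : simplex (C j) (fun v => exists i, t i = v).
    apply: (simplex_sub hT); first by move=> v [i <-]; case: (ht i).
    by exists (t ord0), ord0.
  exists j, (mk_sing sT); apply: cmap_eq => i /=; by case: (ht i).
- move=> n j j' c c' E nP.
  have Er := f_equal (@rng U n) E; rewrite /= !rng_comp in Er.
  have jj : j = j'.
    by apply: dis (rng_simplex c) (rng_simplex c') Er _; rewrite /fam /= rng_comp in nP.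
  subst j'; congr existT; apply: cmap_eq => i.
  by apply: inj; have := f_equal (fun s : CMap (Delta n) U => s i) E.
Qed.

(** At most [i] elements, expressed without decidable equality on [V]. *)
Definition coverable V (i : nat) (S : V -> Prop) : Prop :=
  exists g : 'I_i -> V, forall x, S x -> exists j, g j = x.

Lemma coverable_sub V i (S T : V -> Prop) : coverable i S -> psub T S -> coverable i T.
Proof. by case=> g hg h; exists g => x /h /hg. Qed.

Lemma coverable_drop V i (S T : V -> Prop) x : coverable i.+1 S -> psub T S ->
  S x -> ~ T x -> coverable i T.
Proof.
case=> g hg TS Sx nT; have [j0 hj0] := hg x Sx.
exists (fun j => g (lift j0 j)) => y Ty; have [j hj] := hg y (TS y Ty).
have ne : j0 != j by apply/eqP => e; apply: nT; rewrite -hj0 e hj.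
by have [k ek _] := unlift_some ne; exists k; rewrite -ek.
Qed.

Section SubComplex.
Variables (U : Cpx) (F : vfam U).
Hypotheses (Fcl : fclosed F) (FU : forall S, F S -> simplex U S).

Definition sub_cpx : Cpx.
Proof.
refine {| vert := {x : vert U | F (fun y => y = x)};
          simplex := fun S => F (pimage (@proj1_sig _ _) S) |}.
- move=> S hS; have [[n [g hg]] [y [x [Sx _]]]] := simplex_fin (FU hS).
  split; last by exists x.
  exists n, (fun i => match excluded_middle_informative (F (fun y => y = g i)) with
                      | left h => exist _ (g i) h | right _ => x end).
  move=> z Sz; have [|i hi] := hg (proj1_sig z); first by exists z.
  exists i; case: excluded_middle_informative => [h|[]]; first exact: sig_eq.
  by rewrite hi; exact: (proj2_sig z).
- move=> v; have -> : pimage (@proj1_sig _ _) (fun x => x = v) = (fun y => y = proj1_sig v).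
    by apply: pred_ext => y; split=> [[x [-> <-]]|->] //; exists v.
  exact: (proj2_sig v).
- move=> S T hS TS [x Tx]; apply: Fcl hS _ _; last by exists (proj1_sig x), x.
  by move=> y [z [/TS Sz <-]]; exists z.
Defined.

Definition sub_incl : CMap sub_cpx U.
Proof.
refine (@Build_CMap sub_cpx U (fun v => proj1_sig v) _).
move=> S hS; exact: FU.
Defined.
End SubComplex.

(* A simplex of [Theta] with vertex set [sigma] in [D] is attached, together with its link, along
   its boundary joined with the link; a cone point of the link makes this an acyclic extension. *)
Lemma acyclic_link (U : Cpx) (Theta : vfam U) (D : vert U -> Prop) :
  fclosed Theta -> (forall S, Theta S -> simplex U S) ->
  (forall sigma, Theta sigma -> (forall x, sigma x -> D x) ->
     exists c, ~ D c /\ forall S, (forall x, S x -> D x -> sigma x) ->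
       Theta (punion S sigma) -> Theta (punion (fun x => x = c) (punion S sigma))) ->
  acyclic (fam (fun S => Theta S /\ forall x, S x -> ~ D x)) (fam Theta).
Proof.
move=> cl TU cone.
pose SD (S : vert U -> Prop) x := S x /\ D x.
pose P i : vfam U := fun S => Theta S /\ coverable i (SD S).
have clP i : fclosed (P i).
  move=> S T [h1 h2] TS ne; split; first exact: cl h1 TS ne.
  by apply: (coverable_sub h2) => x [/TS].
have Punion (S : vert U -> Prop) (T : vert U -> Prop) : Theta (punion S T) -> pnonempty S -> Theta S.
  by move=> h; apply: cl h _ => x; left.
suff A : acyclic (fam (P 0)) (fam Theta).
  have -> // : (fun S => Theta S /\ forall x, S x -> ~ D x) = P 0.
  apply: pred_ext => S; split=> -[h1 h2]; split=> //.
    have [_ [x Sx]] := simplex_fin (TU _ h1).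
    by exists (fun _ => x) => y [/h2].
  by move=> x Sx Dx; case: h2 => g hg; have [[]] := hg x (conj Sx Dx).
apply: (acyclic_seq (P := fun i => fam (P i))).
- move=> i n s [h1 [g hg]]; split=> //.
  exists (fun j => if unlift ord_max j is Some k then g k else s ord0) => x /hg [j <-].
  by exists (lift ord_max j); rewrite liftK.
- move=> n s h; have [[i [g hg]] _] := simplex_fin (rng_simplex s).
  by exists i; split=> //; exists g => x [/hg].
- by move=> i; apply: fam_closed.
move=> i.
(* The join of [sigma] with its link: what spans a simplex of [Theta] with [sigma] and has no
   further vertex in [D]. *)
pose Psi (sigma : vert U -> Prop) : vfam U := fun S =>
  [/\ pnonempty S, Theta (punion S sigma) & forall x, S x -> D x -> sigma x].
have Pcl sigma : fclosed (Psi sigma).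
  move=> S T [_ h2 h3] TS ne; split=> // [|x /TS]; last exact: h3.
  apply: cl h2 _ _; last by case: ne => x Tx; exists x; left.
  by move=> x [/TS|]; [left|right].
have PT sigma S : Psi sigma S -> Theta S by case=> h1 h2 h3; exact: Punion h2 h1.
have PU sigma S : Psi sigma S -> simplex U S by move=> /PT; apply: TU.
pose J := {sigma : vert U -> Prop | [/\ Theta sigma, forall x, sigma x -> D x,
   coverable i.+1 sigma & ~ coverable i sigma]}.
apply: (@acyclic_complex_cells U (P i) (P i.+1) J (fun j => sub_cpx (Pcl (proj1_sig j)) (@PU _))
  (fun j => sub_incl (Pcl (proj1_sig j)) (@PU _))) => //.
- move=> S /simplex_fin [_ [s Ss]] [h1 [g hg]]; split=> //.
  exists (fun j => if unlift ord_max j is Some k then g k else s) => x /hg [j <-].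
  by exists (lift ord_max j); rewrite liftK.
- move=> S hS [TS cS].
  case: (classic (coverable i (SD S))) => nc; [by left | right].
  have [_ [s Ss]] := simplex_fin hS.
  have ne : pnonempty (SD S).
    by apply: NNPP => h; apply: nc; exists (fun _ => s) => x hx; case: h; exists x.
  have hj : [/\ Theta (SD S), forall x, SD S x -> D x, coverable i.+1 (SD S) & ~ coverable i (SD S)].
    by split=> // [|x []//]; apply: cl TS _ ne => x [].
  have PsiT T : psub T S -> pnonempty T -> Psi (SD S) T.
    move=> h neT; split=> // [|x /h]; last by [].
    apply: cl TS _ _; last by case: ne => x Dx; exists x; right.
    by move=> x [/h|[]].
  exists (exist _ (SD S) hj), (fun t => S (proj1_sig t)).
  have E : pimage (@proj1_sig _ (fun x => Psi (SD S) (fun y => y = x)))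
             (fun t => S (proj1_sig t)) = S.
    apply: pred_ext => x; split; first by case=> t [h <-].
    move=> Sx; unshelve eexists; first exists x; last by split.
    by apply: PsiT; [move=> y -> | exists x].
  by split; rewrite /= E //; apply: PsiT => //; exists s.
- by move=> j v w /= e; apply: sig_eq.
- move=> [s [Ts sD cs ns]] [s' [Ts' sD' cs' ns']] T T' /= hT hT' E nP.
  (* A simplex of the cell that missed a vertex of [t] would have at most [i] vertices in [D] and
     lie in [P i]. So its part in [D] is all of [t], and the simplex determines its cell. *)
  have key t : Theta t -> coverable i.+1 t -> ~ coverable i t -> (forall x, t x -> D x) ->
     Psi t (pimage (@proj1_sig _ _) T) -> t = SD (pimage (@proj1_sig _ _) T).
    move=> Tt ct nt tD ht; apply: pred_ext => x; split=> [tx|[h1 h2]]; last first.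
      by case: ht => _ _; apply.
    apply: NNPP => nx; apply: nP; split; first exact: PT ht.
    by apply: (coverable_drop ct _ tx nx) => y [h1 h2]; case: ht => _ _; apply.
  have E1 := key s Ts cs ns sD hT.
  have E2 : s' = SD (pimage (@proj1_sig _ _) T).
    by apply: key => //; rewrite E.
  by apply: sig_eq => /=; rewrite E1 E2.
- move=> [s [Ts sD cs ns]] /=.
  have [_ [s0 ss0]] := simplex_fin (TU _ Ts).
  have [c [nDc hc]] := cone s Ts sD.
  have Tc : Theta (punion (fun x => x = c) s).
    have := hc s (fun x h _ => h); have -> : punion s s = s by apply: pred_ext => x; split=> [[]//|]; left.
    exact.
  have Psic : Psi s (fun x => x = c) by split=> // [|x -> //]; exists c.
  have Fc S : Psi s S -> Psi s (punion (fun x => x = c) S).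
    move=> [h1 h2 h3]; split; first by exists c; left.
      have -> : punion (punion (fun x => x = c) S) s = punion (fun x => x = c) (punion S s).
        by apply: pred_ext => x; rewrite /punion; tauto.
      exact: hc.
    by move=> x [->//|]; apply: h3.
  refine (@contig_pcontr (sub_cpx (Pcl s) (@PU s)) _ (exist _ c Psic) _ _ _).
  + move=> S T h TS [t Tt]; apply: clP h _ _; last by exists (proj1_sig t), t.
    by move=> x [y [/TS Sy <-]]; exists y.
  + split; first by apply: cl Tc _ _; [by move=> x [y [-> <-]]; left | by exists c, (exist _ c Psic)].
    by exists (fun _ => c) => x [[y [-> <-]]].
  have pim S : pnonempty S -> pimage (@proj1_sig _ (fun x => Psi s (fun y => y = x)))
       (punion (pimage (fun _ => exist _ c Psic) S) (pimage id S)) =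
       punion (fun x => x = c) (pimage (@proj1_sig _ _) S).
    move=> [t St]; apply: pred_ext => x; split.
      case=> y [[[z [_ <-]]|[z [Sz <-]]] <-]; first by left.
      by right; exists z.
    case=> [->|[y [Sy <-]]]; first by exists (exist _ c Psic); split=> //; left; exists t.
    by exists y; split=> //; right; exists y.
  (* Adding [c] stays within the cell and creates no vertex in [D], so the constant map at [c] is
     contiguous to the identity as a map of pairs. *)
  apply: Relation_Operators.rt1n_trans (rt1n_refl _ _ _); split=> S hS.
    have [_ ne] := simplex_fin hS.
    by rewrite /= pim //; apply: Fc.
  have [_ ne] := simplex_fin hS.
  move=> [h1 h2]; rewrite pim //; split; first exact: PT (Fc _ hS).
  by apply: (coverable_sub h2) => x [[->//|h] Dx].
Qed.

(** * Flags of faces of a simplex *)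

Section Flags.
Variable n : nat.
Local Notation Fl := {set {set 'I_n.+1}}.

Definition scmp (T : finType) (A B : {set T}) : bool := (A \subset B) || (B \subset A).

Lemma scmp_sym T (A B : {set T}) : scmp A B = scmp B A.
Proof. by rewrite /scmp orbC. Qed.

Lemma scmp_refl T (A : {set T}) : scmp A A.
Proof. by rewrite /scmp subxx. Qed.

(** A nonempty chain of nonempty faces, that is, a vertex of the second subdivision of the
    [n]-simplex. Its simplices are the chains of flags under inclusion. *)
Definition is_flag (b : Fl) : bool :=
  [&& b != set0, set0 \notin b & [forall S in b, forall T in b, scmp S T]].

Lemma is_flagP (b : Fl) :
  reflect [/\ b != set0, set0 \notin b & forall S T, S \in b -> T \in b -> scmp S T] (is_flag b).
Proof.
apply: (iffP and3P) => -[h1 h2 h3]; split=> //.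
  by move=> S T hS hT; move/forall_inP: h3 => /(_ S hS) /forall_inP /(_ T hT).
by apply/forall_inP => S hS; apply/forall_inP => T hT; apply: h3.
Qed.

Variable k : 'I_n.+1.

(* [k |: S != setT] says that the face [S] lies in the horn. *)
Definition in_horn (b : Fl) : bool := [forall S in b, k |: S != setT].
Definition meets_horn (b : Fl) : bool := [exists S in b, k |: S != setT].

Definition off_horn (b : Fl) : bool := is_flag b && ~~ in_horn b.

Lemma off_hornP b : reflect (is_flag b /\ exists2 S, S \in b & k |: S = setT) (off_horn b).
Proof.
apply: (iffP andP) => -[h1 h2]; split=> //.
  by move: h2; rewrite negb_forall_in => /exists_inP [S hS] /negPn /eqP e; exists S.
by rewrite negb_forall_in; case: h2 => S hS e; apply/exists_inP; exists S; rewrite // e negbK.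
Qed.

Definition off_cpx : Cpx.
Proof.
refine {| vert := {b : Fl | off_horn b};
          simplex := fun S => pnonempty S /\ forall b c, S b -> S c -> scmp (val b) (val c) |}.
- move=> S [ne _]; split=> //.
  exists #|{: {b : Fl | off_horn b}}|, enum_val => x _.
  by exists (enum_rank x); rewrite enum_rankK.
- by move=> v; split; [exists v | move=> b c -> ->; exact: scmp_refl].
- by move=> S T [_ h] TS ne; split=> // b c /TS hb /TS hc; apply: h.
Defined.

(** The collar: flags with some but, being vertices of [off_cpx], not all of their faces in the
    horn. *)
Definition off_meets : vfam off_cpx := fun S => forall b, S b -> meets_horn (val b).

Local Notation clos := (clos_refl_trans_1n _ (contig off_meets)).

Lemma clos_trans f g h : clos f g -> clos g h -> clos f h.
Proof. by elim=> // a b c ab _ IH /IH; apply: Relation_Operators.rt1n_trans. Qed.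

Definition layer (f g : Fl -> Fl) (j : nat) (b : Fl) : Fl := if j <= #|b| then g b else f b.

Definition preserves (f : Fl -> Fl) : Prop :=
  [/\ forall b, off_horn b -> off_horn (f b),
      forall b, off_horn b -> meets_horn b -> meets_horn (f b) &
      forall b c : Fl, b \subset c -> f b \subset f c].

Definition lifts (F : vert off_cpx -> vert off_cpx) (f : Fl -> Fl) : Prop :=
  forall v, val (F v) = f (val v).

Lemma lift_exists f : preserves f -> exists F, lifts F f.
Proof.
case=> h _ _.
by exists (fun v : {b | off_horn b} => exist _ (f (val v)) (h _ (valP v)) : {b | off_horn b}).
Qed.

Lemma lifts_unique F G f : lifts F f -> lifts G f -> F = G.
Proof.
by move=> h1 h2; apply: functional_extensionality => v; apply: val_inj; rewrite h1 h2.
Qed.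

(** Consecutive layers differ only on flags of cardinality [j], and a chain contains at most one of
    these. For a proper inclusion of [b] in [c], it cannot happen that [b] is moved by [g] while [c]
    is still moved by [f], so the images remain comparable. *)
Lemma layer_contig f g j F G : preserves f -> preserves g ->
  (forall b, off_horn b -> f b \subset g b) ->
  lifts F (layer f g j.+1) -> lifts G (layer f g j) ->
  contig off_meets F G /\ contig off_meets G F.
Proof.
move=> [f1 f2 f3] [g1 g2 g3] fg lF lG.
have key1 x y b c : off_horn b -> off_horn c -> b \subset c -> j <= x <= j.+1 -> j <= y <= j.+1 ->
    scmp (layer f g x b) (layer f g y c).
  move=> hb hc bc hx hy; rewrite /layer.
  have hbc := subset_leq_card bc.
  have [cb|ncb] := boolP (c \subset b).
    have -> : c = b by apply/eqP; rewrite eqEsubset cb bc.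
    have := fg b hb; case: ifP => _; case: ifP => _; rewrite /scmp ?subxx // => -> //; by rewrite orbT.
  have lt : #|b| < #|c| by apply: proper_card; rewrite properE bc ncb.
  case: ifP => h1; case: ifP => h2; last by rewrite /scmp f3.
  - by rewrite /scmp g3.
  - lia.
  - have h : f b \subset g c by apply: subset_trans (fg b hb) _; apply: g3.
    by rewrite /scmp h.
have key x y b c : off_horn b -> off_horn c -> scmp b c -> j <= x <= j.+1 -> j <= y <= j.+1 ->
    scmp (layer f g x b) (layer f g y c).
  move=> hb hc /orP [h|h] hx hy; first exact: key1.
  by rewrite scmp_sym; apply: key1.
suff c : contig off_meets F G.
  split=> //; case: c => c1 c2; split=> S hS.
    have -> : punion (pimage G S) (pimage F S) = punion (pimage F S) (pimage G S).
      by apply: pred_ext => x; rewrite /punion; tauto.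
    exact: c1.
  have -> : punion (pimage G S) (pimage F S) = punion (pimage F S) (pimage G S).
    by apply: pred_ext => x; rewrite /punion; tauto.
  exact: c2.
have lay x b : off_horn b -> meets_horn b -> meets_horn (layer f g x b).
  by move=> hb hm; rewrite /layer; case: ifP => _; [apply: g2 | apply: f2].
split=> S hS.
  case: hS => -[v Sv] hS; split; first by exists (F v); left; exists v.
  by move=> b c [[x [Sx <-]]|[x [Sx <-]]] [[y [Sy <-]]|[y [Sy <-]]];
     rewrite ?lF ?lG; apply: key; rewrite ?leqnn ?leqnSn ?(valP x) ?(valP y) //; apply: hS.
by move=> h b [[x [/h Sx <-]]|[x [/h Sx <-]]]; rewrite ?lF ?lG; apply: lay => //; apply: valP.
Qed.

(* Comparable monotone maps of flags are joined by changing their values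
   one cardinality at a time, starting from the largest flags. *)
Lemma layer_clos f g F G : preserves f -> preserves g ->
  (forall b, off_horn b -> f b \subset g b) -> lifts F f -> lifts G g ->
  clos F G /\ clos G F.
Proof.
move=> pf pg fg lF lG.
have lay j : exists H, lifts H (layer f g j).
  have h (v : {b | off_horn b}) : off_horn (layer f g j (val v)).
    have hv := valP v; rewrite /layer; case: ifP => _; [case: pg | case: pf] => h _ _; exact: h.
  by exists (fun v => exist (fun b => off_horn b) _ (h v) : {b | off_horn b}).
have W j H : lifts H (layer f g j) -> clos H G /\ clos G H.
  elim: j H => [|j IH] H lH.
    have -> : H = G by apply: lifts_unique lH _; move=> v; rewrite lG.
    by split; exact: rt1n_refl.
  have [H' lH'] := lay j; have [c1 c2] := IH H' lH'.
  have [d1 d2] := layer_contig pf pg fg lH lH'.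
  split; first exact: Relation_Operators.rt1n_trans d1 c1.
  by apply: clos_trans c2 _; apply: Relation_Operators.rt1n_trans d2 _; exact: rt1n_refl.
apply: (W #|{: {set 'I_n.+1}}|.+1) => v; rewrite lF /layer.
by have := max_card (mem (val v)); case: leqP => //; lia.
Qed.

(** Interpolates between [S |-> k |: S] at [j = 0] and the identity for large [j]. The set [k |: S]
    never changes, so a face stays in or off the horn. *)
Definition kap (j : nat) (S : {set 'I_n.+1}) := if j <= #|S| then k |: S else S.

Lemma kapU j S : k |: kap j S = k |: S.
Proof. by rewrite /kap; case: ifP => // _; rewrite setUA setUid. Qed.

Lemma kap_neq0 j S : S != set0 -> kap j S != set0.
Proof.
by move=> h; rewrite /kap; case: ifP => // _; apply/set0Pn; exists k; rewrite setU11.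
Qed.

Lemma kap_scmp j x y S T : scmp S T -> j <= x <= j.+1 -> j <= y <= j.+1 ->
  scmp (kap x S) (kap y T).
Proof.
have sub (A B : {set 'I_n.+1}) : A \subset B -> scmp A B by rewrite /scmp => ->.
have W x' y' (S' T' : {set 'I_n.+1}) : S' \subset T' -> j <= x' <= j.+1 -> j <= y' <= j.+1 -> scmp (kap x' S') (kap y' T').
  move=> ST hx hy; have := subset_leq_card ST => le; rewrite /kap.
  case: ifP => h1; case: ifP => h2.
  - by apply: sub; apply: setUS.
  - have -> : T' = S' by apply/eqP; rewrite eq_sym eqEcard ST; lia.
    by rewrite scmp_sym; apply: sub; apply: subsetUr.
  - by apply: sub; apply: subset_trans ST _; apply: subsetUr.
  - exact: sub.
by case/orP => h hx hy; [|rewrite scmp_sym]; apply: W.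
Qed.

Definition Kap j (b : Fl) : Fl := [set kap j S | S in b].

Lemma KapU_flag j x y b : is_flag b -> j <= x <= j.+1 -> j <= y <= j.+1 ->
  is_flag (Kap x b :|: Kap y b).
Proof.
move=> /is_flagP [h1 h2 h3] hx hy; apply/is_flagP; split.
- case/set0Pn: h1 => S hS; apply/set0Pn; exists (kap x S).
  by rewrite inE imset_f.
- apply/negP; rewrite inE => /orP [] /imsetP [S hS e];
  by move: (e) => /esym /eqP; apply/negP; apply: kap_neq0; apply/negP => /eqP e0; rewrite -e0 hS in h2.
- move=> S T; rewrite !inE => /orP [] /imsetP [S' hS' ->] /orP [] /imsetP [T' hT' ->];
  by apply: (@kap_scmp j) => //; apply: h3.
Qed.

(** The union of two consecutive stages contains both, so it serves as the middle term of a zigzag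
    of comparable maps. *)
Lemma KapU_preserves j x y : j <= x <= j.+1 -> j <= y <= j.+1 ->
  preserves (fun b => Kap x b :|: Kap y b).
Proof.
move=> hx hy; split.
- move=> b /off_hornP [fb [S hS e]]; apply/off_hornP; split; first exact: (@KapU_flag j).
  by exists (kap x S); rewrite ?kapU // inE imset_f.
- move=> b _ /exists_inP [S hS h]; apply/exists_inP; exists (kap x S); rewrite ?kapU //.
  by rewrite inE imset_f.
- by move=> b c bc; apply: setUSS; apply: imsetS.
Qed.

Lemma Kap_preserves j : preserves (Kap j).
Proof.
have := @KapU_preserves j j j; rewrite leqnn leqnSn => /(_ isT isT).
by have -> // : (fun b => Kap j b :|: Kap j b) = Kap j;
   apply: functional_extensionality => b; rewrite setUid.
Qed.

Hypothesis n_gt0 : 0 < n.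

(** After [Kap 0] every face contains [k], hence is comparable with both [[set k]] and [setT], and
    this flag can be adjoined. It lies in the collar: [[set k]] is in the horn since [n] is
    positive, [setT] is not. *)
Definition apex_flag : Fl := [set [set k]; setT].

Lemma apexU_preserves : preserves (fun b => Kap 0 b :|: apex_flag).
Proof.
have cmp (S : {set 'I_n.+1}) : k \in S -> scmp [set k] S by rewrite /scmp sub1set => ->.
have cmpT (S : {set 'I_n.+1}) : scmp S setT by rewrite /scmp subsetT.
have cmpT' (S : {set 'I_n.+1}) : scmp setT S by rewrite scmp_sym.
split.
- move=> b /off_hornP [fb [S hS e]]; apply/off_hornP; split; last first.
    by exists setT; rewrite ?setUT // !inE eqxx !orbT.
  have hb : off_horn b by apply/off_hornP; split=> //; exists S.
  case: (Kap_preserves 0) => h _ _; have /off_hornP [/is_flagP [k1 k2 k3] _] := h b hb.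
  apply/is_flagP; split.
  + by apply/set0Pn; exists setT; rewrite !inE eqxx !orbT.
  + rewrite !inE (negbTE k2) /=; apply/negP => /orP [] /eqP /setP /(_ k); by rewrite !inE ?eqxx.
  + have kin A : A \in Kap 0 b -> k \in A by case/imsetP => B _ ->; rewrite /kap /= setU11.
    move=> A B; rewrite !inE => /orP [hA|/orP [] /eqP ->] /orP [hB|/orP [] /eqP ->] //;
      rewrite ?scmp_refl //; first exact: k3.
      by rewrite scmp_sym; apply: cmp; apply: kin.
    by apply: cmp; apply: kin.
- move=> b hb hm; case: (Kap_preserves 0) => _ h _.
  have /exists_inP [S hS e] := h b hb hm.
  by apply/exists_inP; exists S; rewrite // inE hS.
- by move=> b c bc; apply: setUSS => //; apply: imsetS.
Qed.

Lemma set1_neqT : [set k] != setT.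
Proof. by apply/eqP => /(f_equal (fun S : {set 'I_n.+1} => #|S|)); rewrite cards1 cardsT card_ord; lia. Qed.

Lemma apex_off : off_horn apex_flag /\ meets_horn apex_flag.
Proof.
split; last by apply/exists_inP; exists [set k]; rewrite ?setUid ?set1_neqT // !inE eqxx.
apply/off_hornP; split; last by exists setT; rewrite ?setUT // !inE eqxx orbT.
apply/is_flagP; split.
- by apply/set0Pn; exists setT; rewrite !inE eqxx orbT.
- by rewrite !inE; apply/negP => /orP [] /eqP /setP /(_ k); rewrite !inE ?eqxx.
- by move=> A B; rewrite !inE => /orP [] /eqP -> /orP [] /eqP ->; rewrite /scmp ?subxx ?subsetT ?orbT.
Qed.

Lemma apex_preserves : preserves (fun _ => apex_flag).
Proof. by split=> // b _; case: apex_off. Qed.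

(* The faces off the horn are pushed onto [setT] and the faces in the horn onto [k]
   by [S <= k |: S >= k]. *)
Lemma off_contractible : pcontr (fam off_meets).
Proof.
have [a1 a2] := apex_off.
apply: (@contig_pcontr off_cpx off_meets (exist _ apex_flag a1)).
- by move=> S T h TS _ b /TS; apply: h.
- by move=> b ->.
have lc : lifts (fun _ => exist _ apex_flag a1) (fun _ => apex_flag) by [].
(* No face has [n.+2] elements, so this stage moves nothing. *)
have lid : lifts id (Kap n.+2).
  move=> v /=; rewrite /Kap -[LHS]imset_id; apply: eq_imset => S; rewrite /kap.
  have := max_card (mem S); rewrite card_ord; case: leqP => //; lia.
have [T lT] := lift_exists apexU_preserves.
have [K0 lK0] := lift_exists (Kap_preserves 0).
have [c1 c2] := layer_clos apex_preserves apexU_preserves (fun b _ => subsetUr _ _) lc lT.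
have [d1 d2] := layer_clos (Kap_preserves 0) apexU_preserves (fun b _ => subsetUl _ _) lK0 lT.
apply: clos_trans c1 _; apply: clos_trans d2 _.
have W j K : lifts K (Kap j) -> clos K0 K.
  elim: j K => [|j IH] K lK.
    by rewrite (lifts_unique lK lK0); exact: rt1n_refl.
  have [K' lK'] := lift_exists (Kap_preserves j).
  have pm : preserves (fun b => Kap j b :|: Kap j.+1 b) by apply: (@KapU_preserves j); lia.
  have [M lM] := lift_exists pm.
  have [e1 e2] := layer_clos (Kap_preserves j) pm (fun b _ => subsetUl _ _) lK' lM.
  have [f1 f2] := layer_clos (Kap_preserves j.+1) pm (fun b _ => subsetUr _ _) lK lM.
  by apply: clos_trans (IH K' lK') _; apply: clos_trans e1 f2.
exact: W lid.
Qed.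

End Flags.

Notation Fl n := {set {set 'I_n.+1}}.

Definition flag_simplex n (T : Fl n -> Prop) : Prop :=
  [/\ pnonempty T, forall b, T b -> is_flag b & forall b c, T b -> T c -> scmp b c].

Lemma flag_simplex_sub n (T T' : Fl n -> Prop) :
  flag_simplex T -> psub T' T -> pnonempty T' -> flag_simplex T'.
Proof. by case=> h1 h2 h3 s ne; split=> // [b /s|b c /s hb /s hc]; [apply: h2 | apply: h3]. Qed.

Lemma flag_simplex1 n (b : Fl n) : is_flag b -> flag_simplex (fun c => c = b).
Proof. by move=> h; split=> [|c ->//|c d -> ->]; [exists b | rewrite scmp_refl]. Qed.

Definition horn_part n (k : 'I_n.+1) (b : Fl n) : Fl n := [set S in b | k |: S != setT].

Lemma horn_part_flag n (k : 'I_n.+1) (b : Fl n) : is_flag b -> meets_horn k b ->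
  is_flag (horn_part k b) /\ in_horn k (horn_part k b).
Proof.
move=> /is_flagP [h1 h2 h3] /exists_inP [S hS e]; split.
  apply/is_flagP; split.
  - by apply/set0Pn; exists S; rewrite inE hS.
  - by rewrite inE (negbTE h2).
  - by move=> A B; rewrite !inE => /andP [hA _] /andP [hB _]; apply: h3.
by apply/forall_inP => A; rewrite inE => /andP [].
Qed.

(** The Dwyer property of the collar. A flag in the horn comparable with [b] is contained in [b],
    hence in its horn part; a comparable flag at least as large as [b] contains [b]. So the horn
    part of the smallest flag of a chain off the horn can be added to the chain. *)
Lemma horn_part_scmp n (k : 'I_n.+1) (b c : Fl n) : ~~ in_horn k b -> scmp b c ->
  in_horn k c || (#|b| <= #|c|) -> scmp (horn_part k b) c.
Proof.
move=> nb bc; case: (boolP (in_horn k c)) => hc /=.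
  move=> _; rewrite scmp_sym /scmp; suff -> : c \subset horn_part k b by [].
  have cb : c \subset b.
    case/orP: bc => // bc; case/negP: nb; apply/forall_inP => S /(subsetP bc) Sc.
    by move/forall_inP: hc; apply.
  by apply/subsetP => S Sc; rewrite inE (subsetP cb S Sc); move/forall_inP: hc; apply.
move=> le; rewrite /scmp; suff -> : horn_part k b \subset c by [].
have bc' : b \subset c.
  case/orP: bc => // cb; suff -> : b = c by [].
  by apply/eqP; rewrite eq_sym eqEcard cb le.
by apply: subset_trans bc'; apply/subsetP => S; rewrite inE => /andP [].
Qed.

(** * Attaching all lifting problems *)

Section CellComplex.
Variables (K L : Cpx) (phi : CMap K L).

(* Vertices of the complex obtained from [K] by freely attaching all lifting problems
   [Sd^2 Lambda -> Sd^2 Delta] over [L]; the well-founded tree below each vertex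
   replaces the transfinite construction. The values of [a] off the horn are junk. *)
Inductive cellv : Type :=
| cbase of vert K
| ccell n (k : 'I_n.+1) (a : Fl n -> cellv) (beta : Fl n -> vert L) (b : Fl n).

Definition cell_data := {n : nat & ('I_n.+1 * (Fl n -> cellv) * (Fl n -> vert L))%type}.

Definition cdim (j : cell_data) : nat := tag j.
Definition cvert (j : cell_data) : 'I_(cdim j).+1 := (tagged j).1.1.
Definition cattach (j : cell_data) : Fl (cdim j) -> cellv := (tagged j).1.2.
Definition cbeta (j : cell_data) : Fl (cdim j) -> vert L := (tagged j).2.

Definition mkcell (j : cell_data) (b : Fl (cdim j)) : cellv :=
  ccell (cvert j) (@cattach j) (@cbeta j) b.

Definition cell_info (v : cellv) : option {j : cell_data & Fl (cdim j)} :=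
  match v with
  | cbase _ => None
  | ccell n k a beta b => Some (existT (fun j : cell_data => Fl (cdim j))
        (existT (fun n => 'I_n.+1 * (Fl n -> cellv) * (Fl n -> vert L))%type n (k, a, beta)) b)
  end.

Lemma cell_info_mk j b : cell_info (@mkcell j b) = Some (existT (fun j => Fl (cdim j)) j b).
Proof. by case: j b => n [[k a] beta] b. Qed.

Lemma mkcell_data j j' b b' : @mkcell j b = @mkcell j' b' -> j = j'.
Proof. by move/(f_equal cell_info); rewrite !cell_info_mk => -[]. Qed.

Lemma mkcell_inj j b b' : @mkcell j b = @mkcell j b' -> b = b'.
Proof.
move/(f_equal cell_info); rewrite !cell_info_mk => -[E].
exact: inj_pair2 E.
Qed.

Lemma cellvP v : (exists x, v = cbase x) \/ exists j b, v = @mkcell j b.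
Proof.
case: v => [x|n k a beta b]; [by left; exists x | right].
by exists (existT (fun n => 'I_n.+1 * (Fl n -> cellv) * (Fl n -> vert L))%type n (k, a, beta)), b.
Qed.

(** Attaching maps have finite domain, so ranks are natural numbers and a filtration of length omega
    exhausts the complex. *)
Fixpoint crank (v : cellv) : nat :=
  match v with
  | cbase _ => 0
  | ccell n k a beta b => (\max_(c : Fl n) crank (a c)).+1
  end.

Definition jrank (j : cell_data) : nat := (\max_c crank (@cattach j c)).+1.

Lemma crank_mk j b : crank (@mkcell j b) = jrank j. Proof. by []. Qed.

Lemma crank_attach j b : crank (@cattach j b) < jrank j.
Proof. by rewrite ltnS; apply: (leq_bigmax b). Qed.

Definition cproj (v : cellv) : vert L :=
  match v with cbase x => phi x | ccell n k a beta b => beta b end.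

Definition glue (j : cell_data) (b : Fl (cdim j)) : cellv :=
  if in_horn (cvert j) b then cattach b else mkcell b.

(** Simplices and admissible cells are defined together, since a cell is attached along simplices of
    other cells. Passing to subsets of [pimage glue T] builds in closure under faces; the vertices
    are cut out afterwards, as those whose singleton is a simplex. *)
Inductive gsimp : (cellv -> Prop) -> Prop :=
| gsimp_base S0 S : simplex K S0 -> psub S (pimage cbase S0) -> pnonempty S -> gsimp S
| gsimp_cell (j : cell_data) T S : 0 < cdim j ->
    (forall T', flag_simplex T' -> (forall b, T' b -> in_horn (cvert j) b) ->
       gsimp (pimage (@cattach j) T')) ->
    (forall b, is_flag b -> in_horn (cvert j) b -> cproj (cattach b) = cbeta b) ->
    (forall T', flag_simplex T' -> simplex L (pimage (@cbeta j) T')) ->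
    flag_simplex T -> psub S (pimage (@glue j) T) -> pnonempty S -> gsimp S.

Record valid (j : cell_data) : Prop := Valid {
  valid_dim : 0 < cdim j;
  valid_attach : forall T', flag_simplex T' -> (forall b, T' b -> in_horn (cvert j) b) ->
       gsimp (pimage (@cattach j) T');
  valid_proj : forall b, is_flag b -> in_horn (cvert j) b -> cproj (cattach b) = cbeta b;
  valid_beta : forall T', flag_simplex T' -> simplex L (pimage (@cbeta j) T') }.

Lemma gsimp_valid j T S : valid j -> flag_simplex T -> psub S (pimage (@glue j) T) ->
  pnonempty S -> gsimp S.
Proof. by case=> h1 h2 h3 h4; exact: gsimp_cell. Qed.

Lemma gsimp_sub S S' : gsimp S -> psub S' S -> pnonempty S' -> gsimp S'.
Proof.
case=> [S0 S1 h1 h2 _|j T S1 h1 h2 h3 h4 h5 h6 _] h ne.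
  by apply: gsimp_base h1 _ ne => x /h /h2.
by apply: (gsimp_cell h1 h2 h3 h4 h5 _ ne) => x /h /h6.
Qed.

Lemma gsimp_nonempty S : gsimp S -> pnonempty S.
Proof. by case. Qed.

Lemma gsimp_finite S : gsimp S -> pfinite S.
Proof.
case=> [S0 S1 h1 h2 _|j T S1 _ _ _ _ _ h6 _].
  have [[n [g hg]] _] := simplex_fin h1.
  by exists n, (fun i => cbase (g i)) => x /h2 [y [/hg [i <-] <-]]; exists i.
exists #|{: Fl (cdim j)}|, (fun i => glue (enum_val i)) => x /h6 [b [_ <-]].
by exists (enum_rank b); rewrite enum_rankK.
Qed.

Lemma gsimp_proj S : gsimp S -> simplex L (pimage cproj S).
Proof.
case=> [S0 S1 h1 h2 ne|j T S1 h1 h2 h3 h4 h5 h6 ne].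
  apply: (simplex_sub (cfun_simplex phi h1)).
    by move=> y [x [/h2 [z [Sz <-]] <-]]; exists z.
  by case: ne => x Sx; exists (cproj x), x.
apply: (simplex_sub (h4 _ h5)); last by case: ne => x Sx; exists (cproj x), x.
move=> y [x [/h6 [b [Tb <-]] <-]]; exists b; split=> //.
case: h5 => _ hf _; rewrite /glue; case: ifP => // hb; by rewrite h3 //; apply: hf.
Qed.

(** The cell [j'] witnessing [S] may be a different one, attached along [mkcell j b]. Then its own
    vertices have rank above [jrank j], so [S] lies in the image of its horn and the induction
    hypothesis applies there. *)
Lemma gsimp_top S : gsimp S -> forall j b, S (@mkcell j b) ->
  (forall v, S v -> crank v <= jrank j) ->
  valid j /\ exists T, flag_simplex T /\ psub S (pimage (@glue j) T).
Proof.
elim=> {S} [S0 S h1 h2 ne|j' T S h1 h2 IH h3 h4 h5 h6 ne] j b Sb top.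
  by have [x [_]] := h2 _ Sb.
have [b' [Tb' e]] := h6 _ Sb.
case hb' : (in_horn (cvert j') b'); last first.
  move: e; rewrite /glue hb' => /mkcell_data e; subst j'.
  by split; [split | exists T].
have eb : cattach b' = mkcell b by rewrite -e /glue hb'.
pose T' c := [/\ T c, in_horn (cvert j') c & S (cattach c)].
have T's : flag_simplex T'.
  apply: (flag_simplex_sub h5); first by move=> c [].
  by exists b'; split=> //; rewrite eb.
have E : pimage (@cattach j') T' = S.
  apply: pred_ext => v; split; first by case=> c [[_ _ Sc] <-].
  move=> Sv; have [c [Tc ec]] := h6 _ Sv; exists c.
  case hc : (in_horn (cvert j') c); first by move: ec; rewrite /glue hc => ec; rewrite -ec in Sv *.
  have := top v Sv; rewrite -ec /glue hc crank_mk.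
  by have := crank_attach b'; rewrite eb crank_mk; lia.
by have := IH T' T's (fun c => @and3_ind _ _ _ _ (fun _ h _ => h)) j b; rewrite E; apply.
Qed.

Lemma gsimp_rank0 S : gsimp S -> (forall v, S v -> crank v = 0) ->
  exists2 S0, simplex K S0 & psub S (pimage cbase S0).
Proof.
elim=> {S} [S0 S h1 h2 ne|j' T S h1 h2 IH h3 h4 h5 h6 ne] top; first by exists S0.
pose T' c := [/\ T c, in_horn (cvert j') c & S (cattach c)].
have W v : S v -> exists c, T' c /\ cattach c = v.
  move=> Sv; have [c [Tc ec]] := h6 _ Sv; exists c.
  case hc : (in_horn (cvert j') c); first by move: ec; rewrite /glue hc => ec; rewrite -ec in Sv *.
  by have := top v Sv; rewrite -ec /glue hc crank_mk.
have T's : flag_simplex T'.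
  apply: (flag_simplex_sub h5); first by move=> c [].
  by case: ne => v /W [c [hc _]]; exists c.
have [|S0 k1 k2] := IH T' T's (fun c => @and3_ind _ _ _ _ (fun _ h _ => h)).
  by move=> v [c [[_ _ Sc] <-]]; apply: top.
by exists S0 => // v /W h; apply: k2.
Qed.

Lemma gsimp_mkcell j b : gsimp (fun v => v = @mkcell j b) ->
  [/\ valid j, is_flag b & ~~ in_horn (cvert j) b].
Proof.
move=> h; have [|v [T [[_ hT _] hs]]] := gsimp_top h (erefl : mkcell b = mkcell b).
  by move=> v ->; rewrite crank_mk.
have [c [Tc]] := hs _ (erefl : mkcell b = mkcell b).
rewrite /glue; case: ifP => hc e.
  by have := crank_attach c; rewrite e crank_mk; lia.
by rewrite -(mkcell_inj e) hc; split=> //; apply: hT.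
Qed.

Definition cellV := {v : cellv | gsimp (fun x => x = v)}.

Definition vimg (S : cellV -> Prop) : cellv -> Prop := pimage (@proj1_sig _ _) S.

Definition cell_cpx : Cpx.
Proof.
refine {| vert := cellV; simplex := fun S => gsimp (vimg S) |}.
- move=> S hS; have [y [x [Sx _]]] := gsimp_nonempty hS.
  split; last by exists x.
  have [n [g hg]] := gsimp_finite hS.
  exists n, (fun i => match excluded_middle_informative (gsimp (fun y => y = g i)) with
                      | left h => exist _ (g i) h | right _ => x end).
  move=> z Sz; have [|i hi] := hg (proj1_sig z); first by exists z.
  exists i; case: excluded_middle_informative => [h|[]]; first exact: sig_eq.
  by rewrite hi; exact: (proj2_sig z).
- move=> v; apply: gsimp_sub (proj2_sig v) _ _.
    by move=> x [y [-> <-]].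
  by exists (proj1_sig v), v.
- move=> S T hS TS [x Tx]; apply: gsimp_sub hS _ _; last by exists (proj1_sig x), x.
  by move=> y [z [/TS Sz <-]]; exists z.
Defined.

Lemma gsimp_cbase x : gsimp (fun v => v = cbase x).
Proof.
by apply: (gsimp_base (simplex_single x)) => [v ->|]; [exists x | exists (cbase x)].
Qed.

Definition cell_incl : CMap K cell_cpx.
Proof.
refine (@Build_CMap K cell_cpx (fun x => exist _ (cbase x) (gsimp_cbase x)) _).
move=> S hS; apply: (gsimp_base hS); first by move=> v [y [[x [Sx <-]] <-]]; exists x.
have [_ [x Sx]] := simplex_fin hS.
by exists (cbase x), (exist _ (cbase x) (gsimp_cbase x)); split=> //; exists x.
Defined.

Definition cell_proj : CMap cell_cpx L.
Proof.
refine (@Build_CMap cell_cpx L (fun v => cproj (proj1_sig v)) _) => S hS.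
apply: (simplex_sub (gsimp_proj hS)).
  by move=> y [x [Sx <-]]; exists (proj1_sig x); split=> //; exists x.
by have [y [x [Sx _]]] := gsimp_nonempty hS; exists (cproj (proj1_sig x)), x.
Defined.

(* [US] stands for the simplices of [cell_cpx] or of its clique complex. *)
Section Filtration.
Variable US : (cellV -> Prop) -> Prop.
Hypothesis US_fin : forall S, US S -> pfinite S /\ pnonempty S.
Hypothesis US_single : forall v, US (fun x => x = v).
Hypothesis US_sub : forall S T, US S -> psub T S -> pnonempty T -> US T.
Hypothesis US_edge : forall S x y, US S -> S x -> S y -> gsimp (vimg (ppair x y)).
Hypothesis US_gsimp : forall S, gsimp (vimg S) -> US S.
(** The cone point of a collar link: the horn part of the smallest flag of the cell that occurs in
    [S]. *)
Hypothesis US_cone : forall S j (b : Fl (cdim j)) (v c : cellV), US S -> S v ->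
  proj1_sig v = mkcell b -> meets_horn (cvert j) b ->
  (forall x, S x -> crank (proj1_sig x) <= jrank j) ->
  (forall x (b' : Fl (cdim j)), S x -> proj1_sig x = mkcell b' -> #|b| <= #|b'|) ->
  proj1_sig c = cattach (horn_part (cvert j) b) ->
  US (punion (fun x => x = c) S).

Definition UC : Cpx := Build_Cpx US_fin US_single US_sub.

Definition rank_le i : vfam UC := fun S => US S /\ forall v, S v -> crank (proj1_sig v) <= i.

Definition cmeets (v : cellv) : Prop := exists j b, v = @mkcell j b /\ meets_horn (cvert j) b.

(** Stage [i] together with the collars of the cells of rank [i.+1]. *)
Definition rank_mid i : vfam UC := fun S => US S /\
  forall v, S v -> crank (proj1_sig v) <= i \/ crank (proj1_sig v) = i.+1 /\ cmeets (proj1_sig v).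

Lemma rank_le_closed i : fclosed (rank_le i).
Proof. by move=> S T [h1 h2] TS ne; split=> [|v /TS]; [exact: US_sub h1 TS ne | exact: h2]. Qed.

Lemma rank_mid_closed i : fclosed (rank_mid i).
Proof. by move=> S T [h1 h2] TS ne; split=> [|v /TS]; [exact: US_sub h1 TS ne | exact: h2]. Qed.

Lemma rank_le_mid i : acyclic (fam (rank_le i)) (fam (rank_mid i)).
Proof.
pose D (v : vert UC) := i < crank (proj1_sig v).
have -> : rank_le i = (fun S => rank_mid i S /\ forall x, S x -> ~ D x).
  apply: pred_ext => S; split.
    move=> [h1 h2]; split; first by split=> // v /h2; left.
    by move=> x /h2; rewrite /D; lia.
  move=> [[h1 h2] h3]; split=> // v Sv; have := h3 v Sv; rewrite /D; lia.
apply: acyclic_link; first exact: rank_mid_closed.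
  by move=> S [].
move=> sigma [Us ms] sD.
have sr v : sigma v -> crank (proj1_sig v) = i.+1 /\ cmeets (proj1_sig v).
  by move=> sv; case: (ms v sv) => //; have := sD v sv; rewrite /D; lia.
have [_ [v1 sv1]] := US_fin Us.
have [_ [j [b1 [e1 _]]]] := sr v1 sv1.
(* The apex comes from a vertex of [sigma] in cell [j] whose flag is smallest. Any further vertex of
   that cell in [S] has rank above [i], hence lies in [sigma] and obeys the same bound. *)
pose Q m := exists v b, [/\ sigma v, proj1_sig v = @mkcell j b & #|b| = m].
have [m [[v0 [b0 [sv0 e0 c0]]] min]] : exists m, Q m /\ forall m', Q m' -> m <= m'.
  have : Q #|b1| by exists v1, b1.
  elim: (#|b1|) {-2}(#|b1|) (leqnn #|b1|) => [|N IH] m hm Qm.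
    by exists m; split=> // m' _; lia.
  case: (classic (exists2 m', Q m' & m' < m)) => [[m' Qm' lt]|h].
    by apply: (IH m') => //; lia.
  exists m; split=> // m' Qm'; case: leqP => // lt; case: h; by exists m'.
have [r0 [j' [b' [e' hm]]]] := sr v0 sv0.
have jj : j' = j by rewrite e0 in e'; have := mkcell_data e' => ->.
subst j'; have bb : b' = b0 by apply: (@mkcell_inj j); rewrite -e' -e0.
subst b'; have gs0 := proj2_sig v0; rewrite /= e0 in gs0.
have [vj fb0 nb0] := gsimp_mkcell gs0.
have [hf hi] := horn_part_flag fb0 hm.
have gc : gsimp (fun x => x = cattach (horn_part (cvert j) b0)).
  apply: gsimp_sub (valid_attach vj (flag_simplex1 hf) _) _ _.
  - by move=> b ->.
  - by move=> x ->; exists (horn_part (cvert j) b0).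
  - by exists (cattach (horn_part (cvert j) b0)).
have rj : jrank j = i.+1 by rewrite -r0 e0 crank_mk.
have rc : crank (cattach (horn_part (cvert j) b0)) <= i.
  by have := crank_attach (horn_part (cvert j) b0); rewrite rj.
exists (exist (fun y => gsimp (fun x => x = y)) _ gc); split; first by rewrite /D /=; lia.
move=> S SD [h1 h2]; split; last first.
  by move=> v [->|]; [left | apply: h2].
apply: (@US_cone _ j b0 v0) => //.
- by right.
- by move=> x /h2; rewrite rj; case; lia.
- move=> x b [Sx|sx] e; rewrite c0; apply: min.
    by exists x, b; split=> //; apply: SD => //; rewrite /D e crank_mk rj.
  by exists x, b.
Qed.

Lemma valid_vertex j (b : Fl (cdim j)) : valid j -> off_horn (cvert j) b ->
  gsimp (fun v => v = mkcell b).
Proof.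
move=> vj /andP [fb nb]; apply: (gsimp_valid vj (flag_simplex1 fb)); last by exists (mkcell b).
by move=> v ->; exists b; rewrite /glue (negbTE nb).
Qed.

Definition cell_vertex j (vj : valid j) (b : vert (off_cpx (cvert j))) : cellV :=
  exist _ (mkcell (proj1_sig b)) (valid_vertex vj (proj2_sig b)).

Lemma cell_vertex_simplex j (vj : valid j) T : simplex (off_cpx (cvert j)) T ->
  US (pimage (cell_vertex vj) T).
Proof.
move=> [[b Tb] hT]; apply: US_gsimp.
apply: (@gsimp_valid j (fun b => exists2 t, T t & proj1_sig t = b)) => //.
- split.
  + by exists (proj1_sig b), b.
  + by move=> c [t _ <-]; case: t => t ht /=; by case/andP: ht.
  + by move=> c d [t ht <-] [u hu <-]; apply: hT.
- move=> v [y [[t [Tt <-]] <-]]; exists (proj1_sig t); split; first by exists t.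
  by case: t {Tt} => t ht /=; rewrite /glue; case/andP: (ht) => _ /negbTE ->.
- by exists (mkcell (proj1_sig b)), (cell_vertex vj b); split=> //; exists b.
Qed.

Definition cell_char j (vj : valid j) : CMap (off_cpx (cvert j)) UC :=
  @Build_CMap (off_cpx (cvert j)) UC (cell_vertex vj) (@cell_vertex_simplex j vj).

(** Only the edge between [x] and [y] is inspected, which is why this holds for cliques as well. *)
Lemma edge_top S x y j (b : Fl (cdim j)) : US S -> S x -> S y -> proj1_sig x = mkcell b ->
  crank (proj1_sig y) <= jrank j ->
  [/\ valid j, off_horn (cvert j) b &
      exists b', [/\ is_flag b', scmp b b' & glue b' = proj1_sig y]].
Proof.
move=> US' Sx Sy ex ry.
have gx := proj2_sig x; rewrite /= ex in gx; have [vj fb nb] := gsimp_mkcell gx.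
split=> //; first by apply/andP.
have E := US_edge US' Sx Sy.
have [||_ [T [[_ h2 h3] h]]] := @gsimp_top _ E j b.
- by exists x; split=> //; left.
- by move=> v [w [[->|->] <-]] //; rewrite ex crank_mk.
have [|b1 [Tb1]] := h (proj1_sig x); first by exists x; split=> //; left.
rewrite /glue ex; case: ifP => hb1 e1.
  by have := crank_attach b1; rewrite e1 crank_mk; lia.
have {}e1 := mkcell_inj e1; subst b1.
have [|b2 [Tb2 e2]] := h (proj1_sig y); first by exists y; split=> //; right.
by exists b2; split; [apply: h2 | apply: h3 |].
Qed.

Lemma rank_mid_le i : acyclic (fam (rank_mid i)) (fam (rank_le i.+1)).
Proof.
pose J := {j : cell_data | valid j /\ jrank j = i.+1}.
apply: (@acyclic_complex_cells UC _ _ J (fun j => off_cpx (cvert (proj1_sig j)))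
  (fun j => cell_char (proj1 (proj2_sig j)))).
- exact: rank_mid_closed.
- by move=> S _ [h1 h2]; split=> // v /h2 [|[]]; lia.
- move=> S _ [US' hS].
  case: (classic (forall v, S v -> crank (proj1_sig v) <= i \/
      crank (proj1_sig v) = i.+1 /\ cmeets (proj1_sig v))) => h; first by left.
  right.
  have [v [Sv rv nm]] : exists v, [/\ S v, crank (proj1_sig v) = i.+1 & ~ cmeets (proj1_sig v)].
    apply: NNPP => ne; apply: h => v Sv; have := hS v Sv; rewrite leq_eqVlt => /orP [/eqP e|]; last by left.
    by right; split=> //; apply: NNPP => nm; apply: ne; exists v.
  have [[x ex]|[j [b ej]]] := cellvP (proj1_sig v); first by move: rv; rewrite ex.
  have rj : jrank j = i.+1 by rewrite -rv ej crank_mk.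
  have nmb : ~~ meets_horn (cvert j) b.
    by apply/negP => hm; apply: nm; exists j, b.
  have [|vj ob _] := edge_top US' Sv Sv ej; first by rewrite rv rj.
  have W x : S x -> exists b', off_horn (cvert j) b' /\ proj1_sig x = mkcell b'.
    move=> Sx; have [|_ _ [b' [fb' bb' e]]] := edge_top US' Sv Sx ej; first by rewrite rj; apply: hS.
    exists b'; move: e; rewrite /glue; case: ifP => hb'; last by move=> <-; rewrite /off_horn fb' hb'.
    (* A comparable [b'] in the horn would share a face with [b], but no face of [b] lies in the
       horn. So a simplex with a vertex off the collar stays in the part of its cell off the
       horn. *)
    case/andP: ob => /is_flagP [/set0Pn [B hB] _ _] _.
    case/is_flagP: fb' => /set0Pn [B' hB'] _ _.
    have nB A : A \in b -> ~~ (A \in b').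
      move=> Ab; apply/negP => Ab'; case/negP: nmb; apply/exists_inP; exists A => //.
      by move/forall_inP: hb'; apply.
    case/orP: bb' => /subsetP s; first by have := nB B hB; rewrite s.
    by have := nB B' (s _ hB'); rewrite hB'.
  exists (exist _ j (conj vj rj)), (fun t => S (cell_vertex vj t)).
  have E (pj : valid j) : cell_vertex pj = cell_vertex vj by congr cell_vertex; exact: proof_irrelevance.
  split; last first.
    rewrite /= E; apply: pred_ext => x; split; first by case=> t [St <-].
    move=> Sx; have [b' [ob' e]] := W x Sx.
    have ex : cell_vertex vj (exist _ b' ob') = x by apply: sig_eq.
    by exists (exist _ b' ob'); rewrite ex.
  split.
    have [b' [ob' e]] := W v Sv; exists (exist _ b' ob').
    by have -> : cell_vertex vj (exist _ b' ob') = v by apply: sig_eq.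
  move=> t u St Su.
  have [|_ _ [b' [fb' bb' e]]] := edge_top (x := cell_vertex vj t) US' St Su erefl.
    exact: leqnn.
  move: e; rewrite /glue /=; case: ifP => hb' e.
    by have := crank_attach b'; rewrite e crank_mk; lia.
  by rewrite -(mkcell_inj e).
- by move=> [j [vj rj]] v w /= /(f_equal (@proj1_sig _ _)) /= /mkcell_inj; apply: sig_eq.
- move=> [j [vj rj]] [j' [vj' rj']] T T' [[b Tb] _] _ /=.
  move: (proj1 _) (proj1 _) => p' p E _.
  have : pimage (cell_vertex p) T (cell_vertex p b) by exists b.
  rewrite E => -[b' [_ /(f_equal (@proj1_sig _ _)) /= e]].
  by apply: sig_eq => /=; rewrite (mkcell_data e).
- move=> [j [vj rj]] /=; move: (proj1 _) => {}vj.
  have -> : fam (fun S => rank_mid i (pimage (cell_vertex vj) S)) = fam (@off_meets _ (cvert j)).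
    apply: functional_extensionality_dep => n; apply: pred_ext => s; split.
      move=> [_ h] b hb; have [|le|[_ [j' [b' [/= e hm]]]]] := h (cell_vertex vj b).
      - by exists b.
      - have : jrank j <= i by exact: le.
        by rewrite rj ltnn.
      - have jj := mkcell_data e; subst j'.
        by rewrite (mkcell_inj e).
    move=> h; split; first exact: cell_vertex_simplex (rng_simplex s).
    move=> v [b [hb <-]]; right; split; first exact: rj.
    by exists j, (proj1_sig b); split=> //; apply: h.
  exact: off_contractible (valid_dim vj).
Qed.

Lemma rank_acyclic : acyclic (fam (rank_le 0)) (@sfull (Sing UC)).
Proof.
apply: (acyclic_seq (P := fun i => fam (rank_le i))).
- by move=> i n s [h1 h2]; split=> // v /h2; lia.
- move=> n s _; exists (\max_(i < n.+1) crank (proj1_sig (s i))); split.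
    exact: (@rng_simplex UC n s).
  by move=> v [i <-]; apply: (leq_bigmax i).
- by move=> i; apply: fam_closed; exact: rank_le_closed.
- move=> i; apply: acyclic_trans (rank_le_mid i) (rank_mid_le i).
  by move=> n s [h1 h2]; split=> // v /h2; left.
Qed.

End Filtration.
End CellComplex.

(** * The base inclusion into the cell complex, and its clique version *)

Section CellWeq.
Variables (K L : Cpx) (phi : CMap K L).
Local Notation P := (cell_cpx phi).

Lemma glue_horn (j : cell_data K L) b : in_horn (cvert j) b -> glue b = cattach b.
Proof. by rewrite /glue => ->. Qed.

Lemma gsimp_cone (S : cellV phi -> Prop) (j : cell_data K L) (b : Fl (cdim j)) (v c : cellV phi) :
  gsimp phi (vimg S) -> S v -> proj1_sig v = mkcell b -> meets_horn (cvert j) b ->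
  (forall x, S x -> crank (proj1_sig x) <= jrank j) ->
  (forall x (b' : Fl (cdim j)), S x -> proj1_sig x = mkcell b' -> #|b| <= #|b'|) ->
  proj1_sig c = cattach (horn_part (cvert j) b) ->
  gsimp phi (vimg (punion (fun x => x = c) S)).
Proof.
move=> gS Sv ev mb rS minb ec.
have gv := proj2_sig v; rewrite /= ev in gv; have [vj fb nb] := gsimp_mkcell gv.
have [||_ [T [[h1 h2 h3] h]]] := gsimp_top gS (j := j) (b := b).
- by exists v.
- by move=> x [y [Sy <-]]; apply: rS.
have [hf hi] := horn_part_flag fb mb.
have Tb : T b.
  have [|b' [Tb' e]] := h (mkcell b); first by exists v.
  move: e; rewrite /glue; case: ifP => hb' e.
    by have := crank_attach b'; rewrite e crank_mk; lia.
  by rewrite -(mkcell_inj e).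
(* [T] may contain flags that do not come from [S]; the minimality of [b] is known only for those
   that do. *)
pose T' x := T x /\ vimg S (glue x).
have cmpT x : T' x -> scmp (horn_part (cvert j) b) x.
  move=> [Tx [y [Sy ey]]]; apply: horn_part_scmp => //; first exact: h3.
  case hx : (in_horn (cvert j) x) => //=; apply: minb Sy _.
  by rewrite ey /glue hx.
apply: (@gsimp_valid _ _ _ j (punion (fun x => x = horn_part (cvert j) b) T')) => //.
- split; first by exists (horn_part (cvert j) b); left.
    by move=> x [->//|[Tx _]]; apply: h2.
  move=> x y [->|hx] [->|hy]; rewrite ?scmp_refl //; first exact: cmpT.
    by rewrite scmp_sym; apply: cmpT.
  by apply: h3; [case: hx | case: hy].
- move=> x [y [[->|Sy] <-]].
    by exists (horn_part (cvert j) b); split; [left | rewrite glue_horn].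
  have [|b' [Tb' e]] := h (proj1_sig y); first by exists y.
  by exists b'; split=> //; right; split=> //; exists y.
- by exists (proj1_sig c), c; split=> //; left.
Qed.

Lemma gsimp_edge (S : cellV phi -> Prop) x y :
  gsimp phi (vimg S) -> S x -> S y -> gsimp phi (vimg (ppair x y)).
Proof.
move=> h Sx Sy; apply: gsimp_sub h _ _.
  by move=> z [w [[->|->] <-]]; [exists x | exists y].
by exists (proj1_sig x), x; split=> //; left.
Qed.

Lemma cell_incl_weq : T_weq (cell_incl phi).
Proof.
have A : acyclic (fam (U := P) (fun S => gsimp phi (vimg S) /\ forall v : cellV phi, S v -> crank (proj1_sig v) <= 0)) (@sfull (Sing P)).
  exact: (@rank_acyclic K L phi _ (@simplex_fin P) (@simplex_single P) (@simplex_sub P)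
    gsimp_edge (fun S h => h) gsimp_cone).
apply: (acyclic_sweq _ _ A).
- move=> n s t e; apply: cmap_eq => i.
  have := f_equal (fun u : CMap (Delta n) P => proj1_sig (u i)) e.
  by move=> /= [].
- move=> n s; split=> [[h1 h2]|[t <-]]; last first.
    by split; [exact: (@rng_simplex P) | move=> v [i <-]].
  have [|S0 hS0 sub] := gsimp_rank0 h1.
    by move=> v [w [hw <-]]; apply/eqP; rewrite -leqn0; apply: h2.
  have [t ht] : exists t : 'I_n.+1 -> vert K, forall i, S0 (t i) /\ cbase _ (t i) = proj1_sig (s i).
    suff H i : exists x, S0 x /\ cbase _ x = proj1_sig (s i) by exact: choice_fun H.
    by apply: sub; exists (s i); split=> //; exists i.
  have tS : simplex K (fun x => exists i, t i = x).
    apply: (simplex_sub hS0); first by move=> x [i <-]; case: (ht i).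
    by exists (t ord0), ord0.
  exists (mk_sing tS); apply: cmap_eq => i; apply: sig_eq => /=; by case: (ht i).
Qed.

Local Notation CP := (Cl (skel P)).

Lemma clique_edge (S : cellV phi -> Prop) x y :
  simplex CP S -> S x -> S y -> gsimp phi (vimg (ppair x y)).
Proof. by move=> [_ [_ h]] Sx Sy; case: (h x y Sx Sy). Qed.

Lemma clique_gsimp (S : cellV phi -> Prop) : gsimp phi (vimg S) -> simplex CP S.
Proof.
move=> h; have [f ne] := @simplex_fin P S h; split=> //; split=> // a b Sa Sb.
by split; [exact: (gsimp_edge h) | exists a, b].
Qed.

(** In a clique it suffices to join [c] to each vertex [x] of [S]. The simplex cone lemma applied to
    the edge [{v, x}] does this, as [b] remains smallest there. *)
Lemma clique_cone (S : cellV phi -> Prop) (j : cell_data K L) (b : Fl (cdim j)) (v c : cellV phi) :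
  simplex CP S -> S v -> proj1_sig v = mkcell b -> meets_horn (cvert j) b ->
  (forall x, S x -> crank (proj1_sig x) <= jrank j) ->
  (forall x (b' : Fl (cdim j)), S x -> proj1_sig x = mkcell b' -> #|b| <= #|b'|) ->
  proj1_sig c = cattach (horn_part (cvert j) b) ->
  simplex CP (punion (fun x => x = c) S).
Proof.
move=> cS Sv ev mb rS minb ec.
have single (x : cellV phi) : gsimp phi (vimg (ppair x x)).
  have gx : gsimp phi (fun y => y = proj1_sig x) := proj2_sig x.
  by apply: gsimp_sub gx _ _; [move=> z [w [[->|->] <-]] | exists (proj1_sig x), x; split=> //; left].
have edge x : S x -> gsimp phi (vimg (punion (fun y => y = c) (ppair v x))).
  move=> Sx; apply: (@gsimp_cone _ j b v c) => //.
  - exact: clique_edge cS Sv Sx.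
  - by left.
  - by move=> y [->|->]; apply: rS.
  - by move=> y b' [->|->]; apply: minb.
have edge1 x : S x -> gsimp phi (vimg (ppair c x)).
  move=> Sx; apply: gsimp_edge (edge x Sx) _ _; first by left.
  by right; right.
have [[n [g hg]] _] := cS.
split.
  exists n.+1, (fun i => if unlift ord0 i is Some k then g k else c) => x [->|/hg [i <-]].
    by exists ord0; rewrite unlift_none.
  by exists (lift ord0 i); rewrite liftK.
split; first by exists c; left.
move=> x y hx hy; split; last by exists x, y.
change (gsimp phi (vimg (ppair x y))).
have sym u w : gsimp phi (vimg (ppair u w)) -> gsimp phi (vimg (ppair w u)).
  by have -> // : ppair u w = ppair w u; apply: pred_ext => z; rewrite /ppair; tauto.
case: hx hy => [->|Sx] [->|Sy]; first exact: single.
- exact: edge1.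
- by apply: sym; apply: edge1.
- exact: clique_edge cS Sx Sy.
Qed.

Lemma cell_incl_clique_weq : M_weq (skelMap (cell_incl phi)).
Proof.
have A : acyclic (fam (U := CP) (fun S => simplex CP S /\ forall v : cellV phi, S v -> crank (proj1_sig v) <= 0)) (@sfull (Sing CP)).
  exact: (@rank_acyclic K L phi _ (@simplex_fin CP) (@simplex_single CP) (@simplex_sub CP)
    clique_edge clique_gsimp clique_cone).
apply: (acyclic_sweq _ _ A).
- move=> n s t e; apply: cmap_eq => i.
  have := f_equal (fun u : CMap (Delta n) CP => proj1_sig (u i)) e.
  by move=> /= [].
- move=> n s; split=> [[h1 h2]|[t <-]]; last first.
    by split; [exact: (@rng_simplex CP) | move=> v [i <-]].
  (* Edges between vertices of rank 0 come from edges of [K], so the rank 0 cliques are those of the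
     1-skeleton of [K]. *)
  have edge i i' : exists x y, [/\ cbase _ x = proj1_sig (s i), cbase _ y = proj1_sig (s i') & simplex K (ppair x y)].
    have E : gsimp phi (vimg (ppair (s i) (s i'))).
      by apply: (clique_edge h1); [exists i | exists i'].
    have [|S0 hS0 sub] := gsimp_rank0 E.
      by move=> v [w [[->|->] <-]]; apply/eqP; rewrite -leqn0; apply: h2; [exists i | exists i'].
    have [|x [S0x ex]] := sub (proj1_sig (s i)); first by exists (s i); split=> //; left.
    have [|y [S0y ey]] := sub (proj1_sig (s i')); first by exists (s i'); split=> //; right.
    exists x, y; split=> //; apply: (simplex_sub hS0); first by move=> z [] ->.
    by exists x; left.
  have [t ht] : exists t : 'I_n.+1 -> vert K, forall i, cbase _ (t i) = proj1_sig (s i).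
    suff H i : exists x, cbase _ x = proj1_sig (s i) by exact: choice_fun H.
    by have [x [_ [e _ _]]] := edge i i; exists x.
  have tS : simplex (Cl (skel K)) (fun x => exists i, t i = x).
    split; first by exists n.+1, t.
    split; first by exists (t ord0), ord0.
    move=> a b [i <-] [i' <-]; split; last by exists (t i), (t i').
    have [x [y [ex ey hxy]]] := edge i i'.
    by move: ex ey hxy; rewrite -!ht => -[->] [->].
  exists (mk_sing (U := Cl (skel K)) tS); apply: cmap_eq => i; apply: sig_eq; exact: ht.
Qed.

End CellWeq.

(** * Lifting against horns in [Ex^2 Sing] *)

Lemma enum_by_key (T : finType) (key : T -> nat) (A : {set T}) : A != set0 ->
  exists l (c : 'I_l.+1 -> T), [/\ forall i, c i \in A, forall x, x \in A -> exists i, c i = x,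
    injective c & forall i j : 'I_l.+1, i <= j -> key (c i) <= key (c j)].
Proof.
case/set0Pn => x0 Ax0; pose r x y := key x <= key y.
pose s := sort r (enum A).
have rt : ssrbool.transitive r by move=> y x z; exact: leq_trans.
have rr : ssrbool.reflexive r by move=> x; exact: leqnn.
have so : sorted r s by apply: sort_sorted => x y; exact: leq_total.
have us : uniq s by rewrite sort_uniq enum_uniq.
have ms x : (x \in s) = (x \in A) by rewrite mem_sort mem_enum.
have s0 : 0 < size s by rewrite -has_predT; apply/hasP; exists x0; rewrite // ms.
have es : (size s).-1.+1 = size s by rewrite prednK.
exists (size s).-1, (fun i => nth x0 s i).
have lt (i : 'I_(size s).-1.+1) : i < size s by apply: leq_trans (ltn_ord i) _; rewrite es.
split.
- by move=> i; rewrite -ms mem_nth.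
- move=> x; rewrite -ms => hx.
  have h : index x s < (size s).-1.+1 by rewrite es index_mem.
  by exists (Ordinal h); rewrite /= nth_index.
- by move=> i j /eqP; rewrite nth_uniq // => /eqP /val_inj.
- by move=> i j ij; apply: (sorted_leq_nth rt rr x0 so) ij; rewrite inE lt.
Qed.

Lemma scmp_card (T : finType) (A B : {set T}) : scmp A B -> #|A| <= #|B| -> A \subset B.
Proof.
case/orP => // BA le; suff -> : B = A by [].
by apply/eqP; rewrite eqEcard BA le.
Qed.

Definition cpart m l (c : Sd m l) (A : {set 'I_l.+1}) : Fl m := [set proj1_sig c x | x in A].

Definition cimg m l (c : Sd m l) : Fl m := cpart c setT.

Lemma sd_full_subproof l : sdP (n := l) (fun _ : 'I_1 => setT).
Proof. by split=> // _; apply/set0Pn; exists ord0; rewrite inE. Qed.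

Definition sd_full l : Sd l 0 := exist _ _ (sd_full_subproof l).

Lemma cpart_flag m l (c : Sd m l) (A : {set 'I_l.+1}) : A != set0 -> is_flag (cpart c A).
Proof.
case/set0Pn => x Ax; have [c1 c2] := proj2_sig c; apply/is_flagP; split.
- by apply/set0Pn; exists (proj1_sig c x); rewrite imset_f.
- by apply/negP => /imsetP [y _ e]; have := c1 y; rewrite -e eqxx.
- move=> S T /imsetP [y _ ->] /imsetP [z _ ->]; rewrite /scmp.
  by case: (leqP y z) => h; rewrite ?(c2 _ _ h) ?(c2 _ _ (ltnW h)) ?orbT.
Qed.

Lemma setT_neq0 l : [set: 'I_l.+1] != set0.
Proof. by apply/set0Pn; exists ord0; rewrite inE. Qed.

Lemma flag_chain m (b : Fl m) : is_flag b ->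
  exists l (c : Sd m l), cimg c = b /\ injective (proj1_sig c).
Proof.
move=> /is_flagP [h1 h2 h3].
have [l [c [c1 c2 c3 c4]]] := enum_by_key (fun S : {set 'I_m.+1} => #|S|) h1.
have hc : sdP c.
  split=> [i|i j ij]; first by apply/negP => /eqP e; have := c1 i; rewrite e (negbTE h2).
  by apply: scmp_card; [apply: h3 | apply: c4].
exists l, (exist _ c hc); split=> //; apply/setP => S; apply/imsetP/idP.
  by case=> i _ ->; apply: c1.
by move=> /c2 [i <-]; exists i.
Qed.

Lemma subset_dmap l (A : {set 'I_l.+1}) : A != set0 ->
  exists l' (t : Dmap l' l), [set t y | y in setT] = A /\ injective t.
Proof.
move=> A0; have [l' [c [c1 c2 c3 c4]]] := enum_by_key (@nat_of_ord _) A0.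
exists l', {| dfun := c; dmono := c4 |}; split=> //.
apply/setP => S; apply/imsetP/idP; first by case=> i _ ->; apply: c1.
by move=> /c2 [i <-]; exists i.
Qed.

Lemma dmap_factor q p n (f : Dmap q n) (r : Dmap p n) : injective r ->
  (forall x, exists y, f x = r y) -> exists s : Dmap q p, f = dcomp r s.
Proof.
move=> ri /choice_fun [s hs].
have sm (i j : 'I_q.+1) : i <= j -> s i <= s j.
  move=> ij; case: leqP => // lt.
  have h1 := dmono f ij; rewrite !hs in h1; have h2 := dmono r (ltnW lt).
  have e : r (s i) = r (s j) by apply: val_inj => /=; lia.
  by have := ri _ _ e => e'; move: lt; rewrite e' ltnn.
by exists {| dfun := s; dmono := sm |}; apply: dmap_eq.
Qed.

Definition tset m n (t : 'I_m.+1 -> 'I_n.+1) (b : Fl m) : Fl n :=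
  (fun S : {set 'I_m.+1} => [set t y | y in S]) @: b.

Lemma tset_flag m n (t : 'I_m.+1 -> 'I_n.+1) b : is_flag b -> is_flag (tset t b).
Proof.
move=> /is_flagP [h1 h2 h3]; apply/is_flagP; split.
- by rewrite imset_eq0.
- apply/negP => /imsetP [S hS /esym /eqP]; rewrite imset_eq0 => /eqP e.
  by rewrite e in hS; rewrite hS in h2.
- move=> S T /imsetP [S' hS' ->] /imsetP [T' hT' ->].
  by rewrite /scmp; case/orP: (h3 _ _ hS' hT') => h; rewrite (imsetS _ h) ?orbT.
Qed.

Lemma tset_comp l m n (t : 'I_m.+1 -> 'I_n.+1) (u : 'I_l.+1 -> 'I_m.+1) b :
  tset (fun y => t (u y)) b = tset t (tset u b).
Proof. by rewrite /tset -imset_comp; apply: eq_imset => S /=; rewrite -imset_comp. Qed.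

Lemma sub_imset_inj (aT rT : finType) (f : aT -> rT) (A B : {set aT}) : injective f ->
  f @: A \subset f @: B -> A \subset B.
Proof.
move=> fi /subsetP h; apply/subsetP => x Ax.
by have /imsetP [y By /fi ->] := h (f x) (imset_f f Ax).
Qed.

Lemma tset_sub m n (t : 'I_m.+1 -> 'I_n.+1) b c : injective t ->
  tset t b \subset tset t c -> b \subset c.
Proof. by move=> ti; apply: sub_imset_inj; apply: imset_inj. Qed.

Lemma tset_inj m n (t : 'I_m.+1 -> 'I_n.+1) : injective t -> injective (tset t).
Proof. by move=> ti; apply: imset_inj; apply: imset_inj. Qed.

Lemma flag_max m (b : Fl m) : is_flag b ->
  exists2 S, S \in b & forall T, T \in b -> T \subset S.
Proof.
move=> /is_flagP [/set0Pn [S0 hS0] _ h3].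
have [S hS max] := @arg_maxnP _ S0 (fun S => S \in b) (fun S : {set 'I_m.+1} => #|S|) hS0.
by exists S => // T hT; apply: scmp_card; [apply: h3 | apply: max].
Qed.

Lemma flag_lift p n (r : Dmap p n) (b : Fl n) : is_flag b ->
  (forall S, S \in b -> S \subset [set r y | y in setT]) ->
  exists c, is_flag c /\ tset r c = b.
Proof.
move=> /is_flagP [h1 h2 h3] sub.
have im S : S \in b -> [set r y | y in r @^-1: S] = S.
  move=> hS; apply/setP => x; apply/imsetP/idP; first by case=> y; rewrite inE => h ->.
  by move=> xS; have /imsetP [y _ e] := subsetP (sub S hS) x xS; exists y; rewrite ?inE -?e.
exists ((fun S : {set 'I_n.+1} => r @^-1: S) @: b); split.
  apply/is_flagP; split.
  - by rewrite imset_eq0.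
  - apply/negP => /imsetP [S hS e]; have := im S hS; rewrite -e imset0 => e'.
    by rewrite -e' in hS; rewrite hS in h2.
  - move=> S T /imsetP [S' hS' ->] /imsetP [T' hT' ->].
    by rewrite /scmp; case/orP: (h3 _ _ hS' hT') => h; rewrite (preimsetS _ h) ?orbT.
rewrite /tset -imset_comp -[RHS]imset_id; apply: eq_in_imset => S hS /=; exact: im.
Qed.

Lemma flag_shrink m (b : Fl m) : is_flag b ->
  exists q (u : Dmap q m) c, [/\ injective u, is_flag c, tset u c = b & setT \in c].
Proof.
move=> fb; have [S hS max] := flag_max fb.
have S0 : S != set0 by apply/negP => /eqP e; case/is_flagP: fb => _ /negP h _; rewrite e in hS.
have [q [u [eu ui]]] := subset_dmap S0.
have [|c [fc ec]] := flag_lift (r := u) fb; first by move=> T; rewrite eu; exact: max.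
exists q, u, c; split=> //.
have : S \in tset u c by rewrite ec.
case/imsetP => T hT; rewrite -eu => /(imset_inj ui) ->.
by [].
Qed.

Section Evaluation.
Variable X : Cpx.
Local Notation EE := (Ex (Ex (Sing X))).

Definition ev m (e : EE m) l (c : Sd m l) j (c' : Sd l j) (i : 'I_j.+1) : vert X :=
  ((((e : SMap _ _) l c : SMap _ _) j c') : CMap _ _) i.

Lemma ev_nat_out m (e : EE m) l l' (c : Sd m l) (f : Dmap l' l) j (c' : Sd l' j) i :
  ev e (sact (Sd m) f c) c' i = ev e c (sdmap f j c') i.
Proof. by rewrite /ev (snat (e : SMap _ _) f c). Qed.

Lemma ev_nat_in m (e : EE m) l (c : Sd m l) j j' (c' : Sd l j) (f : Dmap j' j) i :
  ev e c (sact (Sd l) f c') i = ev e c c' (f i).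
Proof. by rewrite /ev (snat ((e : SMap _ _) l c : SMap _ _) f c'). Qed.

(** Every chain of faces is a degeneration of the injective chain with the same set of faces, and
    the degeneracy takes the full vertex of one subdivision to that of the other. *)
Lemma ev_full m (e : EE m) l (c : Sd m l) l' (c' : Sd m l') : cimg c = cimg c' ->
  ev e c (sd_full l) ord0 = ev e c' (sd_full l') ord0.
Proof.
suff W l0 (c0 : Sd m l0) : injective (proj1_sig c0) -> forall l (c : Sd m l), cimg c = cimg c0 ->
    ev e c (sd_full l) ord0 = ev e c0 (sd_full l0) ord0.
  move=> E; have fl : is_flag (cimg c) by apply: cpart_flag; exact: setT_neq0.
  have [l0 [c0 [e0 i0]]] := flag_chain fl.
  by rewrite (W l0 c0 i0 l c) // (W l0 c0 i0 l' c') // -E.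
move=> i0 {c} {}l c E.
have hs x : exists y, proj1_sig c x = proj1_sig c0 y.
  have : proj1_sig c x \in cimg c0 by rewrite -E imset_f.
  by case/imsetP => y _ ->; exists y.
have [s es] := choice_fun hs.
have sm (i j : 'I_l.+1) : i <= j -> s i <= s j.
  move=> ij; case: leqP => // lt.
  have h1 := proj2 (proj2_sig c) _ _ ij; rewrite !es in h1.
  have h2 := proj2 (proj2_sig c0) _ _ (ltnW lt).
  have e' : s i = s j by apply: i0; apply/eqP; rewrite eqEsubset h1 h2.
  by move: lt; rewrite e' ltnn.
pose f : Dmap l l0 := {| dfun := s; dmono := sm |}.
have -> : c = sact (Sd m) f c0 by apply: sig_eq; apply: functional_extensionality => x /=.
rewrite ev_nat_out; congr (ev e c0 _ _); apply: sig_eq; apply: functional_extensionality => x /=.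
apply/setP => y; rewrite inE; apply/imsetP.
have : proj1_sig c0 y \in cimg c by rewrite E imset_f.
case/imsetP => z _ ez; exists z; first by rewrite inE.
by apply: i0; rewrite ez es.
Qed.

(* A simplex of [Ex^2 Sing X] is a map from the complex of flags to [X]; [evl] reads off its value
   on vertices. The value is junk when [b] is not a flag. *)
Definition evl m (e : EE m) (b : Fl m) : vert X :=
  match excluded_middle_informative (exists lc : {l & Sd m l}, cimg (projT2 lc) = b) with
  | left h => let lc := proj1_sig (constructive_indefinite_description _ h) in
              ev e (projT2 lc) (sd_full _) ord0
  | right _ => ev e (sd_full m) (sd_full 0) ord0
  end.

Lemma evl_img m (e : EE m) l (c : Sd m l) : evl e (cimg c) = ev e c (sd_full l) ord0.
Proof.
rewrite /evl; case: excluded_middle_informative => [h|[]]; last by exists (existT _ l c).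
by case: constructive_indefinite_description => [[l' c'] /= E]; apply: ev_full.
Qed.

(** Restricting [c'] to its vertex [i], and [c] to the index set found there, reduces any value to
    one at a full vertex. *)
Lemma evE m (e : EE m) l (c : Sd m l) j (c' : Sd l j) i :
  ev e c c' i = evl e (cpart c (proj1_sig c' i)).
Proof.
have [l' [t [et _]]] := subset_dmap (proj1 (proj2_sig c') i).
have -> : cpart c (proj1_sig c' i) = cimg (sact (Sd m) t c).
  by rewrite -et /cimg /cpart -imset_comp.
rewrite evl_img ev_nat_out.
pose f : Dmap 0 j := {| dfun := fun _ => i; dmono := fun _ _ _ => leqnn i |}.
have -> : sdmap t 0 (sd_full l') = sact (Sd l) f c'.
  by apply: sig_eq; apply: functional_extensionality => x /=.
by rewrite ev_nat_in.
Qed.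

Lemma evl_ext m (e e' : EE m) : (forall b, is_flag b -> evl e b = evl e' b) -> e = e'.
Proof.
move=> h; apply: smap_eq => l c; apply: smap_eq => j c'; apply: cmap_eq => i.
have := evE e c c' i; rewrite h; first by rewrite -evE.
by apply: cpart_flag; exact: proj1 (proj2_sig c') i.
Qed.

Lemma evl_act m m' (u : Dmap m' m) (e : EE m) b : is_flag b ->
  evl (sact EE u e) b = evl e (tset u b).
Proof.
move=> /flag_chain [l [c [<- _]]].
have -> : tset u (cimg c) = cimg (sdmap u l c).
  by rewrite /tset /cimg /cpart -imset_comp.
by rewrite !evl_img.
Qed.

Lemma evl_simplex m (e : EE m) T : flag_simplex T -> simplex X (pimage (evl e) T).
Proof.
move=> [[b0 Tb0] hf hc].
pose A := [set b : Fl m | if excluded_middle_informative (T b) then true else false].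
have mA b : (b \in A) <-> T b by rewrite inE; case: excluded_middle_informative.
have A0 : A != set0 by apply/set0Pn; exists b0; apply/mA.
have [j [d [d1 d2 d3 d4]]] := enum_by_key (fun b : Fl m => #|b|) A0.
have dT i : T (d i) by apply/mA.
have dsub (i i' : 'I_j.+1) : i <= i' -> d i \subset d i'.
  by move=> le; apply: scmp_card; [apply: hc | apply: d4].
have [l [c [ec _]]] := flag_chain (hf _ (dT ord_max)).
(* All flags of [T] lie in the largest one, so a single chain [c] lists their faces and the flags
   become nested sets of indices. *)
pose c' (i : 'I_j.+1) := [set x | proj1_sig c x \in d i].
have cp i : cpart c (c' i) = d i.
  apply/setP => S; apply/imsetP/idP; first by case=> x; rewrite inE => h ->.
  move=> hS; have : S \in cimg c by rewrite ec; apply: (subsetP (dsub i ord_max (leq_ord i))).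
  by case/imsetP => x _ e'; exists x; rewrite ?inE -?e'.
have hc' : sdP c'.
  split=> [i|i i' /dsub /subsetP s]; last by apply/subsetP => x; rewrite !inE; apply: s.
  apply/negP => /eqP e'; have := cp i; rewrite e' /cpart imset0 => e2.
  by case/is_flagP: (hf _ (dT i)); rewrite -e2 eqxx.
pose s : CMap (Delta j) X := ((e : SMap _ _) l c : SMap _ _) j (exist _ c' hc').
apply: (simplex_sub (rng_simplex s)); last by exists (evl e b0), b0.
move=> v [b [/mA /d2 [i <-] <-]]; exists i.
by rewrite -(cp i); apply: (evE e c (exist _ c' hc') i).
Qed.

Variables (n : nat) (gam : Fl n -> vert X).
Hypothesis gam_simplex : forall T, flag_simplex T -> simplex X (pimage gam T).

Lemma mk_ee_subproof m (t : Dmap m n) l (c : Sd m l) j (c' : Sd l j) :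
  simplex X (fun v => exists i, gam (tset t (cpart c (proj1_sig c' i))) = v).
Proof.
pose T b := exists i, tset t (cpart c (proj1_sig c' i)) = b.
apply: (simplex_sub (gam_simplex (T := T) _)).
- split.
  + by exists (tset t (cpart c (proj1_sig c' ord0))), ord0.
  + move=> b [i <-]; apply: tset_flag; apply: cpart_flag; exact: proj1 (proj2_sig c') i.
  + have W (i i' : 'I_j.+1) : i <= i' -> tset t (cpart c (proj1_sig c' i)) \subset tset t (cpart c (proj1_sig c' i')).
      move=> le; apply: imsetS; apply: imsetS; exact: (proj2 (proj2_sig c')).
    move=> b b' [i <-] [i' <-]; rewrite /scmp; case: (leqP i i') => [/W ->//|/ltnW /W ->].
    by rewrite orbT.
- by move=> v [i <-]; exists (tset t (cpart c (proj1_sig c' i))); split=> //; exists i.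
- by exists (gam (tset t (cpart c (proj1_sig c' ord0)))), ord0.
Qed.

Definition mk_ee0 m (t : Dmap m n) l (c : Sd m l) : Ex (Sing X) l.
Proof.
refine (@Build_SMap (Sd l) (Sing X) (fun j c' => mk_sing (mk_ee_subproof t c c')) _).
by move=> j j' f c'; apply: cmap_eq.
Defined.

Definition mk_ee1 m (t : Dmap m n) : EE m.
Proof.
refine (@Build_SMap (Sd m) (Ex (Sing X)) (fun l c => mk_ee0 t c) _).
move=> l' l f c; apply: smap_eq => j c'; apply: cmap_eq => i /=.
by rewrite /cpart -imset_comp.
Defined.

(** The inverse of [evl]: a simplicial map from the complex of flags to [X] becomes an [n]-simplex
    of [Ex^2 Sing X], presented as a map from [Std n]. *)
Definition mk_ee : SMap (Std n) EE.
Proof.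
refine (@Build_SMap (Std n) EE (fun m t => mk_ee1 t) _).
move=> m' m f t; apply: smap_eq => l c; apply: smap_eq => j c'; apply: cmap_eq => i /=.
rewrite (tset_comp t f) /=; congr (gam (tset t _)).
by rewrite /tset /cpart -imset_comp.
Defined.

Lemma evl_mk_ee m (t : Dmap m n) b : is_flag b -> evl (mk_ee m t) b = gam (tset t b).
Proof. by move=> /flag_chain [l [c [<- _]]]; rewrite evl_img. Qed.

End Evaluation.

Lemma evl_map X Y (p : CMap X Y) m (e : Ex (Ex (Sing X)) m) b :
  evl (ExMap (ExMap (SingMap p)) m e) b = p (evl e b).
Proof. by rewrite /evl; case: excluded_middle_informative. Qed.

Section HornFlags.
Variables (n : nat) (k : 'I_n.+1).

Lemma horn_tset m (t : Dmap m n) (b : Fl m) : hornP k t -> in_horn k (tset t b).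
Proof.
case=> j [jk tj]; apply/forall_inP => S /imsetP [S' _ ->].
apply/eqP => /setP /(_ j); rewrite !inE (negbTE jk) /= => /imsetP [y _ e].
by have := tj y; rewrite -e eqxx.
Qed.

Lemma horn_of_top m (r : Dmap m n) (c : Fl m) : setT \in c -> in_horn k (tset r c) -> hornP k r.
Proof.
move=> Tc /forall_inP h.
have := h _ (imset_f _ Tc); rewrite eqEsubset subsetT /= => /subsetPn [j _].
rewrite !inE negb_or => /andP [jk nj]; exists j; split=> // i.
by apply/eqP => e; case/negP: nj; rewrite -e imset_f.
Qed.

Variables (X : Cpx) (a : SMap (Horn k) (Ex (Ex (Sing X)))).

(* The vertex map [Sd^2 Lambda -> X] underlying [a], as a relation. *)
Definition horn_value (b : Fl n) (v : vert X) : Prop :=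
  exists m (t : Dmap m n) (h : hornP k t) (c : Fl m),
    [/\ is_flag c, tset t c = b & v = evl (a m (exist _ t h)) c].

Lemma horn_evl_comp m m' (t : Dmap m n) (u : Dmap m' m) (h : hornP k t)
    (h' : hornP k (dcomp t u)) (c : Fl m') : is_flag c ->
  evl (a m' (exist _ (dcomp t u) h')) c = evl (a m (exist _ t h)) (tset u c).
Proof.
move=> fc; rewrite -evl_act // -snat; congr (evl (a m' _) c).
exact: sig_eq.
Qed.

(** The largest member of [b] is the image of a face inclusion [r] inside the horn. Every other
    representative of [b], once shrunk to its own largest member, factors through [r], so its value
    is the one read there. *)
Lemma horn_value_top b : is_flag b -> in_horn k b ->
  exists q (r : Dmap q n) (h : hornP k r) c,
    [/\ injective r, is_flag c, tset r c = b, setT \in c &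
        forall v, horn_value b v -> v = evl (a q (exist _ r h)) c].
Proof.
move=> fb hb; have [q [r [c [ri fc ec Tc]]]] := flag_shrink fb.
have hr : hornP k r by apply: (horn_of_top Tc); rewrite ec.
exists q, r, hr, c; split=> // v [m [t [h [d [fd ed ->]]]]].
have [p [u [d' [ui fd' ed' Td']]]] := flag_shrink fd.
have [|s es] := @dmap_factor p q n (dcomp t u) r ri.
  move=> x; have : [set t (u y) | y in setT] \in b.
    by rewrite -ed -ed' -tset_comp; apply: imset_f.
  rewrite -ec => /imsetP [S _ e].
  have : t (u x) \in [set r y | y in S] by rewrite -e; apply: (imset_f (fun y => t (u y))); rewrite inE.
  by case/imsetP => y _ ey; exists y.
have h2 : hornP k (dcomp t u) by apply: hornP_act.
have h3 : hornP k (dcomp r s) by rewrite -es.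
rewrite -ed' -(horn_evl_comp h h2) //.
have -> : exist _ (dcomp t u) h2 = exist (fun t => hornP k t) (dcomp r s) h3 by apply: sig_eq.
rewrite (horn_evl_comp hr h3) //; congr (evl _ _).
apply: (tset_inj ri); rewrite -tset_comp ec -ed -ed' -tset_comp.
have E x : r (s x) = t (u x) by rewrite -[r (s x)]/(dcomp r s x) -es.
by rewrite /tset; apply: eq_imset => S /=; apply: eq_imset => x; rewrite /= E.
Qed.

Lemma horn_value_unique b v w : is_flag b -> in_horn k b -> horn_value b v -> horn_value b w -> v = w.
Proof.
by move=> fb hb hv hw; have [q [r [h [c [_ _ _ _ u]]]]] := horn_value_top fb hb;
   rewrite (u v hv) (u w hw).
Qed.

Lemma horn_value_exists b : is_flag b -> in_horn k b -> exists v, horn_value b v.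
Proof.
move=> fb hb; have [q [r [h [c [_ fc ec _ _]]]]] := horn_value_top fb hb.
by exists (evl (a q (exist _ r h)) c), q, r, h, c.
Qed.

(** The face carrying the largest flag of the chain carries all the others, so one simplex of [a]
    computes every value. *)
Lemma horn_value_simplex (al : Fl n -> vert X) T :
  (forall b, is_flag b -> in_horn k b -> horn_value b (al b)) ->
  flag_simplex T -> (forall b, T b -> in_horn k b) -> simplex X (pimage al T).
Proof.
move=> hal [[b0 Tb0] hf hc] hT.
have [bm [Tbm max]] : exists bm, T bm /\ forall b, T b -> #|b| <= #|bm|.
  have [N hN] : exists N, forall b : Fl n, #|b| <= N by exists #|{: {set 'I_n.+1}}| => b; apply: max_card.
  have [M] : exists M, N - #|b0| <= M by exists (N - #|b0|).
  elim: M b0 Tb0 => [|M IH] b Tb le.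
    by exists b; split=> // b' _; have := hN b'; lia.
  case: (classic (exists2 b', T b' & #|b| < #|b'|)) => [[b' Tb' lt]|h].
    by apply: (IH b') => //; have := hN b'; lia.
  exists b; split=> // b' Tb'; case: leqP => // lt; case: h; by exists b'.
have sub b : T b -> b \subset bm by move=> Tb; apply: scmp_card; [apply: hc | apply: max].
have [q [r [h [c [ri fc ec Tc u]]]]] := horn_value_top (hf _ Tbm) (hT _ Tbm).
pose T' d := is_flag d /\ T (tset r d).
have lift b : T b -> exists d, T' d /\ tset r d = b.
  move=> Tb; have [|d [fd ed]] := flag_lift (r := r) (hf _ Tb).
    move=> S Sb; have : S \in tset r c by rewrite ec; apply: (subsetP (sub b Tb)).
    by case/imsetP => S' _ ->; apply: imsetS; apply: subsetT.
  by exists d; split=> //; split=> //; rewrite ed.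
have fT' : flag_simplex T'.
  split; first by have [d [hd _]] := lift b0 Tb0; exists d.
    by move=> d [].
  move=> d e [fd Td] [fe Te]; have := hc _ _ Td Te.
  by rewrite /scmp => /orP [] /(tset_sub ri) ->; rewrite ?orbT.
apply: (simplex_sub (evl_simplex (a q (exist _ r h)) fT')); last by exists (al b0), b0.
move=> v [b [Tb <-]]; have [d [hd ed]] := lift b Tb; exists d; split=> //.
apply: (@horn_value_unique b); [exact: hf | exact: hT | | by apply: hal; [apply: hf | apply: hT]].
by exists q, r, h, d; split=> //; case: hd.
Qed.

End HornFlags.

Lemma set1_flag n (k : 'I_n.+1) : 0 < n -> is_flag [set [set k]] /\ in_horn k [set [set k]].
Proof.
move=> n0; split; last first.
  by apply/forall_inP => S; rewrite inE => /eqP ->; rewrite setUid set1_neqT.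
apply/is_flagP; split.
- by apply/set0Pn; exists [set k]; rewrite inE.
- by rewrite inE; apply/negP => /eqP /setP /(_ k); rewrite !inE eqxx.
- by move=> S T; rewrite !inE => /eqP -> /eqP ->; exact: scmp_refl.
Qed.

Section CellFibration.
Variables (K L : Cpx) (phi : CMap K L).
Local Notation P := (cell_cpx phi).

(** The lifting problem is itself the datum of a valid cell: [al] on the horn, [beta] over the whole
    simplex. The characteristic map of that cell is the lift. *)
Lemma cell_proj_fib : T_fib (cell_proj phi).
Proof.
move=> n k n0 a b comm.
pose beta (c : Fl n) := evl (b n (did n)) c.
have bE m (t : Dmap m n) c : is_flag c -> evl (b m t) c = beta (tset t c).
  move=> fc; rewrite /beta -evl_act // -snat; congr (evl (b m _) c); exact: dmap_eq.
have [f1 h1] := set1_flag k n0.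
(* [v0] is only a default for arguments that are not flags, or not in the horn; it exists because
   [n] is positive. *)
have [v0 _] := horn_value_exists a f1 h1.
have [al hal] : exists al : Fl n -> vert P, forall c, is_flag c -> in_horn k c -> horn_value a c (al c).
  suff H c : exists v, is_flag c -> in_horn k c -> horn_value a c v by exact: choice_fun H.
  case: (boolP (is_flag c)) => fc; last by exists v0.
  case: (boolP (in_horn k c)) => hc; last by exists v0.
  by have [v hv] := horn_value_exists a fc hc; exists v.
have alP c : is_flag c -> in_horn k c -> cell_proj phi (al c) = beta c.
  move=> fc hc; have [m [t [h [d [fd <- ->]]]]] := hal c fc hc.
  rewrite -evl_map -bE //; congr (evl _ d); exact: comm.
pose j : cell_data K L := existT (fun n => 'I_n.+1 * (Fl n -> cellv K L) * (Fl n -> vert L))%type n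
  (k, (fun c => proj1_sig (al c)), beta).
have vj : valid phi j.
  split=> //.
  - move=> T fT hT; have := horn_value_simplex hal fT hT.
    rewrite /= /vimg; have -> // : pimage (@proj1_sig _ _) (pimage al T) = pimage (@cattach _ _ j) T.
    apply: pred_ext => v; split; first by case=> w [[c [Tc <-]] <-]; exists c.
    by case=> c [Tc <-]; exists (al c); split=> //; exists c.
  - by move=> T fT; apply: evl_simplex.
have [gam hgam] : exists gam : Fl n -> vert P, forall c,
    is_flag c -> proj1_sig (gam c) = @glue _ _ j c.
  suff H c : exists v : vert P, is_flag c -> proj1_sig v = @glue _ _ j c by exact: choice_fun H.
  case: (boolP (is_flag c)) => fc; last by exists v0.
  case: (boolP (in_horn k c)) => hc.
    by exists (al c) => _; rewrite glue_horn.
  have ho : off_horn (cvert j) c by rewrite /off_horn fc.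
  exists (exist (fun y => gsimp phi (fun x => x = y)) _ (valid_vertex vj ho)) => _ /=.
  by rewrite /glue (negbTE hc).
have gamS T : flag_simplex T -> simplex P (pimage gam T).
  move=> fT; have [[c0 Tc0] hf _] := fT.
  apply: (@gsimp_valid _ _ phi j T) => //; last by exists (proj1_sig (gam c0)), (gam c0); split=> //; exists c0.
  by move=> v [w [[c [Tc <-]] <-]]; exists c; split=> //; rewrite hgam //; apply: hf.
have gam_al c : is_flag c -> in_horn k c -> gam c = al c.
  by move=> fc hc; apply: sig_eq; rewrite hgam // glue_horn.
have gam_proj c : is_flag c -> cell_proj phi (gam c) = beta c.
  move=> fc; case: (boolP (in_horn k c)) => hc; first by rewrite gam_al // alP.
  by rewrite /= hgam // /glue (negbTE hc).
exists (mk_ee gamS); split=> m x.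
  apply: evl_ext => c fc; rewrite evl_mk_ee //.
  have fx := tset_flag (proj1_sig x) fc; have hx := horn_tset c (proj2_sig x).
  rewrite gam_al //; apply: (horn_value_unique fx hx); first exact: hal.
  by exists m, (proj1_sig x), (proj2_sig x), c; split=> //; case: x {fx hx}.
apply: evl_ext => c fc; rewrite evl_map evl_mk_ee // gam_proj ?bE //.
exact: tset_flag.
Qed.

End CellFibration.

(** * Weak equivalences *)

Lemma homot_pre X Y Z (f : SMap X Y) (h h' : SMap Y Z) :
  homot h h' -> homot (scomp h f) (scomp h' f).
Proof.
elim=> [a b [H [H0 H1]]|a|a b _ IH|a b c _ IH1 _ IH2].
- apply: rst_step; exists (scomp H (prod_map _ f)).
  by split=> n x /=; rewrite ?H0 ?H1.
- exact: rst_refl.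
- exact: rst_sym.
- exact: rst_trans IH1 IH2.
Qed.

Lemma scompA X Y Z W (h : SMap Z W) (g : SMap Y Z) (f : SMap X Y) :
  scomp (scomp h g) f = scomp h (scomp g f).
Proof. exact: smap_eq. Qed.

Lemma sweq_comp X Y Z (g : SMap Y Z) (f : SMap X Y) : sweq f -> sweq g -> sweq (scomp g f).
Proof.
move=> hf hg W kW; have [f1 f2] := hf W kW; have [g1 g2] := hg W kW; split=> [u|h1 h2].
  have [v hv] := f1 u; have [w hw] := g1 v; exists w.
  by rewrite -scompA; apply: rst_trans hv; apply: homot_pre.
by rewrite -!scompA => /f2 /g2.
Qed.

Lemma sweq_cancel_r X Y Z (g : SMap Y Z) (f : SMap X Y) : sweq f -> sweq (scomp g f) -> sweq g.
Proof.
move=> hf hg W kW; have [f1 f2] := hf W kW; have [g1 g2] := hg W kW; split=> [u|h1 h2 e].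
  have [v hv] := g1 (scomp u f); exists v; apply: f2; by rewrite scompA.
by apply: g2; rewrite -!scompA; apply: homot_pre.
Qed.

Lemma sweq_retract X Y X' Y' (f : SMap X Y) (f' : SMap X' Y') (i : SMap X X') (r : SMap X' X)
    (j : SMap Y Y') (s : SMap Y' Y) :
  scomp r i = sid X -> scomp s j = sid Y -> scomp f' i = scomp j f -> scomp f r = scomp s f' ->
  sweq f' -> sweq f.
Proof.
move=> ri sj e1 e2 hf W kW; have [f1 f2] := hf W kW.
have idr A (u : SMap A W) : scomp u (sid A) = u by apply: smap_eq.
split=> [u|h1 h2 e].
  have [v hv] := f1 (scomp u r); exists (scomp v j).
  by have := homot_pre i hv; rewrite !scompA ri idr e1.
have := homot_pre r e; rewrite !scompA e2 -!scompA => /f2 /(homot_pre j).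
by rewrite !scompA sj !idr.
Qed.

Lemma sweq_iso X Y (f : SMap X Y) (g : SMap Y X) :
  scomp g f = sid X -> scomp f g = sid Y -> sweq f.
Proof.
move=> gf fg W kW; have idr A (u : SMap A W) : scomp u (sid A) = u by apply: smap_eq.
split=> [u|h1 h2 /(homot_pre g)]; last by rewrite !scompA fg !idr.
by exists (scomp u g); rewrite scompA gf idr; apply: rst_refl.
Qed.

Lemma sweq_id X : sweq (sid X).
Proof. by apply: (@sweq_iso _ _ _ (sid X)); apply: smap_eq. Qed.

Lemma SingMap_comp K L M (g : CMap L M) (f : CMap K L) :
  SingMap (cmcomp g f) = scomp (SingMap g) (SingMap f).
Proof. by apply: smap_eq => n s; apply: cmap_eq. Qed.

Definition cmid (K : Cpx) : CMap K K.
Proof.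
refine (@Build_CMap K K (fun v => v) _) => S hS.
have [_ [x Sx]] := simplex_fin hS; apply: (simplex_sub hS); last by exists x, x.
by move=> y [z [Sz <-]].
Defined.

Lemma SingMap_id K (f : CMap K K) : (forall v, f v = v) -> SingMap f = sid (Sing K).
Proof. by move=> h; apply: smap_eq => n s; apply: cmap_eq => i /=; rewrite h. Qed.

Lemma SingMap_square K L L' M (f : CMap K L) (g : CMap L M) (f' : CMap K L') (g' : CMap L' M) :
  (forall v, g (f v) = g' (f' v)) ->
  scomp (SingMap g) (SingMap f) = scomp (SingMap g') (SingMap f').
Proof. by move=> h; apply: smap_eq => n s; apply: cmap_eq => i /=. Qed.

Definition unit_map (K : Cpx) : CMap K (Cl (skel K)) := adjunct (cmid (skel K)).

Lemma finite_least V (le : V -> V -> Prop) (S : V -> Prop) : pfinite S -> pnonempty S ->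
  (forall x y, S x -> S y -> le x y \/ le y x) ->
  (forall x y z, le x y -> le y z -> le x z) ->
  exists2 m, S m & forall x, S x -> le m x.
Proof.
move=> [n [g hg]] ne tot tr; elim: n g S hg ne tot => [|n IH] g S hg [x0 Sx0] tot.
  by have [[]] := hg x0 Sx0.
have rf x : S x -> le x x by move=> Sx; case: (tot x x Sx Sx).
pose S' x := S x /\ exists i, g (lift ord0 i) = x.
have S'P x : S x -> S' x \/ x = g ord0.
  move=> Sx; have [i ei] := hg x Sx; case: (unliftP ord0 i) => [k e|e].
    by left; split=> //; exists k; rewrite -e.
  by right; rewrite -ei e.
case: (classic (pnonempty S')) => [ne|emp]; last first.
  exists x0 => // x Sx.
  have eq0 y : S y -> y = g ord0 by move=> /S'P [h|//]; case: emp; exists y.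
  by rewrite (eq0 x Sx) -(eq0 x0 Sx0); apply: rf.
have [||m [Sm _] hm] := IH (fun i => g (lift ord0 i)) S' _ ne.
- by move=> x [].
- by move=> x y [Sx _] [Sy _]; apply: tot.
case: (classic (S (g ord0))) => [S0|n0]; last first.
  exists m => // x Sx; case: (S'P x Sx) => [/hm//|e].
  by rewrite e in Sx.
case: (tot m (g ord0) Sm S0) => h.
  by exists m => // x /S'P [/hm//|->].
exists (g ord0) => // x Sx; case: (S'P x Sx) => [/hm h'|->]; last exact: rf.
exact: tr h h'.
Qed.

(* The flag complex of pointed simplices [(v, A)], [v] in [A], under inclusion of [A], is weakly
   equivalent to [K]: inside [pointed_cyl], whose simplices join a simplex [sigma] of [K] to a chain
   of simplices containing [sigma], the links of both ends are cones. *)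
Section Pointed.
Variable K : Cpx.

(** The marked vertex gives a projection to [K] without an order or a choice on the vertices of
    simplices. *)
Definition pointed := {p : vert K * (vert K -> Prop) | simplex K p.2 /\ p.2 p.1}.

Definition pbase (q : pointed) : vert K := (proj1_sig q).1.
Definition pset (q : pointed) : vert K -> Prop := (proj1_sig q).2.

Definition pcollapse (x : vert K + pointed) : vert K :=
  match x with inl v => v | inr q => pbase q end.

Definition pcyl_simplex (S : vert K + pointed -> Prop) : Prop :=
  [/\ pfinite S, simplex K (pimage pcollapse S),
      forall q q', S (inr q) -> S (inr q') -> psub (pset q) (pset q') \/ psub (pset q') (pset q) &
      forall x q, S (inl x) -> S (inr q) -> pset q x].

Lemma pcyl_nonempty S : pcyl_simplex S -> pnonempty S.
Proof. by case=> _ /simplex_fin [_ [y [x [Sx _]]]] _ _; exists x. Qed.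

Definition pointed_cyl : Cpx.
Proof.
refine {| vert := vert K + pointed; simplex := pcyl_simplex |}.
- by move=> S h; split; [case: h | exact: pcyl_nonempty].
- move=> v; split.
  + by exists 1, (fun _ => v) => x ->; exists ord0.
  + have -> : pimage pcollapse (fun x => x = v) = (fun y => y = pcollapse v).
      by apply: pred_ext => y; split=> [[x [-> <-]]|->] //; exists v.
    exact: simplex_single.
  + by move=> q q' <- [<-]; left.
  + by move=> x q <-.
- move=> S T [[n [g hg]] h2 h3 h4] TS [x Tx]; split.
  + by exists n, g => y /TS /hg.
  + apply: (simplex_sub h2); last by exists (pcollapse x), x.
    by move=> y [z [/TS Sz <-]]; exists z.
  + by move=> q q' /TS hq /TS hq'; apply: h3.
  + by move=> y q /TS hy /TS hq; apply: h4.
Defined.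

Definition pointed_cpx : Cpx.
Proof.
refine {| vert := pointed; simplex := fun S => pcyl_simplex (pimage inr S) |}.
- move=> S h; have [z [x [Sx _]]] := pcyl_nonempty h; split; last by exists x.
  case: h => [[n [g hg]] _ _ _].
  exists n, (fun i => if g i is inr q then q else x) => q Sq.
  have [|i e] := hg (inr q); first by exists q.
  by exists i; rewrite e.
- move=> v; have -> : pimage inr (fun x => x = v) = (fun y : vert pointed_cyl => y = inr v).
    by apply: pred_ext => y; split=> [[x [-> <-]]|->] //; exists v.
  exact: (simplex_single (c := pointed_cyl)).
- move=> S T h TS [x Tx]; apply: (simplex_sub (c := pointed_cyl) h); last by exists (inr x), x.
  by move=> y [z [/TS Sz <-]]; exists z.
Defined.

Definition pointed_incl : CMap pointed_cpx pointed_cyl :=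
  @Build_CMap pointed_cpx pointed_cyl inr (fun S h => h).

Definition base_incl : CMap K pointed_cyl.
Proof.
refine (@Build_CMap K pointed_cyl inl _) => S hS.
have [[n [g hg]] _] := simplex_fin hS; split.
- by exists n, (fun i => inl (g i)) => x [y [/hg [i <-] <-]]; exists i.
- have -> // : pimage pcollapse (pimage inl S) = S.
  apply: pred_ext => x; split; first by case=> y [[z [Sz <-]] <-].
  by move=> Sx; exists (inl x); split=> //; exists x.
- by move=> q q' [x []].
- by move=> x q _ [y []].
Defined.

Definition collapse : CMap pointed_cyl K :=
  @Build_CMap pointed_cyl K pcollapse (fun S h => let: And4 _ h2 _ _ := h in h2).

(** The apex collapses onto a vertex already present, so the image in [K] is unchanged and only the
    order conditions remain. *)
Lemma pcyl_cone (c : vert pointed_cyl) (R : vert pointed_cyl -> Prop) :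
  pcyl_simplex R -> (exists2 d, R d & pcollapse d = pcollapse c) ->
  (forall q q', c = inr q -> R (inr q') -> psub (pset q) (pset q')) ->
  (forall x q, c = inl x -> R (inr q) -> pset q x) ->
  (forall x q, R (inl x) -> c = inr q -> pset q x) ->
  pcyl_simplex (punion (fun x => x = c) R).
Proof.
move=> [[n [g hg]] h2 h3 h4] [d Rd ed] k1 k2 k3; split.
- exists n.+1, (fun i => if unlift ord0 i is Some k then g k else c) => x [->|/hg [i <-]].
    by exists ord0; rewrite unlift_none.
  by exists (lift ord0 i); rewrite liftK.
- have -> // : pimage pcollapse (punion (fun x => x = c) R) = pimage pcollapse R.
  apply: pred_ext => y; split=> [[x [[->|Rx] <-]]|[x [Rx <-]]].
  + by exists d.
  + by exists x.
  + by exists x; split=> //; right.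
- move=> q q' [e|Rq] [e'|Rq'].
  + by move: e'; rewrite -e => -[->]; left.
  + by left; apply: k1 (esym e) Rq'.
  + by right; apply: k1 (esym e') Rq.
  + exact: h3.
- move=> x q [e|Rx] [e'|Rq].
  + by rewrite -e in e'.
  + exact: k2 (esym e) Rq.
  + exact: k3 Rx (esym e').
  + exact: h4.
Qed.

Lemma pcyl_full (Q : spred (Sing pointed_cyl)) :
  acyclic Q (fam (U := pointed_cyl) pcyl_simplex) -> acyclic Q (@sfull (Sing pointed_cyl)).
Proof.
move=> A Z kZ; have [a b] := A Z kZ; split.
  apply: (ext_mono _ a) => n s _; exact: (@rng_simplex pointed_cyl).
apply: (ext_mono _ b) => n s _; left; exact: (@rng_simplex pointed_cyl).
Qed.

Lemma pointed_incl_weq : T_weq pointed_incl.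
Proof.
pose D (x : vert pointed_cyl) : Prop := exists v, x = inl v.
have A : acyclic (fam (U := pointed_cyl) (fun S => pcyl_simplex S /\ forall x, S x -> ~ D x))
   (fam (U := pointed_cyl) pcyl_simplex).
  apply: acyclic_link => //; first exact: (@simplex_sub pointed_cyl).
  move=> sigma hs sD; have [_ h2 _ _] := hs.
  have [x0 sx0] := pcyl_nonempty hs; have [v0 e0] := sD x0 sx0.
  (* [A] is the smallest set that a pointed simplex joined to [sigma] can carry, so the apex lies
     below all those in the link. *)
  pose A := pimage pcollapse sigma.
  have Av0 : A v0 by exists x0; split=> //; rewrite e0.
  pose q : pointed := exist (fun p : vert K * (vert K -> Prop) => simplex K p.2 /\ p.2 p.1)
    (v0, A) (conj h2 Av0).
  exists (inr q); split; first by case.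
  move=> S SD hS; have [_ _ _ k4] := hS.
  have sinl v : sigma (inl v) -> A v by exists (inl v).
  have inls v : A v -> sigma (inl v).
    by case=> x [sx <-]; have [w ew] := sD x sx; rewrite ew in sx *.
  apply: pcyl_cone => //.
  - by exists x0; [right | rewrite e0].
  - by move=> _ q' [<-] hq' v /inls sv; apply: (k4 v q' _ hq'); right.
  - move=> v _ hv [<-]; apply: sinl; case: hv => // Sv.
    by apply: SD Sv _; exists v.
apply: (acyclic_sweq _ _ (pcyl_full A)).
- move=> n s t e; apply: cmap_eq => i.
  by have := f_equal (fun u : CMap (Delta n) pointed_cyl => u i) e => -[].
- move=> n s; split=> [[h1 h2]|[t <-]]; last first.
    split; first exact: (@rng_simplex pointed_cyl).
    by move=> x [i <-] [v].
  have [t ht] : exists t : 'I_n.+1 -> pointed, forall i, inr (t i) = s i.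
    suff H i : exists q, inr q = s i by exact: choice_fun H.
    case e : (s i) => [v|q]; last by exists q.
    by case: (h2 (s i)); [exists i | exists v].
  have tS : simplex pointed_cpx (fun x => exists i, t i = x).
    rewrite /=; have -> // : pimage inr (fun x => exists i, t i = x) = rng s.
    apply: pred_ext => x; split; first by case=> y [[i <-] <-]; exists i; rewrite ht.
    by case=> i <-; exists (t i); split=> //; exists i.
  by exists (mk_sing (U := pointed_cpx) tS); apply: cmap_eq.
Qed.

Lemma base_incl_weq : T_weq base_incl.
Proof.
pose D (x : vert pointed_cyl) : Prop := exists q, x = inr q.
have A : acyclic (fam (U := pointed_cyl) (fun S => pcyl_simplex S /\ forall x, S x -> ~ D x))
   (fam (U := pointed_cyl) pcyl_simplex).
  apply: acyclic_link => //; first exact: (@simplex_sub pointed_cyl).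
  move=> sigma hs sD; have [h1 h2 h3 _] := hs.
  have [x0 sx0] := pcyl_nonempty hs.
  pose le (x y : vert pointed_cyl) : Prop := match x, y with
    | inr q, inr q' => psub (pset q) (pset q') | _, _ => False end.
  have [||m sm hm] := finite_least (le := le) h1 (ex_intro _ x0 sx0).
  - move=> x y sx sy; have [q eq] := sD x sx; have [q' eq'] := sD y sy.
    by subst x y; apply: h3.
  - move=> [//|q] [//|q'] [//|q''] h h' v /h /h'; exact.
  have [q0 e0] := sD m sm; subst m.
  (* The marked vertex of the least member of the chain belongs to every larger member. *)
  exists (inl (pbase q0)); split; first by case.
  move=> S SD hS; apply: pcyl_cone => //.
  - by exists (inr q0); [right | ].
  - move=> x q [<-] hq; have sq : sigma (inr q).
      by case: hq => // Sq; apply: SD Sq _; exists q.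
    by apply: (hm _ sq); case: (proj2_sig q0).
apply: (acyclic_sweq _ _ (pcyl_full A)).
- move=> n s t e; apply: cmap_eq => i.
  by have := f_equal (fun u : CMap (Delta n) pointed_cyl => u i) e => -[].
- move=> n s; split=> [[h1 h2]|[t <-]]; last first.
    split; first exact: (@rng_simplex pointed_cyl).
    by move=> x [i <-] [v].
  have [t ht] : exists t : 'I_n.+1 -> vert K, forall i, inl (t i) = s i.
    suff H i : exists q, inl q = s i by exact: choice_fun H.
    case e : (s i) => [v|q]; first by exists v.
    by case: (h2 (s i)); [exists i | exists q].
  have tS : simplex K (fun x => exists i, t i = x).
    case: h1 => _ h _ _; apply: (simplex_sub h).
      by move=> x [i <-]; exists (s i); rewrite -ht; split=> //; exists i; rewrite ht.
    by exists (t ord0), ord0.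
  by exists (mk_sing tS); apply: cmap_eq.
Qed.

Definition pointed_proj : CMap pointed_cpx K := cmcomp collapse pointed_incl.

Lemma pointed_proj_weq : T_weq pointed_proj.
Proof.
rewrite /T_weq SingMap_comp; apply: sweq_comp; first exact: pointed_incl_weq.
(* [collapse] is a retraction of [base_incl]. *)
apply: (sweq_cancel_r base_incl_weq).
rewrite -SingMap_comp SingMap_id //; exact: sweq_id.
Qed.

Lemma pointed_unit_weq : T_weq (unit_map pointed_cpx).
Proof.
have h S : simplex (Cl (skel pointed_cpx)) S -> simplex pointed_cpx (pimage id S).
  move=> [fS [neS eS]].
  have cmp q q' : S q -> S q' -> psub (pset q) (pset q') \/ psub (pset q') (pset q).
    move=> Sq Sq'; have [[_ _ k _] _] := eS _ _ Sq Sq'.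
    by apply: k; [exists q | exists q']; split=> //; [left | right].
  (* The order is reversed, to find the member with the largest set. That set contains all the
     marked vertices, so they span a simplex and the clique is one. *)
  have [||m Sm hm] := finite_least (le := fun q q' => psub (pset q') (pset q)) fS neS.
  - by move=> q q' Sq Sq'; case: (cmp q q' Sq Sq'); [right | left].
  - by move=> q q' q'' a b x /b /a.
  have [n [g hg]] := fS; split.
  - by exists n, (fun i => inr (g i)) => x [y [[z [Sz <-]] <-]]; have [i <-] := hg z Sz; exists i.
  - apply: (simplex_sub (proj1 (proj2_sig m))).
      move=> x [y [[z [[w [Sw <-]] <-]] <-]] /=; apply: (hm w Sw); exact: proj2 (proj2_sig w).
    by exists (pbase m), (inr m); split=> //; exists m; split=> //; exists m.
  - by move=> q q' [x [[y [Sy <-]] [<-]]] [x' [[y' [Sy' <-]] [<-]]]; apply: cmp.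
  - by move=> x q [y [_ ]].
pose inv : CMap (Cl (skel pointed_cpx)) pointed_cpx :=
  @Build_CMap (Cl (skel pointed_cpx)) pointed_cpx id h.
by apply: (@sweq_iso _ _ _ (SingMap inv)); rewrite -SingMap_comp SingMap_id.
Qed.

End Pointed.

(** * The conditions of a Quillen equivalence *)

Lemma cell_proj_weq K L (phi : CMap K L) : T_weq phi -> T_weq (cell_proj phi).
Proof.
move=> h; apply: (sweq_cancel_r (cell_incl_weq phi)).
by rewrite -SingMap_comp; have -> : cmcomp (cell_proj phi) (cell_incl phi) = phi by apply: cmap_eq.
Qed.

Lemma unit_weq_of_cofibrant K : T_cofibrant K -> T_weq (unit_map K).
Proof.
move=> cK; pose q := pointed_proj K.
have uP : T_weq (unit_map (cell_cpx q)).
  apply: (sweq_cancel_r (cell_incl_weq q)).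
  rewrite (@SingMap_square _ _ _ _ _ _ (unit_map _) (ClMap (skelMap (cell_incl q)))) //.
  by apply: sweq_comp; [exact: pointed_unit_weq | exact: cell_incl_clique_weq].
have [|c [_ hc]] := cK _ _ _ (@cell_proj_fib _ _ q) (cell_proj_weq (pointed_proj_weq K)) (initMap _) (cmid K).
  by case.
apply: (@sweq_retract _ _ _ _ _ _ (SingMap c) (SingMap (cell_proj q))
   (SingMap (ClMap (skelMap c))) (SingMap (ClMap (skelMap (cell_proj q))))) uP.
- by rewrite -SingMap_comp SingMap_id.
- by rewrite -SingMap_comp SingMap_id.
- exact: SingMap_square.
- exact: SingMap_square.
Qed.

Lemma skel_trivial_cof K L (i : CMap K L) : T_cof i -> T_weq i -> M_weq (skelMap i).
Proof.
move=> ci wi.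
have [|c [h1 h2]] := ci _ _ _ (@cell_proj_fib _ _ i) (cell_proj_weq wi) (cell_incl i) (cmid L).
  by [].
apply: (@sweq_retract _ _ _ _ _ _ (SingMap (ClMap (cmid (skel K)))) (SingMap (ClMap (cmid (skel K))))
   (SingMap (ClMap (skelMap c))) (SingMap (ClMap (skelMap (cell_proj i)))) _ _ _ _
   (cell_incl_clique_weq i)).
- by rewrite -SingMap_comp SingMap_id.
- by rewrite -SingMap_comp SingMap_id.
- by apply: SingMap_square => v; rewrite /= h1.
- by apply: SingMap_square.
Qed.

Lemma skel_cof K L (i : CMap K L) : T_cof i -> M_cof (skelMap i).
Proof.
move=> ci X Y p fp wp a b comm.
have [|c [h1 h2]] := ci _ _ _ fp wp (adjunct a) (adjunct b); first exact: comm.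
have hc S : simplex (skel L) S -> simplex X (pimage c S).
  move=> [hS [x [y hxy]]]; have [_ [_ e]] := cfun_simplex c hS.
  have [_ [z Sz]] := simplex_fin hS.
  have ne : pnonempty (pimage c S) by exists (c z), z.
  (* The lift lands in cliques, so its edges must be recovered in [X]. The bounding pair [x], [y]
     need not lie in [S], hence the cases. *)
  have [S1|n1] := classic (S x); have [S2|n2] := classic (S y).
  - apply: (simplex_sub (e (c x) (c y) _ _)) => //; [by exists x | by exists y |].
    by move=> v [w [/hxy [] -> <-]]; [left | right].
  - apply: (simplex_sub (@simplex_single X (c x))) => // v [w [Sw <-]].
    by case: (hxy w Sw) (Sw) => ->.
  - apply: (simplex_sub (@simplex_single X (c y))) => // v [w [Sw <-]].
    by case: (hxy w Sw) (Sw) => ->.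
  - by case: (hxy z Sz) (Sz) => ->.
by exists (@Build_CMap (skel L) X (fun v => c v) hc).
Qed.

Theorem theorem5p9 :
  (forall (K L : Cpx) (i : CMap K L),
      T_cof i -> M_cof (skelMap i)) /\
  (forall (K L : Cpx) (i : CMap K L),
      T_cof i -> T_weq i -> M_cof (skelMap i) /\ M_weq (skelMap i)) /\
  (forall (K : Cpx) (G : Gr), T_cofibrant K -> M_fibrant G ->
      forall f : CMap (skel K) G, M_weq f <-> T_weq (adjunct f)).
Proof.
split; first exact: skel_cof.
split=> [K L i ci wi|K G cK _ f].
  by split; [exact: skel_cof | exact: skel_trivial_cof].
have uK := unit_weq_of_cofibrant cK.
have E : SingMap (adjunct f) = scomp (SingMap (ClMap f)) (SingMap (unit_map K)).
  by rewrite -SingMap_comp; congr SingMap; apply: cmap_eq.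
rewrite /T_weq E; split=> h; first exact: sweq_comp uK h.
exact: sweq_cancel_r uK h.
Qed.
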